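(* Let $n\ge 2$ and $0<r<1$. (i) Let $A^n_r=\{z\in\mathbb{C}^n:\ r<\|z\|<1\}$. Then for every $z\in A^n_r$, $$s_{A^n_r}(z)=\tilde e_{A^n_r}(z)=\frac{\|z\|-r}{1-r\|z\|}.$$ (ii) Let $B^n_r=\{z\in\mathbb{C}^n:\ \|z\|<r\}$. Then for every $z\in\mathbb{D}^n\setminus\overline{B^n_r}$, $$s^{\mathbb{D}^n}_{\mathbb{D}^n\setminus\overline{B^n_r}}(z)=\tilde e^{\mathbb{D}^n}_{\mathbb{D}^n\setminus\overline{B^n_r}}(z)=\min_{w\in\partial B^n_r}\ \max_{1\le i\le n}\left|\frac{|z_i|-|w_i|}{1-|w_i||z_i|}\right|.$$
   Context: $\|\cdot\|$ is the Euclidean norm, $B^n$ the open Euclidean unit ball and $\mathbb{D}^n$ the unit polydisk in $\mathbb{C}^n$, $\mathbb{D}=\mathbb{D}^1$; $O(X,Y)$ is the set of holomorphic maps from $X$ into $Y$. Carathéodory pseudodistance on a domain $D$: $c_D(z,w)=\sup\{\tanh^{-1}|\lambda| : f\in O(D,\mathbb{D}),\ f(z)=0,\ f(w)=\lambda\}$, with balls $B^c_D(z,r)=\{w\in D: c_D(z,w)<r\}$. For $\Omega\in\{B^n,\mathbb{D}^n\}$, let $\rho_\Omega$ be the norm with unit ball $\Omega$ ($\rho_{B^n}(w)=\|w\|$, $\rho_{\mathbb{D}^n}(w)=\max_i|w_i|$). For a bounded domain $D\subset\mathbb{C}^n$ and $z\in D$: generalized squeezing function $s_D^\Omega(z)=\sup\{r>0:\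 \{\rho_\Omega<r\}\subset f(D)$ for some injective $f\in O(D,\Omega)$ with $f(z)=0\}$; Fridman invariant $\tilde e^\Omega_D(z)=\sup\{\tanh(r):\ B^c_D(z,r)\subset f(\Omega)$ for some injective $f\in O(\Omega,D)\}$. Write $s_D=s_D^{B^n}$ and $\tilde e_D=\tilde e_D^{B^n}$. *)

(* Defs.v *)
From HB Require Import structures.
From mathcomp Require Import all_boot all_order all_algebra.
From mathcomp Require Import all_classical all_reals all_analysis.
From mathcomp.real_closed Require Export complex.

Set Implicit Arguments.
Unset Strict Implicit.
Unset Printing Implicit Defensive.

Import Order.TTheory GRing.Theory Num.Theory.
Import numFieldNormedType.Exports.

Local Open Scope classical_set_scope.
Local Open Scope ring_scope.

(* R[i] packed as a numClosedFieldType: 'rV[Cplx R]_n then carries the normed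
   module structure over Cplx R provided for matrices over a numFieldType
   (sup norm, hence the usual topology of C^n). *)
Definition Cplx (R : realType) : numClosedFieldType := R[i].

(* The norm `|z| of R[i] is R[i]-valued; this is the R-valued modulus. *)
Definition cmod (R : realType) (z : Cplx R) : R := ComplexField.Normc.normc z.

Definition artanh (R : realType) (x : R) : R := ln ((1 + x) / (1 - x)) / 2.

Definition tanh (R : realType) (x : R) : R :=
  (expR x - expR (- x)) / (expR x + expR (- x)).

(* O(X, Y) for X open: maps are total functions, only their values on X matter.
   [differentiable] is Frechet differentiability over the scalar field Cplx R,
   i.e. complex differentiability. *)
Definition holo (R : realType) (V W : normedModType (Cplx R))
    (X : set V) (Y : set W) : set (V -> W) :=
  [set f | (forall x, X x -> differentiable f x) /\ f @` X `<=` Y].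

Definition frontier (T : topologicalType) (A : set T) : set T :=
  closure A `\` interior A.

Definition euclid_norm (R : realType) (n : nat) (z : 'rV[Cplx R]_n) : R :=
  Num.sqrt (\sum_(i < n) cmod (z ord0 i) ^+ 2).

Definition max_norm (R : realType) (n : nat) (z : 'rV[Cplx R]_n) : R :=
  \big[Num.max/0]_(i < n) cmod (z ord0 i).

Definition norm_ball (R : realType) (n : nat) (rho : 'rV[Cplx R]_n -> R)
    (r : R) : set 'rV[Cplx R]_n :=
  [set w | rho w < r].

Definition unit_disk (R : realType) : set (Cplx R)^o :=
  [set l | cmod l < 1].

Definition caratheodory (R : realType) (n : nat) (D : set 'rV[Cplx R]_n)
    (z w : 'rV[Cplx R]_n) : \bar R :=
  ereal_sup [set (artanh (cmod l))%:E | l in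
    [set l : (Cplx R)^o |
      exists2 f, holo D (@unit_disk R) f & f z = 0 /\ f w = l]].

Definition caratheodory_ball (R : realType) (n : nat) (D : set 'rV[Cplx R]_n)
    (z : 'rV[Cplx R]_n) (r : R) : set 'rV[Cplx R]_n :=
  [set w | D w /\ (caratheodory D z w < r%:E)%E].

(* Omega is the unit ball of the norm rho: B^n for rho = euclid_norm, the
   polydisk D^n for rho = max_norm. *)
Definition squeezing (R : realType) (n : nat) (rho : 'rV[Cplx R]_n -> R)
    (D : set 'rV[Cplx R]_n) (z : 'rV[Cplx R]_n) : \bar R :=
  ereal_sup [set r%:E | r in
    [set r : R | 0 < r /\
      exists f, [/\ holo D (norm_ball rho 1) f, set_inj D f, f z = 0 &
                    norm_ball rho r `<=` f @` D]]].

Definition fridman (R : realType) (n : nat) (rho : 'rV[Cplx R]_n -> R)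
    (D : set 'rV[Cplx R]_n) (z : 'rV[Cplx R]_n) : \bar R :=
  ereal_sup [set (tanh r)%:E | r in
    [set r : R |
      exists f, [/\ holo (norm_ball rho 1) D f, set_inj (norm_ball rho 1) f &
                    caratheodory_ball D z r `<=` f @` norm_ball rho 1]]].

Definition annulus (R : realType) (n : nat) (r : R) : set 'rV[Cplx R]_n :=
  [set z | r < euclid_norm z < 1].

Definition polydisk_minus_ball (R : realType) (n : nat) (r : R) :
    set 'rV[Cplx R]_n :=
  norm_ball (@max_norm R n) 1 `\` closure (norm_ball (@euclid_norm R n) r).

Definition is_minimum (R : realType) (T : Type) (A : set T) (F : T -> R)
    (m : R) : Prop :=
  (exists2 w, A w & F w = m) /\ (forall w, A w -> m <= F w).

(* Main.v *)
(* Let [rho] be the norm of the model domain Omega (the Euclidean norm or the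
   sup norm), D = Omega minus the closed Euclidean ball K of radius r, and
   phi the involutive automorphism of Omega exchanging z and 0.

   Hartogs-Schwarz: a holomorphic f : D -> disk with f z = 0 satisfies
   |f x| <= rho (phi x).  The mean F y of f (t y) t / (t - 1) over a circle
   |t| = s with s > 1 is independent of s and extends f across K \ {0}: the
   difference F - f is the analogous mean over a circle with s < 1, which is
   holomorphic for |y| > r and tends to 0 at infinity along a complex line
   orthogonal to y.  Then F composed with a disc t |-> phi (t u) is bounded,
   of modulus <= 1 near the unit circle, and holomorphic off at most one point
   distinct from 0, so the Schwarz lemma applies.  In particular the
   Caratheodory pseudodistance of D is artanh (rho (phi x)).

   Let m be the minimum of rho (phi w) over K, attained at w0 with |w0| = r.
   The maps phi and phi (m .) show that both invariants are at least m.  If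
   the squeezing function were larger, a competitor f would send points of D
   tending to w0 into a compact subset of f (D), which its local inverse
   forbids.  If the Fridman invariant were larger, the image of a competitor f
   would contain all points of D near w0; the maximum principle for the
   inverse of f on discs orthogonal to w0 keeps the preimages of (1 + t) w0 in
   a compact part of Omega, so w0 would lie in f (Omega).  Both steps use
   Osgood's theorem: an injective holomorphic map has invertible derivative. *)

Require Import Defs.
From HB Require Import structures.
From mathcomp Require Import all_boot all_order all_algebra.
From mathcomp Require Import perm.
From mathcomp Require Import all_classical all_reals all_analysis.
From mathcomp Require Import ring lra.

Set Implicit Arguments.
Unset Strict Implicit.
Unset Printing Implicit Defensive.

Import Order.TTheory GRing.Theory Num.Theory.
Import numFieldNormedType.Exports.

Local Open Scope classical_set_scope.
Local Open Scope ring_scope.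

(** * Real-valued norms over [Cplx R] *)

(** One-variable analysis is phrased throughout in terms of the mean [circ r k] of a function over a
    circle. Its independence of the radius is Goursat's theorem pulled back by the exponential;
    removable singularities, the maximum principle, the Schwarz lemma and Hurwitz's theorem are read
    off from it. Both parts are instances of one statement about two norms, [rho] for the model
    domain and [E] for the hole. Averaging over dilations suits any such pair, but degenerates at
    the point 0 of the hole; this is why the Schwarz lemma has to tolerate one bounded singularity.
    Dimension at least 2 enters through the orthogonal direction, along which [E] strictly grows.
    The overview minimizes over the closed ball K, the theorem over its boundary and over moduli
    only. In the polydisk the two minima are reconciled by aligning arguments with those of [z] and
    by moving moduli towards those of [z] until the sphere is met. In Osgood's theorem the obstacle
    is a kernel of dimension at least 2, where no one-variable reduction is available; there
    constancy of [f] is proved along curves that are only Lipschitz. *)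

Definition rc (R : realType) (x : R) : Cplx R := Complex x 0.

Section RealNorm.
Variable R : realType.
Local Notation C := (Cplx R).

Lemma rcD (x y : R) : rc (x + y) = rc x + rc y.
Proof. exact: (rmorphD (real_complex R)). Qed.
Lemma rcN (x : R) : rc (- x) = - rc x.
Proof. exact: (rmorphN (real_complex R)). Qed.
Lemma rcB (x y : R) : rc (x - y) = rc x - rc y.
Proof. exact: (rmorphB (real_complex R)). Qed.
Lemma rcM (x y : R) : rc (x * y) = rc x * rc y.
Proof. exact: (rmorphM (real_complex R)). Qed.
Lemma rc0 : rc (0 : R) = 0. Proof. by []. Qed.
Lemma rc1 : rc (1 : R) = 1. Proof. by []. Qed.
Lemma rcV (x : R) : rc x^-1 = (rc x)^-1.
Proof. exact: (fmorphV (real_complex R)). Qed.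
Lemma rcX (x : R) k : rc (x ^+ k) = rc x ^+ k.
Proof. exact: (rmorphXn (real_complex R)). Qed.
Lemma rc_nat k : rc (k%:R : R) = k%:R.
Proof. exact: (rmorph_nat (real_complex R)). Qed.
Lemma rc_inj : injective (@rc R). Proof. by move=> x y []. Qed.
Lemma rc_eq0 (x : R) : (rc x == 0) = (x == 0).
Proof. by rewrite -rc0 (inj_eq rc_inj). Qed.
Lemma ler_rc (x y : R) : (rc x <= rc y) = (x <= y).
Proof. exact: lecR. Qed.
Lemma ltr_rc (x y : R) : (rc x < rc y) = (x < y).
Proof. exact: ltcR. Qed.

Lemma cE (z : C) : z = rc (complex.Re z) + 'i%C * rc (complex.Im z).
Proof. exact: complexE. Qed.

Lemma rc_ge0E (z : C) : 0 <= z -> z = rc (complex.Re z).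
Proof. by case: z => a b; rewrite lecE /= => /andP[/eqP -> _]. Qed.

(* The norm of a normed module over [Cplx R] is itself [Cplx R]-valued; [rn] is
   its real value. *)
Definition rn (W : normedModType C) (x : W) : R := complex.Re (`|x| : C).

Section rn.
Variable W : normedModType C.
Implicit Types x y : W.

Lemma rnE x : `|x| = rc (rn x).
Proof. by rewrite /rn -rc_ge0E. Qed.

Lemma rn_ge0 x : 0 <= rn x.
Proof. by rewrite -ler_rc -rnE rc0. Qed.

Lemma rn0 : rn (0 : W) = 0.
Proof. by apply: rc_inj; rewrite -rnE normr0 rc0. Qed.

Lemma rn_eq0 x : (rn x == 0) = (x == 0).
Proof. by rewrite -rc_eq0 -rnE normr_eq0. Qed.

Lemma rn_gt0 x : (0 < rn x) = (x != 0).
Proof. by rewrite lt0r rn_ge0 andbT rn_eq0. Qed.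

Lemma rnN x : rn (- x) = rn x.
Proof. by apply: rc_inj; rewrite -!rnE normrN. Qed.

Lemma rnD x y : rn (x + y) <= rn x + rn y.
Proof. by rewrite -ler_rc rcD -!rnE ler_normD. Qed.

Lemma rnB x y : rn (x - y) <= rn x + rn y.
Proof. by rewrite -(rnN y); exact: rnD. Qed.

Lemma rnC x y : rn (x - y) = rn (y - x).
Proof. by rewrite -opprB rnN. Qed.

Lemma rn_sub x y z : rn (x - z) <= rn (x - y) + rn (y - z).
Proof. by apply: le_trans (rnD _ _); rewrite addrA subrK. Qed.

Lemma rn_ler_sub x y : rn x - rn y <= rn (x - y).
Proof. by rewrite lerBlDr; apply: le_trans (rnD _ _); rewrite subrK. Qed.

Lemma rn_dist x y : `|rn x - rn y| <= rn (x - y).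
Proof.
by rewrite ler_norml rn_ler_sub andbT lerNl opprB rnC rn_ler_sub.
Qed.

Lemma rn_sum (I : Type) (s : seq I) (P : pred I) (F : I -> W) :
  rn (\sum_(i <- s | P i) F i) <= \sum_(i <- s | P i) rn (F i).
Proof.
elim/big_rec2: _ => [|i x y _ le]; first by rewrite rn0.
by apply: le_trans (rnD _ _) _; rewrite lerD2l.
Qed.

Lemma nbhs_rnP (a : W) (P : set W) :
  nbhs a P <-> exists2 e : R, 0 < e & forall x, rn (x - a) < e -> P x.
Proof.
split.
  move=> /nbhs_ballP[e /= e0 H].
  have ee : e = rc (complex.Re e) by apply: rc_ge0E; exact: ltW.
  exists (complex.Re e); first by rewrite -ltr_rc rc0 -ee.
  move=> x; rewrite rnC -ltr_rc -rnE -ee => xe; apply: H.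
  by rewrite -ball_normE.
move=> [e e0 H]; apply/nbhs_ballP; exists (rc e).
  by rewrite /= -rc0 ltr_rc.
by move=> x; rewrite -ball_normE /= => xa; apply: H; rewrite rnC -ltr_rc -rnE.
Qed.

End rn.

Lemma rnZ (W : normedModType C) (c : C) (x : W) : rn (c *: x) = rn c * rn x.
Proof. by apply: rc_inj; rewrite rcM -!rnE normrZ. Qed.

Lemma rnM (x y : C) : rn (x * y) = rn x * rn y.
Proof. by apply: rc_inj; rewrite rcM -!rnE normrM. Qed.

Lemma rnV (x : C) : rn x^-1 = (rn x)^-1.
Proof. by apply: rc_inj; rewrite rcV -!rnE normfV. Qed.

Lemma rnX (x : C) k : rn (x ^+ k) = rn x ^+ k.
Proof. by apply: rc_inj; rewrite rcX -!rnE normrX. Qed.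

Lemma rn1 : rn (1 : C) = 1.
Proof. by apply: rc_inj; rewrite -rnE normr1. Qed.

Lemma rn_cmod (z : C) : rn z = cmod z.
Proof. by []. Qed.

Lemma rn_rc (x : R) : rn (rc x) = `|x|.
Proof. by rewrite rn_cmod /cmod /= expr0n /= addr0 sqrtr_sqr. Qed.

Lemma rn_sqr (z : C) : rn z ^+ 2 = complex.Re z ^+ 2 + complex.Im z ^+ 2.
Proof.
case: z => a b; rewrite rn_cmod /cmod /= sqr_sqrtr //.
by rewrite addr_ge0 // sqr_ge0.
Qed.

Lemma ler_rn_Re (z : C) : `|complex.Re z| <= rn z.
Proof.
rewrite -(@ler_pXn2r _ 2) ?nnegrE ?rn_ge0 ?normr_ge0 //.
by rewrite rn_sqr real_normK ?num_real // lerDl sqr_ge0.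
Qed.

Lemma ler_rn_Im (z : C) : `|complex.Im z| <= rn z.
Proof.
rewrite -(@ler_pXn2r _ 2) ?nnegrE ?rn_ge0 ?normr_ge0 //.
by rewrite rn_sqr real_normK ?num_real // lerDr sqr_ge0.
Qed.

Lemma rn_i : rn ('i%C : C) = 1.
Proof.
by rewrite rn_cmod /cmod /= expr0n /= add0r expr1n sqrtr1.
Qed.

Lemma continuous_rnP (V W : normedModType C) (f : V -> W) (a : V) :
  {for a, continuous f} <->
  forall e : R, 0 < e -> exists2 d : R, 0 < d &
    forall x, rn (x - a) < d -> rn (f x - f a) < e.
Proof.
split=> [cf e e0|H].
  have : nbhs (f a) [set y | rn (y - f a) < e] by apply/nbhs_rnP; exists e.
  by move=> /cf /nbhs_rnP[d d0 h]; exists d.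
move=> P /nbhs_rnP[e e0 he]; have [d d0 hd] := H e e0.
by apply/nbhs_rnP; exists d => // x /hd; apply: he.
Qed.

Lemma rn_continuous (W : normedModType C) : continuous (@rn W).
Proof.
move=> x; apply/cvgrPdist_lt => e e0.
apply/nbhs_rnP; exists e => // y yx.
by apply: le_lt_trans (rn_dist _ _) _; rewrite rnC.
Qed.

Lemma rc_continuous : continuous (@rc R).
Proof.
move=> x P /nbhs_rnP[e e0 he]; apply/nbhs_ballP; exists e => //= y.
by rewrite -ball_normE /= distrC => h; apply: he; rewrite -rcB rn_rc.
Qed.

Lemma compact_cbox (M : R) : compact [set z : C | `|complex.Re z| <= M /\ `|complex.Im z| <= M].
Proof.
have -> : [set z : C | `|complex.Re z| <= M /\ `|complex.Im z| <= M] =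
   (fun p : R * R => rc p.1 + 'i%C * rc p.2) @` (`[- M, M] `*` `[- M, M]).
  apply/seteqP; split=> [z /= [h1 h2]|z /= [[x y] /= [h1 h2] <-]].
    exists (complex.Re z, complex.Im z) => /=; last by rewrite -cE.
    by rewrite !in_itv /= -!ler_norml.
  rewrite !in_itv /= -!ler_norml in h1 h2.
  by rewrite /rc /=; simpc.
apply: continuous_compact; last by apply: compact_setX; exact: segment_compact.
apply: continuous_subspaceT => p.
apply: cvgD.
  by apply: continuous_comp; [exact: cvg_fst|exact: rc_continuous].
apply: cvgM; first exact: cvg_cst.
by apply: continuous_comp; [exact: cvg_snd|exact: rc_continuous].
Qed.

Lemma complex_hausdorff : hausdorff_space C.
Proof. exact: norm_hausdorff. Qed.

Lemma continuous_coord n (i : 'I_n) : continuous (fun v : 'rV[C]_n => v ord0 i).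
Proof. by move=> v; exact: coord_continuous. Qed.

Lemma rn_coord n (v : 'rV[C]_n) i : rn (v ord0 i) <= rn v.
Proof.
rewrite -ler_rc -!rnE.
rewrite [X in _ <= X]/Num.norm /= mx_normE.
by rewrite -[leLHS]nngE num_le; exact: (@le_bigmax _ _ _ _ (fun ij : 'I_1 * 'I_n => (`|v ij.1 ij.2|%:nng)%R) (ord0, i)).
Qed.

Lemma rn_rV_le n (v : 'rV[C]_n) (M : R) : 0 <= M ->
  (forall i, rn (v ord0 i) <= M) -> rn v <= M.
Proof.
move=> M0 H; have [->|v0] := eqVneq v 0; first by rewrite rn0.
have [i vi] := @mx_norm_neq0 _ _ _ v (contra_neq (@mx_norm_eq0 _ _ _ v) v0).
have -> : rn v = rn (v i.1 i.2) by apply: rc_inj; rewrite -!rnE -vi.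
by rewrite ord1.
Qed.

Lemma rn_rV n (v : 'rV[C]_n) : rn v = max_norm v.
Proof.
apply/eqP; rewrite eq_le; apply/andP; split.
  apply: rn_rV_le => [|i]; first exact: bigmax_ge_id.
  by rewrite rn_cmod; exact: le_bigmax.
apply: bigmax_le => [|i _]; first exact: rn_ge0.
by rewrite -rn_cmod rn_coord.
Qed.

Lemma closed_preimage (T : topologicalType) (f : T -> R) (A : set R) :
  continuous f -> closed A -> closed (f @^-1` A).
Proof. by move=> /continuous_closedP; apply. Qed.

Lemma compact_C_bounded (A : set C) (M : R) :
  closed A -> (forall z, A z -> rn z <= M) -> compact A.
Proof.
move=> cA hA; apply: subclosed_compact cA (@compact_cbox M) _ => z /hA zM.
by split; apply: le_trans zM; [exact: ler_rn_Re|exact: ler_rn_Im].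
Qed.

Lemma continuous_rn_sub (W : normedModType C) (c : W) : continuous (fun z => rn (z - c)).
Proof.
move=> z; apply: (@continuous_comp _ _ _ (fun z => z - c) (@rn W)).
  by apply: cvgB; [exact: cvg_id|exact: cvg_cst].
exact: rn_continuous.
Qed.

Lemma compact_C_sphere (c : C) (r : R) : compact [set z | rn (z - c) = r].
Proof.
apply: (@compact_C_bounded _ (rn c + r)).
  exact: (closed_preimage (@continuous_rn_sub _ c) (@closed_eq R r)).
by move=> z /= <-; rewrite -lerBlDl rn_ler_sub.
Qed.

Lemma compact_C_annulus (c : C) (r s : R) : compact [set z | r <= rn (z - c) <= s].
Proof.
apply: (@compact_C_bounded _ (rn c + s)).
  have := closed_preimage (@continuous_rn_sub _ c) (@itv_closed _ R r s).
  by congr closed; apply/seteqP; split => z /=; rewrite in_itv.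
by move=> z /= /andP[_ zs]; rewrite -lerBlDl; apply: le_trans zs; rewrite rn_ler_sub.
Qed.

Lemma compact_max (T : topologicalType) (f : T -> R) (A : set T) :
  A !=set0 -> compact A -> (forall x, A x -> {for x, continuous f}) ->
  exists2 x, A x & forall y, A y -> f y <= f x.
Proof.
move=> A0 cA cf; have [|x Ax xm] := @compact_EVT_max _ R f A A0 cA.
  by apply: continuous_in_subspaceT => x; rewrite inE; exact: cf.
by exists x; [rewrite inE in Ax|move=> y Ay; apply: xm; rewrite inE].
Qed.

Lemma compact_min (T : topologicalType) (f : T -> R) (A : set T) :
  A !=set0 -> compact A -> (forall x, A x -> {for x, continuous f}) ->
  exists2 x, A x & forall y, A y -> f x <= f y.
Proof.
move=> A0 cA cf; have [|x Ax xm] := @compact_EVT_min _ R f A A0 cA.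
  by apply: continuous_in_subspaceT => x; rewrite inE; exact: cf.
by exists x; [rewrite inE in Ax|move=> y Ay; apply: xm; rewrite inE].
Qed.

Lemma compact_rV_bounded n (A : set 'rV[C]_n) (M : R) :
  closed A -> (forall v, A v -> rn v <= M) -> compact A.
Proof.
move=> cA hA.
have cB := @rV_compact C n _ (fun=> @compact_cbox M).
apply: subclosed_compact cA cB _.
move=> v /hA vM i /=; have := le_trans (rn_coord v i) vM.
by move=> h; split; apply: le_trans h; [exact: ler_rn_Re|exact: ler_rn_Im].
Qed.

End RealNorm.

(** * Calculus of continuity at a single point *)

Section PointwiseContinuity.
Variables (R : realType) (T : topologicalType).
Local Notation C := (Cplx R).
Variable (W : normedModType C).
Implicit Types (a : T).

Lemma cfor_cst (U : topologicalType) (c : U) a : {for a, continuous (fun=> c)}.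
Proof. exact: cvg_cst. Qed.

Lemma cfor_id a : {for a, continuous id}.
Proof. exact: cvg_id. Qed.

Lemma cfor_comp (U V : topologicalType) (f : T -> U) (g : U -> V) a :
  {for a, continuous f} -> {for f a, continuous g} ->
  {for a, continuous (fun z => g (f z))}.
Proof. by move=> cf cg; exact: continuous_comp cf cg. Qed.

Lemma cfor_pair (U V : topologicalType) (f : T -> U) (g : T -> V) a :
  {for a, continuous f} -> {for a, continuous g} ->
  {for a, continuous (fun z => (f z, g z))}.
Proof. by move=> cf cg; exact: cvg_pair cf cg. Qed.

Lemma cfor_near (U : topologicalType) (f g : T -> U) a :
  (\forall z \near a, f z = g z) -> {for a, continuous f} ->
  {for a, continuous g}.
Proof.
move=> fg cf P; rewrite -(nbhs_singleton fg) => /cf nP.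
by apply: filterS2 fg nP => z /= ->.
Qed.

Lemma cforDv (f g : T -> W) a : {for a, continuous f} ->
  {for a, continuous g} -> {for a, continuous (fun z => f z + g z)}.
Proof. by move=> cf cg; exact: cvgD cf cg. Qed.

Lemma cforZv (f : T -> C) (g : T -> W) a : {for a, continuous f} ->
  {for a, continuous g} -> {for a, continuous (fun z => f z *: g z)}.
Proof. by move=> cf cg; exact: cvgZ cf cg. Qed.

Lemma cforD (f g : T -> C) a : {for a, continuous f} ->
  {for a, continuous g} -> {for a, continuous (fun z => f z + g z)}.
Proof. by move=> cf cg; exact: cvgD cf cg. Qed.

Lemma cforN (f : T -> C) a : {for a, continuous f} ->
  {for a, continuous (fun z => - f z)}.
Proof. by move=> cf; exact: cvgN cf. Qed.

Lemma cforB (f g : T -> C) a : {for a, continuous f} ->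
  {for a, continuous g} -> {for a, continuous (fun z => f z - g z)}.
Proof. by move=> cf cg; exact: cvgB cf cg. Qed.

Lemma cforM (f g : T -> C) a : {for a, continuous f} ->
  {for a, continuous g} -> {for a, continuous (fun z => f z * g z)}.
Proof. by move=> cf cg; exact: cvgM cf cg. Qed.

Lemma cforV (f : T -> C) a : {for a, continuous f} -> f a != 0 ->
  {for a, continuous (fun z => (f z)^-1)}.
Proof. by move=> cf fa; exact: cvgV fa cf. Qed.

Lemma cfor_rc (f : T -> R) a : {for a, continuous f} ->
  {for a, continuous (fun z => rc (f z))}.
Proof. by move=> cf; apply: cfor_comp cf _; exact: rc_continuous. Qed.

Lemma cfor_rn (f : T -> W) a : {for a, continuous f} ->
  {for a, continuous (fun z => rn (f z))}.
Proof. by move=> cf; apply: cfor_comp cf _; exact: rn_continuous. Qed.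

Lemma cfor_rnP (f : T -> W) a : {for a, continuous f} <->
  forall e : R, 0 < e -> \forall z \near a, rn (f z - f a) < e.
Proof.
split=> [cf e e0|H P /nbhs_rnP[e e0 he]].
  by apply: (cf [set y | rn (y - f a) < e]); apply/nbhs_rnP; exists e.
by apply: filterS (H e e0) => z; exact: he.
Qed.

End PointwiseContinuity.

(** * Dyadic integrals over [0, 1] *)

Section DyadicIntegral.
Variable R : realType.
Local Notation C := (Cplx R).
Implicit Types (f g : R -> C).

(* Left Riemann sum of [f] over the dyadic subdivision of [0, 1] into 2^k pieces. *)
Fixpoint dsum (k : nat) f : C :=
  if k is k'.+1 then
    (dsum k' (fun t => f (t / 2)) + dsum k' (fun t => f ((1 + t) / 2))) / 2
  else f 0.

(** [dsum k.+1] averages the sums of the two halves, so the halving rule [dint_half], on which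
    Goursat's subdivision rests, holds already before the limit. For [cont01] functions the limit
    exists by [dsum_cvg]. *)
Definition dint f : C := lim (dsum^~ f @ \oo).

(** Continuity at each point of [0, 1] is taken in R, hence two-sided also at 0 and 1; an integrand
    controlled on [0, 1] alone is first composed with [clip01]. *)
Definition cont01 f := forall t : R, 0 <= t <= 1 -> {for t, continuous f}.

Let half01 (t : R) : 0 <= t <= 1 -> 0 <= t / 2 <= 1.
Proof. by move=> t01; lra. Qed.

Let half01' (t : R) : 0 <= t <= 1 -> 0 <= (1 + t) / 2 <= 1.
Proof. by move=> t01; lra. Qed.

Lemma dsum_ext k f g : (forall t : R, 0 <= t <= 1 -> f t = g t) ->
  dsum k f = dsum k g.
Proof.
elim: k f g => [|k IH] f g fg /=; first by apply: fg; lra.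
by congr ((_ + _) / _); apply: IH => t t01; apply: fg; auto.
Qed.

Lemma dsumD k f g : dsum k (fun t => f t + g t) = dsum k f + dsum k g.
Proof. by elim: k f g => [|k IH] f g //=; rewrite !IH; ring. Qed.

Lemma dsumZ k (c : C) f : dsum k (fun t => c * f t) = c * dsum k f.
Proof. by elim: k f => [|k IH] f //=; rewrite !IH; ring. Qed.

Lemma dsum_cst k (c : C) : dsum k (fun=> c) = c.
Proof. by elim: k => [|k IH] //=; rewrite !IH; field. Qed.

Lemma rn2 : rn (2 : C) = 2.
Proof. by rewrite -[2 : C]rc_nat rn_rc ger0_norm. Qed.

Lemma rn_half (z : C) : rn (z / 2) = rn z / 2.
Proof. by rewrite rnM rnV rn2. Qed.

Lemma rn_dsum k f (M : R) : (forall t : R, 0 <= t <= 1 -> rn (f t) <= M) ->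
  rn (dsum k f) <= M.
Proof.
elim: k f => [|k IH] f fM /=; first by apply: fM; lra.
rewrite rn_half; apply: (@le_trans _ _ ((M + M) / 2)); last by lra.
by rewrite ler_pM2r ?invr_gt0 ?ltr0n // (le_trans (rnD _ _)) // lerD //;
  apply: IH => t t01; apply: fM; auto.
Qed.

(** Rescaling a half-interval to [0, 1] doubles distances, so the induction on [k] ends with a sum
    over [0, 1] compared to the single value [f 0], where the whole oscillation is at most [e]. *)
Lemma dsum_osc k m f (e : R) :
  (forall s t : R, 0 <= s <= 1 -> 0 <= t <= 1 -> `|s - t| <= (2 ^+ k)^-1 ->
    rn (f s - f t) <= e) ->
  rn (dsum (k + m) f - dsum k f) <= e.
Proof.
elim: k f => [|k IH] f fe.
  rewrite add0n /= (_ : _ - _ = dsum m (fun t => f t + - f 0)).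
    apply: rn_dsum => t t01; apply: fe => //; first by lra.
    by rewrite expr0 invr1 subr0 ger0_norm; lra.
  by rewrite dsumD dsum_cst.
rewrite addSn /= -mulrBl rn_half opprD addrACA.
apply: (@le_trans _ _ ((e + e) / 2)); last by lra.
rewrite ler_pM2r ?invr_gt0 ?ltr0n // (le_trans (rnD _ _)) // lerD //;
  apply: IH => s t s01 t01 st; (apply: fe; [by auto|by auto|]).
  rewrite -mulrBl normrM exprS invfM mulrC (@ger0_norm _ 2^-1) ?invr_ge0 ?ler0n//.
  by rewrite ler_pM2l ?invr_gt0 ?ltr0n.
rewrite -mulrBl normrM exprS invfM mulrC (@ger0_norm _ 2^-1) ?invr_ge0 ?ler0n//.
by rewrite ler_pM2l ?invr_gt0 ?ltr0n // opprD addrACA subrr add0r.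
Qed.

(** Compactness of [0, 1] is applied to the increment [h = s - t] near 0; thus [s] may fall outside
    of [0, 1]. *)
Lemma unif01 f : cont01 f -> forall e : R, 0 < e ->
  exists2 d : R, 0 < d & forall s t : R, 0 <= t <= 1 -> `|s - t| < d ->
    rn (f s - f t) < e.
Proof.
move=> cf e e0.
have := @segment_compact R 0 1 => /compact_near_coveringP.
move=> /(_ R (nbhs (0 : R)) (fun h t => rn (f (t + h) - f t) < e) _).
case.
  move=> t; rewrite /= in_itv /= => t01.
  have := cf t t01 => cft.
  have : \forall s \near t, rn (f s - f t) < e / 2.
    apply: (cft [set y | rn (y - f t) < e / 2]); apply/nbhs_rnP; exists (e / 2) => //; lra.
  move=> /nbhs_ballP[d /= d0 hd].
  exists (ball t (d / 2), ball 0 (d / 2)); first by split; apply: nbhsx_ballx; lra.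
  move=> [x h] /= [tx h0].
  rewrite -ball_normE /= in tx h0.
  rewrite sub0r normrN in h0.
  have h1 : rn (f (x + h) - f t) < e / 2.
    apply: (@hd (x + h)); rewrite -ball_normE /= opprD addrA.
    by apply: le_lt_trans (ler_normB _ _) _; lra.
  have h2 : rn (f x - f t) < e / 2.
    by apply: (@hd x); rewrite -ball_normE /=; lra.
  apply: le_lt_trans (rn_sub _ (f t) _) _; rewrite (rnC (f t)); lra.
move=> d /= d0 hd; exists d => // s t t01 st.
have := hd (s - t); rewrite /= sub0r normrN => /(_ st t).
by rewrite /= in_itv /= (addrC t) subrK; apply.
Qed.

Lemma cvg_C (u : nat -> C) :
  (forall e : R, 0 < e -> exists k, forall m, rn (u (k + m)%N - u k) <= e) ->
  cvg (u @ \oo).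
Proof.
move=> H.
have aux (p : C -> R) : (forall x y, p x - p y = p (x - y)) ->
    (forall x, `|p x| <= rn x) -> cvg ((fun k => p (u k)) @ \oo).
  move=> pB pn; apply/cauchy_cvgP/cauchy_exP => e e0.
  have [k hk] := H (e / 2) ltac:(lra).
  exists (p (u k)); exists k => // n /= kn.
  rewrite -ball_normE /= distrC pB; apply: le_lt_trans (pn _) _.
  by rewrite -(subnKC kn); apply: le_lt_trans (hk _) _; lra.
have c1 := aux (@complex.Re R) (fun x y => esym (raddfB _ x y)) (@ler_rn_Re R).
have c2 := aux (@complex.Im R) (fun x y => esym (raddfB _ x y)) (@ler_rn_Im R).
have -> : u = (fun k => rc (complex.Re (u k)) + 'i%C * rc (complex.Im (u k))).
  by apply/funext => k; rewrite -cE.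
apply: is_cvgD; last apply: is_cvgM.
- apply/cvg_ex; eexists; apply: continuous_cvg c1; exact: rc_continuous.
- exact: is_cvg_cst.
- apply/cvg_ex; eexists; apply: continuous_cvg c2; exact: rc_continuous.
Qed.

Lemma dsum_cvg f : cont01 f -> dsum^~ f @ \oo --> dint f.
Proof.
move=> cf; apply: cvg_C => e e0.
have [d d0 hd] := unif01 cf e0.
have [k hk] : exists k, (2 ^+ k)^-1 < d.
  have /cvgrPdist_lt /(_ d d0) [k _ hk] := @cvg_geometric R 1 2^-1 ltac:(rewrite ger0_norm; lra).
  exists k; have := hk k (leqnn k).
  by rewrite /geometric /= mul1r sub0r normrN exprVn ger0_norm // invr_ge0 exprn_ge0.
exists k => m; apply: dsum_osc => s t s01 t01 st; apply/ltW/hd => //.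
exact: le_lt_trans st hk.
Qed.

Lemma cont01D f g : cont01 f -> cont01 g -> cont01 (fun t => f t + g t).
Proof. by move=> cf cg t t01; apply: cvgD; [exact: cf|exact: cg]. Qed.

Lemma cont01M f g : cont01 f -> cont01 g -> cont01 (fun t => f t * g t).
Proof. by move=> cf cg t t01; apply: cvgM; [exact: cf|exact: cg]. Qed.

Lemma cont01_cst (c : C) : cont01 (fun=> c).
Proof. by move=> t t01; exact: cvg_cst. Qed.

Lemma dintE f (l : C) : dsum^~ f @ \oo --> l -> dint f = l.
Proof. by move=> h; apply: cvg_lim h; exact: complex_hausdorff. Qed.

Lemma dint_ext f g : (forall t : R, 0 <= t <= 1 -> f t = g t) ->
  dint f = dint g.
Proof.
move=> fg; rewrite /dint (_ : dsum^~ f = dsum^~ g) //.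
by apply/funext => k; exact: dsum_ext.
Qed.

Lemma dintD f g : cont01 f -> cont01 g ->
  dint (fun t => f t + g t) = dint f + dint g.
Proof.
move=> cf cg; apply: dintE; under eq_fun do rewrite dsumD.
by apply: cvgD; exact: dsum_cvg.
Qed.

Lemma dintZ (c : C) f : cont01 f -> dint (fun t => c * f t) = c * dint f.
Proof.
move=> cf; apply: dintE; under eq_fun do rewrite dsumZ.
by apply: cvgM; [exact: cvg_cst|exact: dsum_cvg].
Qed.

Lemma dint_cst (c : C) : dint (fun=> c) = c.
Proof.
by apply: dintE; under eq_fun do rewrite dsum_cst; exact: cvg_cst.
Qed.

Lemma dintB f g : cont01 f -> cont01 g ->
  dint (fun t => f t - g t) = dint f - dint g.
Proof.
move=> cf cg.
have cN : cont01 (fun t => -1 * g t) by apply: cont01M cg; exact: cont01_cst.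
rewrite -[- dint g]mulN1r -(dintZ _ cg) -(dintD cf cN).
by apply: dint_ext => t _; rewrite mulN1r.
Qed.

Lemma rn_dint f (M : R) : cont01 f ->
  (forall t : R, 0 <= t <= 1 -> rn (f t) <= M) -> rn (dint f) <= M.
Proof.
move=> cf fM; have c : (fun k => rn (dsum k f)) @ \oo --> rn (dint f).
  by apply: continuous_cvg; [exact: rn_continuous|exact: dsum_cvg].
rewrite -(cvg_lim _ c); last exact: (@Rhausdorff R).
apply: limr_le; first by apply/cvg_ex; eexists; exact: c.
by near=> k; exact: rn_dsum.
Unshelve. all: by end_near. Qed.

Lemma cont01_half f : cont01 f -> cont01 (fun t => f (t / 2)).
Proof.
move=> cf t t01; apply: continuous_comp; last by apply: cf; auto.
by apply: cvgM; [exact: cvg_id|exact: cvg_cst].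
Qed.

Lemma cont01_half' f : cont01 f -> cont01 (fun t => f ((1 + t) / 2)).
Proof.
move=> cf t t01; apply: continuous_comp; last by apply: cf; auto.
apply: cvgM; last exact: cvg_cst.
by apply: cvgD; [exact: cvg_cst|exact: cvg_id].
Qed.

Lemma dint_half f : cont01 f ->
  dint f = (dint (fun t => f (t / 2)) + dint (fun t => f ((1 + t) / 2))) / 2.
Proof.
move=> cf; apply: dintE; rewrite -cvg_shiftS /=.
apply: cvgM; last exact: cvg_cst.
by apply: cvgD; apply: dsum_cvg; [exact: cont01_half|exact: cont01_half'].
Qed.

(** In the limit this gives the integral of an affine function, which Goursat's argument
    subtracts. *)
Lemma dsum_id k : dsum k (@rc R) = (1 - (2 ^+ k)^-1) / 2.
Proof.
have aff m (a b : C) : dsum m (fun t => a + b * rc t) = a + b * dsum m (@rc R).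
  by rewrite dsumD dsum_cst dsumZ.
elim: k => [|k IH] /=; first by rewrite expr0 invr1 subrr mul0r.
have -> : dsum k (fun t => rc (t / 2)) = dsum k (fun t => 0 + 2^-1 * rc t).
  by apply: dsum_ext => t _; rewrite add0r rcM rcV rc_nat mulrC.
have -> : dsum k (fun t => rc ((1 + t) / 2)) = dsum k (fun t => 2^-1 + 2^-1 * rc t).
  by apply: dsum_ext => t _; rewrite rcM rcD rcV rc_nat mulrDl mul1r [rc t / _]mulrC.
rewrite !aff IH exprS; have : (2 : C) ^+ k != 0 by rewrite expf_neq0 // pnatr_eq0.
by move=> h; field.
Qed.

Lemma cont01_rc : cont01 (@rc R).
Proof. by move=> t _; exact: rc_continuous. Qed.

Lemma dint_affine (a b : C) : dint (fun t => a + b * rc t) = a + b / 2.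
Proof.
rewrite dintD; [|exact: cont01_cst|by apply: cont01M; [exact: cont01_cst|exact: cont01_rc]].
rewrite dint_cst dintZ; last exact: cont01_rc.
congr (_ + _ * _); apply: dintE; under eq_fun do rewrite dsum_id.
suff : (fun k => (1 - (2 ^+ k)^-1) / 2 : C) @ \oo --> ((1 - 0) / 2 : C).
  by rewrite subr0 mul1r.
apply: cvgM; last exact: cvg_cst.
apply: cvgB; first exact: cvg_cst.
have -> : (fun k => (2 ^+ k)^-1 : C) = (@rc R) \o (geometric 1 2^-1).
  by apply/funext => k; rewrite /geometric /= mul1r rcX rcV rc_nat exprVn.
rewrite -rc0; apply: continuous_cvg; first exact: rc_continuous.
by apply: cvg_geometric; rewrite ger0_norm; lra.
Qed.

(** Tube argument: compactness of [0, 1] turns joint continuity along the slice at [x0] into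
    closeness that is uniform in the parameter. *)
Lemma near_unif01 (T : topologicalType) (f : T -> R -> C) (x0 : T) (e : R) :
  0 < e -> cont01 (f x0) ->
  (forall t : R, 0 <= t <= 1 -> {for (x0, t), continuous (fun p => f p.1 p.2)}) ->
  \forall x \near x0, forall t : R, 0 <= t <= 1 -> rn (f x t - f x0 t) < e.
Proof.
move=> e0 c0 cf.
have hA : \forall x \near x0, `[(0 : R), 1]%classic `<=` (fun t => rn (f x t - f x0 t) < e).
  apply: (iffLR (compact_near_coveringP _) (@segment_compact R 0 1)).
  move=> t; rewrite /= in_itv /= => t01.
  have h1 : \forall p \near (x0, t), rn (f p.1 p.2 - f x0 t) < e / 2.
    by apply: (cf t t01 [set y | rn (y - f x0 t) < e / 2]); apply/nbhs_rnP; exists (e / 2) => //; lra.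
  have h2 : \forall s \near t, rn (f x0 s - f x0 t) < e / 2.
    by apply: (c0 t t01 [set y | rn (y - f x0 t) < e / 2]); apply/nbhs_rnP; exists (e / 2) => //; lra.
  case: h1 => -[A B] /= [nA nB] hAB.
  exists (B `&` [set s | rn (f x0 s - f x0 t) < e / 2], A).
    by split => //=; apply: filterI.
  move=> [s x] /= [[Bs hs] Ax]; have := hAB (x, s) (conj Ax Bs).
  by move=> /= h; apply: le_lt_trans (rn_sub _ (f x0 t) _) _; rewrite (rnC (f x0 t)); lra.
by apply: filterS hA => x h t t01; apply: h; rewrite /= in_itv.
Qed.

Lemma dint_continuous (T : topologicalType) (f : T -> R -> C) (x0 : T) :
  (\forall x \near x0, cont01 (f x)) ->
  (forall t : R, 0 <= t <= 1 -> {for (x0, t), continuous (fun p => f p.1 p.2)}) ->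
  {for x0, continuous (fun x => dint (f x))}.
Proof.
move=> cx cf P /nbhs_rnP[e e0 he].
have c0 : cont01 (f x0) by exact: nbhs_singleton cx.
have e20 : 0 < e / 2 by lra.
have hA := near_unif01 e20 c0 cf.
suff : \forall x \near x0, rn (dint (f x) - dint (f x0)) < e.
  by apply: filterS => x; exact: he.
near=> x; have cfx : cont01 (f x) by near: x.
rewrite -(dintB cfx c0).
apply: (@le_lt_trans _ _ (e / 2)); last by lra.
apply: rn_dint.
  apply: cont01D cfx _.
  by move=> t t01; apply: cvgN; exact: c0.
move=> t t01; apply/ltW.
have : forall t : R, 0 <= t <= 1 -> rn (f x t - f x0 t) < e / 2 by near: x.
by apply.
Unshelve. all: by end_near. Qed.

End DyadicIntegral.

(** * Complex differentiability *)

Section ComplexDerivative.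
Variable R : realType.
Local Notation C := (Cplx R).
Implicit Types (f g : C -> C) (a : C).

(* Complex differentiability at a point in Caratheodory's form: the value [q a]
   of the continuous difference quotient is the derivative. *)
Definition chol f a := exists2 q : C -> C, {for a, continuous q} &
  \forall z \near a, f z = f a + q z * (z - a).

Lemma chol_continuous f a : chol f a -> {for a, continuous f}.
Proof.
move=> [q cq fq]; apply: (@cfor_near _ _ (fun z => f a + q z * (z - a))).
  by near=> z; rewrite (near fq z).
apply: cforD; first exact: cfor_cst.
apply: cforM cq _; apply: cforB; [exact: cfor_id|exact: cfor_cst].
Unshelve. all: by end_near. Qed.

Lemma chol_near f g a : (\forall z \near a, f z = g z) -> chol f a -> chol g a.
Proof.
move=> fg [q cq fq]; exists q => //; near=> z.
by rewrite -(near fg z) // (near fq z) // (nbhs_singleton fg).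
Unshelve. all: by end_near. Qed.

Lemma chol_ext f g a : f =1 g -> chol f a -> chol g a.
Proof. by move=> fg; apply: chol_near; near=> z; rewrite fg.
Unshelve. all: by end_near. Qed.

Lemma chol_cst (c a : C) : chol (fun=> c) a.
Proof.
exists (fun=> 0); first exact: cfor_cst.
by near=> z; rewrite mul0r addr0.
Unshelve. all: by end_near. Qed.

Lemma chol_id a : chol id a.
Proof.
exists (fun=> 1); first exact: cfor_cst.
by near=> z; rewrite mul1r addrC subrK.
Unshelve. all: by end_near. Qed.

Lemma cholD f g a : chol f a -> chol g a -> chol (fun z => f z + g z) a.
Proof.
move=> [p cp fp] [q cq gq]; exists (fun z => p z + q z); first exact: cforD cp cq.
by near=> z; rewrite (near fp z) // (near gq z) //; ring.
Unshelve. all: by end_near. Qed.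

Lemma cholM f g a : chol f a -> chol g a -> chol (fun z => f z * g z) a.
Proof.
move=> [p cp fp] gg; have cg := chol_continuous gg; case: gg => [q cq gq].
exists (fun z => p z * g z + f a * q z).
  apply: cforD; first exact: cforM cp cg.
  by apply: cforM; [exact: cfor_cst|exact: cq].
near=> z; rewrite (near fp z) //.
have e : q z * (z - a) = g z - g a by rewrite [in RHS](near gq z) // [RHS]addrC addKr.
rewrite [RHS](_ : _ = f a * g a + p z * g z * (z - a) + f a * (q z * (z - a))).
  by rewrite e; ring.
by ring.
Unshelve. all: by end_near. Qed.

Lemma cholN f a : chol f a -> chol (fun z => - f z) a.
Proof.
move=> cf; apply: chol_ext (cholM (chol_cst (-1) a) cf) => z.
by rewrite mulN1r.
Qed.

Lemma cholB f g a : chol f a -> chol g a -> chol (fun z => f z - g z) a.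
Proof. by move=> cf cg; apply: cholD => //; exact: cholN. Qed.

Lemma cholX f a n : chol f a -> chol (fun z => f z ^+ n) a.
Proof.
move=> cf; elim: n => [|n IH]; first exact: chol_cst.
by apply: chol_ext (cholM cf IH) => z; rewrite exprS.
Qed.

Lemma chol_sum (I : Type) (s : seq I) (F : I -> C -> C) a :
  (forall i, chol (F i) a) -> chol (fun z => \sum_(i <- s) F i z) a.
Proof.
move=> cF; elim: s => [|i s IH].
  by apply: chol_ext (chol_cst 0 a) => z; rewrite big_nil.
by apply: chol_ext (cholD (cF i) IH) => z; rewrite big_cons.
Qed.

Lemma continuous_near_neq0 f a : {for a, continuous f} -> f a != 0 ->
  \forall z \near a, f z != 0.
Proof.
move=> /continuous_rnP cf fa0; have [|d d0 hd] := cf (rn (f a)).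
  by rewrite rn_gt0.
apply/nbhs_rnP; exists d => // z /hd h; apply: contraTneq h => ->.
by rewrite sub0r rnN ltxx.
Qed.

Lemma cholV f a : chol f a -> f a != 0 -> chol (fun z => (f z)^-1) a.
Proof.
move=> ff fa0; have cf := chol_continuous ff; case: ff => [p cp fp].
exists (fun z => - p z / (f z * f a)).
  apply: cforM; first exact: cforN cp.
  apply: cforV; last by rewrite mulf_neq0.
  by apply: cforM; [exact: cf|exact: cfor_cst].
have nz := continuous_near_neq0 cf fa0.
near=> z; have fz0 : f z != 0 by near: z.
have e : p z * (z - a) = f z - f a by rewrite [in RHS](near fp z) // [RHS]addrC addKr.
have -> : - p z / (f z * f a) * (z - a) = - (p z * (z - a)) / (f z * f a).
  by rewrite mulrAC mulNr.
by rewrite e; field; rewrite fz0 fa0.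
Unshelve. all: by end_near. Qed.

Lemma chol_comp f g a : chol g a -> chol f (g a) -> chol (fun z => f (g z)) a.
Proof.
move=> gg; have cg := chol_continuous gg; case: gg => [q cq gq] [p cp fp].
exists (fun z => p (g z) * q z).
  by apply: cforM cq; exact: cfor_comp cg cp.
near=> z; rewrite -mulrA.
have -> : q z * (z - a) = g z - g a by rewrite [in RHS](near gq z) // [RHS]addrC addKr.
by near: z; exact: (cg _ fp).
Unshelve. all: by end_near. Qed.

Definition is_cder f a (d : C) := exists q : C -> C,
  [/\ {for a, continuous q}, q a = d & \forall z \near a, f z = f a + q z * (z - a)].

Lemma is_cderP f a (d : C) :
  is_cder f a d <-> forall e : R, 0 < e -> exists2 r : R, 0 < r &
    forall z, rn (z - a) < r -> rn (f z - f a - d * (z - a)) <= e * rn (z - a).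
Proof.
split.
  move=> [q [/continuous_rnP cq <- /nbhs_rnP[r r0 fq]]] e e0.
  have [d' d0 hd] := cq e e0; exists (Num.min r d'); first by rewrite lt_min r0.
  move=> z; rewrite lt_min => /andP[zr zd]; rewrite fq //.
  have -> : f a + q z * (z - a) - f a - q a * (z - a) = (q z - q a) * (z - a) by ring.
  by rewrite rnM ler_wpM2r ?rn_ge0 // ltW // hd.
move=> H; exists (fun z => if z == a then d else (f z - f a) / (z - a)); split.
- apply/continuous_rnP => e e0; rewrite eqxx.
  have [r r0 hr] := H (e / 2) ltac:(lra); exists r => // z /hr.
  case: eqVneq => [->|za]; first by move=> _; rewrite subrr rn0.
  have za0 : 0 < rn (z - a) by rewrite rn_gt0 subr_eq0.
  move=> h; apply: (@le_lt_trans _ _ (e / 2)); last by lra.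
  by rewrite -(ler_pM2r za0) -rnM mulrBl divfK ?subr_eq0.
- by rewrite eqxx.
near=> z; case: eqVneq => [->|za]; first by rewrite subrr mulr0 addr0.
by rewrite divfK ?subr_eq0 // addrC subrK.
Unshelve. all: by end_near. Qed.

Lemma is_cder_chol f a d : is_cder f a d -> chol f a.
Proof. by move=> [q [cq _ fq]]; exists q. Qed.

Lemma chol_is_cder f a : chol f a -> exists d, is_cder f a d.
Proof. by move=> [q cq fq]; exists (q a), q. Qed.

Lemma cholP f a :
  chol f a <-> exists d : C, forall e : R, 0 < e -> exists2 r : R, 0 < r &
    forall z, rn (z - a) < r -> rn (f z - f a - d * (z - a)) <= e * rn (z - a).
Proof.
split=> [/chol_is_cder[d /is_cderP H]|[d /is_cderP /is_cder_chol//]].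
by exists d.
Qed.

Definition cexp (z : C) : C :=
  rc (expR (complex.Re z)) *
  (rc (cos (complex.Im z)) + 'i%C * rc (sin (complex.Im z))).

Lemma ii : 'i%C * 'i%C = -1 :> C.
Proof. by rewrite -expr2 sqr_i. Qed.

Lemma cexpD (z w : C) : cexp (z + w) = cexp z * cexp w.
Proof.
rewrite /cexp !raddfD /= expRD cosD sinD !(rcM, rcB, rcD).
rewrite -[X in _ * (X + _) = _]addr0.
set A := rc (expR _); set B := rc (expR _); set c := rc (cos _); set s := rc (sin _).
set c' := rc (cos _); set s' := rc (sin _).
have : ('i%C : C) * 'i%C = -1 := ii.
move: ('i%C : C) => i ii'.
have -> : A * (c + i * s) * (B * (c' + i * s')) =
  A * B * (c * c' + (i * i) * (s * s') + i * (s * c' + c * s')) by ring.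
by rewrite ii'; ring.
Qed.

Lemma derive_eps (g : R -> R) (dg : R) : is_derive (0 : R) 1 g dg ->
  forall e : R, 0 < e -> exists2 d : R, 0 < d &
    forall x, `|x| < d -> `|g x - g 0 - dg * x| <= e * `|x|.
Proof.
move=> [dv <-] e e0; have := dv; rewrite /derivable => /cvgrPdist_le.
rewrite -/('D_1 g 0) => /(_ e e0) [d /= d0 hd]; exists d => // x xd.
have [->|x0] := eqVneq x 0; first by rewrite subrr mulr0 subr0 normr0 mulr0.
have := hd x; rewrite /= sub0r normrN => /(_ xd x0).
rewrite addr0 /GRing.scale /= mulr1 => h.
have := ler_wpM2r (normr_ge0 x) h; rewrite -normrM distrC => h'.
apply: le_trans h'; rewrite le_eqVlt; apply/orP; left; apply/eqP; congr `|_|.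
by field.
Qed.

Lemma chol_cexp0 : chol cexp 0.
Proof.
apply/cholP; exists 1 => e e0.
(* The four error terms add up to at most [9 * (u * t)], hence the 16; [u <= 1] keeps [expR x] below
   3. *)
pose u := Num.min 1 (e / 16).
have u0 : 0 < u by rewrite lt_min ltr01; lra.
have u1 : u <= 1 by rewrite ge_min lexx.
have u2 : u <= e / 16 by rewrite ge_min lexx orbT.
clearbody u.
have [d1 d10 h1] := derive_eps (is_derive_expR 0) u0.
have [d2 d20 h2] := derive_eps (is_derive_cos 0) u0.
have [d3 d30 h3] := derive_eps (is_derive_sin 0) u0.
set d := Num.min u (Num.min d1 (Num.min d2 d3)).
have d0 : 0 < d by rewrite !lt_min u0 d10 d20.
have [du d1' d2' d3'] : [/\ d <= u, d <= d1, d <= d2 & d <= d3].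
  by rewrite !ge_min !lexx !orbT.
clearbody d; exists d => // z; rewrite subr0 => zd.
have xz := ler_rn_Re z; have yz := ler_rn_Im z.
set x := complex.Re z in xz *; set y := complex.Im z in yz *.
have {}h1 := h1 x ltac:(lra); have {}h2 := h2 y ltac:(lra); have {}h3 := h3 y ltac:(lra).
rewrite expR0 mul1r in h1; rewrite sin0 oppr0 mul0r subr0 cos0 in h2.
rewrite sin0 cos0 mul1r subr0 in h3.
rewrite /cexp -/x -/y mul1r /= expR0 cos0 sin0 rc0 rc1 mulr0 addr0 mulr1.
have zE : z = rc x + 'i%C * rc y by rewrite /x /y -cE.
have -> : rc (expR x) * (rc (cos y) + 'i%C * rc (sin y)) - 1 - z =
   rc (expR x * (cos y - 1) + (expR x - 1 - x)) +
   'i%C * rc (expR x * (sin y - y) + (expR x - 1) * y).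
  by rewrite zE !(rcD, rcM, rcB, rcN) rc1; ring.
have t0 := rn_ge0 z; set t := rn z in xz yz zd t0 *.
have ut : u * t <= e / 16 * t by rewrite ler_wpM2r.
have et0 : 0 <= e * t by rewrite mulr_ge0 // ltW.
have ux : u * `|x| <= u * t by rewrite ler_wpM2l // ltW.
have uy : u * `|y| <= u * t by rewrite ler_wpM2l // ltW.
have ux1 : u * `|x| <= `|x| by rewrite ler_piMl.
have e1 : `|expR x - 1| <= 2 * `|x|.
  have -> : expR x - 1 = x + (expR x - 1 - x) by ring.
  by apply: le_trans (ler_normD _ _) _; lra.
have e2 : `|expR x| <= 3.
  have -> : expR x = 1 + (expR x - 1) by ring.
  by apply: le_trans (ler_normD _ _) _; rewrite normr1; lra.
have b1 : `|expR x * (cos y - 1)| <= 3 * (u * t).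
  by rewrite normrM ler_pM //; lra.
have b2 : `|expR x * (sin y - y)| <= 3 * (u * t).
  by rewrite normrM ler_pM //; lra.
have b3 : `|(expR x - 1) * y| <= 2 * (u * t).
  rewrite normrM mulrA ler_pM //; lra.
apply: le_trans (rnD _ _) _; rewrite rnM rn_i mul1r !rn_rc.
have := ler_normD (expR x * (cos y - 1)) (expR x - 1 - x).
have := ler_normD (expR x * (sin y - y)) ((expR x - 1) * y).
lra.
Qed.

Lemma chol_cexp (a : C) : chol cexp a.
Proof.
have : chol (fun z => cexp a * cexp (z - a)) a.
  apply: cholM; first exact: chol_cst.
  apply: chol_comp; first by apply: cholB; [exact: chol_id|exact: chol_cst].
  by rewrite subrr; exact: chol_cexp0.
by apply: chol_ext => z; rewrite -cexpD addrC subrK.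
Qed.

End ComplexDerivative.

(** * Goursat's theorem and circle means *)

Section Goursat.
Variable R : realType.
Local Notation C := (Cplx R).
Implicit Types (g : C -> C) (p u v : C).

Let h (k : nat) : R := (2 ^+ k)^-1.

Let hS k : h k.+1 = h k / 2.
Proof. by rewrite /h exprS invfM mulrC. Qed.

Let h_gt0 k : 0 < h k.
Proof. by rewrite /h invr_gt0 exprn_gt0. Qed.

Let h_le1 k : h k <= 1.
Proof. by rewrite /h invf_le1 ?exprn_gt0 // exprn_ege1 // ler1n. Qed.

(** [P s t k] speaks of the square with lower left corner [(s, t)] and side [2^-k]. The corner
    coordinates increase and the opposite ends decrease, so the suprema of the corner coordinates
    lie in all the squares. *)
Lemma dyadic_nested (P : R -> R -> nat -> Prop) :
  P 0 0 0%N ->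
  (forall s t k, P s t k -> exists s' t', [/\ P s' t' k.+1,
     s <= s' <= s + h k / 2 & t <= t' <= t + h k / 2]) ->
  exists s0 t0, forall k, exists s t,
    [/\ P s t k, s <= s0 <= s + h k & t <= t0 <= t + h k].
Proof.
move=> P0 step.
have /choice[F hF] : forall x : nat * (R * R), exists y : R * R,
    P x.2.1 x.2.2 x.1 -> [/\ P y.1 y.2 x.1.+1,
      x.2.1 <= y.1 <= x.2.1 + h x.1 / 2 & x.2.2 <= y.2 <= x.2.2 + h x.1 / 2].
  move=> [k [s t]] /=; have [/step[s' [t' H]]|nP] := pselect (P s t k).
    by exists (s', t').
  by exists (0, 0).
pose st := fix st k := if k is k'.+1 then F (k', st k') else (0, 0).
have Pst k : P (st k).1 (st k).2 k.
  by elim: k => [//|k IH] /=; have [] := hF (k, st k) IH.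
have lim (a : nat -> R) : (forall k, a k <= a k.+1 <= a k + h k / 2) ->
    exists a0, forall k, a k <= a0 <= a k + h k.
  move=> ha.
  have up k m : a k <= a (k + m)%N /\ a (k + m)%N + h (k + m)%N <= a k + h k.
    elim: m => [|m [IH1 IH2]]; first by rewrite addn0.
    rewrite addnS hS; have := ha (k + m)%N; lra.
  have ub k j : a j <= a k + h k.
    have [jk|kj] := leqP j k.
      by have [] := up j (k - j)%N; rewrite subnKC // => + _; have := h_gt0 k; lra.
    have [_] := up k (j - k)%N; rewrite subnKC ?(ltnW kj) //.
    have := h_gt0 j; lra.
  exists (sup (range a)) => k; apply/andP; split.
    by apply: ub_le_sup; [exists (a 0%N + h 0%N) => _ [j _ <-]|exists k].
  by apply: ge_sup; [exists (a k); exists k|move=> _ [j _ <-]].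
have [|s0 hs0] := lim (fun k => (st k).1).
  by move=> k; have [] := hF (k, st k) (Pst k).
have [|t0 ht0] := lim (fun k => (st k).2).
  by move=> k; have [] := hF (k, st k) (Pst k).
by exists s0, t0 => k; exists (st k).1, (st k).2; split.
Qed.

(** The integral of [g] along the segment from [p] to [p + v]. *)
Definition seg g p v : C := v * dint (fun t => g (p + v * rc t)).

(** The contour integral of [g] around the parallelogram with vertices [p], [p + u], [p + u + v],
    [p + v], in this order. *)
Definition par g p u v : C :=
  seg g p u + seg g (p + u) v - seg g (p + v) u - seg g p v.

Lemma rc_half (t : R) : rc (t / 2) = rc t / 2.
Proof. by rewrite rcM rcV rc_nat. Qed.

Lemma cont01_seg g p v :
  (forall t : R, 0 <= t <= 1 -> {for p + v * rc t, continuous g}) ->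
  cont01 (fun t => g (p + v * rc t)).
Proof.
move=> cg t t01; apply: (@cfor_comp _ _ _ (fun t => p + v * rc t)); last exact: cg.
apply: cforD; first exact: cfor_cst.
by apply: cforM; [exact: cfor_cst|exact: rc_continuous].
Qed.

Lemma seg_half g p v :
  (forall t : R, 0 <= t <= 1 -> {for p + v * rc t, continuous g}) ->
  seg g p v = seg g p (v / 2) + seg g (p + v / 2) (v / 2).
Proof.
move=> cg; rewrite /seg (dint_half (cont01_seg cg)).
have -> : dint (fun t => g (p + v * rc (t / 2))) =
          dint (fun t => g (p + v / 2 * rc t)).
  by apply: dint_ext => t _; congr g; rewrite rc_half; ring.
have -> : dint (fun t => g (p + v * rc ((1 + t) / 2))) =
          dint (fun t => g (p + v / 2 + v / 2 * rc t)).
  by apply: dint_ext => t _; congr g; rewrite rc_half rcD rc1; ring.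
by field.
Qed.

Definition inpar p u v : set C := [set z | exists s t : R,
  [/\ 0 <= s <= 1, 0 <= t <= 1 & z = p + u * rc s + v * rc t]].

(** Each side is cut at its midpoint; the inner edges of the four quarters are run through twice in
    opposite directions and cancel. *)
Lemma par_split g p u v :
  (forall z, inpar p u v z -> {for z, continuous g}) ->
  par g p u v = par g p (u / 2) (v / 2) + par g (p + u / 2) (u / 2) (v / 2) +
    par g (p + v / 2) (u / 2) (v / 2) + par g (p + u / 2 + v / 2) (u / 2) (v / 2).
Proof.
move=> cg; rewrite /par.
have c1 (s : R) : 0 <= s <= 1 -> forall t : R, 0 <= t <= 1 -> {for p + v * rc s + u * rc t, continuous g}.
  by move=> s01 t t01; apply: cg; exists t, s; split=> //; ring.
have c2 (s : R) : 0 <= s <= 1 -> forall t : R, 0 <= t <= 1 -> {for p + u * rc s + v * rc t, continuous g}.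
  by move=> s01 t t01; apply: cg; exists s, t; split=> //; ring.
have i0 : 0 <= (0 : R) <= 1 by lra.
have i1 : 0 <= (1 : R) <= 1 by lra.
have e0 (w : C) : p + w * rc 0 = p by rewrite rc0 mulr0 addr0.
have e1 (w : C) : p + w * rc 1 = p + w by rewrite rc1 mulr1.
have := seg_half (c1 _ i0); rewrite e0 => ->.
have := seg_half (c1 _ i1); rewrite e1 => ->.
have := seg_half (c2 _ i0); rewrite e0 => ->.
have := seg_half (c2 _ i1); rewrite e1 => ->.
have -> : p + u / 2 + u / 2 = p + u by field.
have -> : p + v / 2 + v / 2 = p + v by field.
have -> : p + v / 2 + u / 2 = p + u / 2 + v / 2 by ring.
have -> : p + u / 2 + v / 2 + u / 2 = p + u + v / 2 by field.
have -> : p + u / 2 + v / 2 + v / 2 = p + v + u / 2 by field.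
by ring.
Qed.

Lemma seg_affine (a b : C) p v : seg (fun z => a + b * z) p v = v * (a + b * p + b * v / 2).
Proof.
rewrite /seg (_ : dint _ = dint (fun t => (a + b * p) + (b * v) * rc t)).
  by rewrite dint_affine.
by apply: dint_ext => t _; ring.
Qed.

Lemma par_affine (a b : C) p u v : par (fun z => a + b * z) p u v = 0.
Proof. by rewrite /par !seg_affine; field. Qed.

Lemma seg_dist g1 g2 p v (M : R) :
  (forall t : R, 0 <= t <= 1 -> {for p + v * rc t, continuous g1}) ->
  (forall t : R, 0 <= t <= 1 -> {for p + v * rc t, continuous g2}) ->
  (forall t : R, 0 <= t <= 1 -> rn (g1 (p + v * rc t) - g2 (p + v * rc t)) <= M) ->
  rn (seg g1 p v - seg g2 p v) <= rn v * M.
Proof.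
move=> /cont01_seg c1 /cont01_seg c2 gM; rewrite /seg -mulrBr -(dintB c1 c2) rnM.
rewrite ler_wpM2l ?rn_ge0 //; apply: rn_dint gM.
by move=> t t01; apply: cforB; [exact: c1|exact: c2].
Qed.

Lemma par_dist g1 g2 p u v (M : R) :
  (forall z, inpar p u v z -> {for z, continuous g1}) ->
  (forall z, inpar p u v z -> {for z, continuous g2}) ->
  (forall z, inpar p u v z -> rn (g1 z - g2 z) <= M) ->
  rn (par g1 p u v - par g2 p u v) <= 2 * (rn u + rn v) * M.
Proof.
move=> c1 c2 gM.
have i0 : 0 <= (0 : R) <= 1 by lra.
have i1 : 0 <= (1 : R) <= 1 by lra.
have p1 (t : R) : 0 <= t <= 1 -> inpar p u v (p + u * rc t).
  by move=> t01; exists t, 0; split=> //; rewrite rc0 mulr0 addr0.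
have p2 (t : R) : 0 <= t <= 1 -> inpar p u v (p + v * rc t).
  by move=> t01; exists 0, t; split=> //; rewrite rc0 mulr0 addr0.
have p3 (t : R) : 0 <= t <= 1 -> inpar p u v (p + v + u * rc t).
  by move=> t01; exists t, 1; split=> //; rewrite rc1 mulr1; ring.
have p4 (t : R) : 0 <= t <= 1 -> inpar p u v (p + u + v * rc t).
  by move=> t01; exists 1, t; split=> //; rewrite rc1 mulr1.
have d1 := @seg_dist g1 g2 p u M (fun t h => c1 _ (p1 t h)) (fun t h => c2 _ (p1 t h)) (fun t h => gM _ (p1 t h)).
have d2 := @seg_dist g1 g2 p v M (fun t h => c1 _ (p2 t h)) (fun t h => c2 _ (p2 t h)) (fun t h => gM _ (p2 t h)).
have d3 := @seg_dist g1 g2 (p + v) u M (fun t h => c1 _ (p3 t h)) (fun t h => c2 _ (p3 t h)) (fun t h => gM _ (p3 t h)).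
have d4 := @seg_dist g1 g2 (p + u) v M (fun t h => c1 _ (p4 t h)) (fun t h => c2 _ (p4 t h)) (fun t h => gM _ (p4 t h)).
rewrite /par.
set A := seg g1 p u in d1 *; set B := seg g1 p v in d2 *.
set A' := seg g1 (p + v) u in d3 *; set B' := seg g1 (p + u) v in d4 *.
set E := seg g2 p u in d1 *; set F := seg g2 p v in d2 *.
set E' := seg g2 (p + v) u in d3 *; set F' := seg g2 (p + u) v in d4 *.
have -> : A + B' - A' - B - (E + F' - E' - F) = (A - E) + (B' - F') - (A' - E') - (B - F) by ring.
apply: le_trans (rnB _ _) _; have := rnB ((A - E) + (B' - F')) (A' - E').
have := rnD (A - E) (B' - F'); lra.
Qed.

(** One of the four quarters always carries at least a quarter of the integral. At the common point
    of the nested quarters [g] is affine up to [e] times the diameter, and affine functions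
    integrate to 0, so the integral at scale [2^-k] is at most a multiple of [e * 4^-k]. *)
Lemma goursat g p u v : (forall z, inpar p u v z -> chol g z) -> par g p u v = 0.
Proof.
move=> cg.
have ctg z : inpar p u v z -> {for z, continuous g}.
  by move=> /cg; exact: chol_continuous.
pose c := rn (par g p u v).
pose pt (s t : R) := p + u * rc s + v * rc t.
pose P (s t : R) (k : nat) := [/\ 0 <= s /\ s + h k <= 1, 0 <= t /\ t + h k <= 1 &
  c <= 4 ^+ k * rn (par g (pt s t) (u * rc (h k)) (v * rc (h k)))].
have inp s t k z : P s t k -> inpar (pt s t) (u * rc (h k)) (v * rc (h k)) z ->
    exists s' t', [/\ s <= s' <= s + h k, t <= t' <= t + h k & z = pt s' t'].
  move=> [hs ht _] [s' [t' [s01 t01 ->]]].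
  have hk := h_gt0 k.
  have a1 : 0 <= h k * s' <= h k.
    by apply/andP; split; [apply: mulr_ge0; lra|rewrite ler_piMr //; lra].
  have a2 : 0 <= h k * t' <= h k.
    by apply/andP; split; [apply: mulr_ge0; lra|rewrite ler_piMr //; lra].
  exists (s + h k * s'), (t + h k * t'); split; [lra|lra|].
  by rewrite /pt !rcD !rcM; ring.
have P0 : P 0 0 0%N.
  rewrite /P /pt /h expr0 invr1 expr0 mul1r rc0 rc1 !mulr0 !addr0 !mulr1.
  by split=> //; lra.
have step s t k : P s t k -> exists s' t', [/\ P s' t' k.+1,
     s <= s' <= s + h k / 2 & t <= t' <= t + h k / 2].
  move=> Pk; have [hs ht hc] := Pk; have hk := h_gt0 k.
  have : forall z, inpar (pt s t) (u * rc (h k)) (v * rc (h k)) z ->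
      {for z, continuous g}.
    move=> z /(inp _ _ _ _ Pk)[s' [t' [a b ->]]].
    by apply: ctg; exists s', t'; split=> //; lra.
  move=> /par_split.
  have -> : u * rc (h k) / 2 = u * rc (h k.+1) by rewrite hS rc_half mulrA.
  have -> : v * rc (h k) / 2 = v * rc (h k.+1) by rewrite hS rc_half mulrA.
  have q1 : pt s t + u * rc (h k.+1) = pt (s + h k.+1) t by rewrite /pt rcD; ring.
  have q2 : pt s t + v * rc (h k.+1) = pt s (t + h k.+1) by rewrite /pt rcD; ring.
  have q3 : pt s t + u * rc (h k.+1) + v * rc (h k.+1) = pt (s + h k.+1) (t + h k.+1).
    by rewrite /pt !rcD; ring.
  rewrite q3 q1 q2.
  set T1 := par g (pt s t) (u * rc (h k.+1)) _; set T2 := par g (pt (s + h k.+1) t) _ _.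
  set T3 := par g (pt s (t + _)) _ _; set T4 := par g (pt (s + _) (t + _)) _ _ => e.
  have hSk := hS k.
  have [c1|c1] := lerP c (4 ^+ k.+1 * rn T1).
    by exists s, t; split; [split; [clear -hs ht hSk hk; lra|clear -hs ht hSk hk; lra|exact: c1]|clear -hs ht hSk hk; lra|clear -hs ht hSk hk; lra].
  have [c2|c2] := lerP c (4 ^+ k.+1 * rn T2).
    by exists (s + h k.+1), t; split; [split; [clear -hs ht hSk hk; lra|clear -hs ht hSk hk; lra|exact: c2]|clear -hs ht hSk hk; lra|clear -hs ht hSk hk; lra].
  have [c3|c3] := lerP c (4 ^+ k.+1 * rn T3).
    by exists s, (t + h k.+1); split; [split; [clear -hs ht hSk hk; lra|clear -hs ht hSk hk; lra|exact: c3]|clear -hs ht hSk hk; lra|clear -hs ht hSk hk; lra].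
  have [c4|c4] := lerP c (4 ^+ k.+1 * rn T4).
    by exists (s + h k.+1), (t + h k.+1); split; [split; [clear -hs ht hSk hk; lra|clear -hs ht hSk hk; lra|exact: c4]|clear -hs ht hSk hk; lra|clear -hs ht hSk hk; lra].
  exfalso; rewrite e in hc; clearbody T1 T2 T3 T4.
  have le4 : rn (T1 + T2 + T3 + T4) <= rn T1 + rn T2 + rn T3 + rn T4.
    apply: le_trans (rnD _ _) _; have := rnD (T1 + T2) T3; have := rnD T1 T2; lra.
  have k4 : 0 <= (4 : R) ^+ k by rewrite exprn_ge0.
  have := ler_wpM2l k4 le4.
  move: c1 c2 c3 c4 hc; rewrite exprS; lra.
have [s0 [t0 H]] := dyadic_nested P0 step.
have in0 : inpar p u v (pt s0 t0).
  have [s [t [[hs ht _] h1 h2]]] := H 0%N.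
  by exists s0, t0; split=> //; lra.
have /cholP[d hd] := cg _ in0.
(* [L * h k] bounds the diameter at scale [k], and [2 * L * h k] is the perimeter; hence the factor
   [2 * L * L] below. *)
set L := rn u + rn v.
have L0 : 0 <= L by rewrite addr_ge0 ?rn_ge0.
suff main : forall e : R, 0 < e -> c <= 2 * L * L * e.
  apply/eqP; rewrite -rn_eq0 -/c eq_le rn_ge0 andbT.
  apply/ler_addgt0Pr => e e0; rewrite add0r.
  apply: le_trans (main (e / (1 + 2 * L * L)) _) _.
    by rewrite divr_gt0 // ltr_pwDl // !mulr_ge0.
  rewrite mulrA ler_pdivrMr ?ltr_pwDl ?mulr_ge0 //.
  rewrite mulrC ler_wpM2l //; first exact: ltW.
  lra.
move=> e e0; have [r r0 hr] := hd e e0.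
have [k hk] : exists k, L * h k < r.
  have L1 : 0 < 1 + L by lra.
  have /cvgrPdist_lt /(_ (r / (1 + L)) (divr_gt0 r0 L1)) [k _ hk] :=
    @cvg_geometric R 1 2^-1 ltac:(rewrite ger0_norm; lra).
  exists k; have := hk k (leqnn k).
  rewrite /geometric /= mul1r sub0r normrN exprVn ger0_norm ?invr_ge0 ?exprn_ge0 //.
  rewrite ltr_pdivlMr // -/(h k); have := h_gt0 k; lra.
have [s [t [Pk h1 h2]]] := H k; have [hs ht hc] := Pk.
have hk0 := h_gt0 k.
have near0 z : inpar (pt s t) (u * rc (h k)) (v * rc (h k)) z ->
    rn (z - pt s0 t0) <= L * h k.
  move=> /(inp _ _ _ _ Pk)[s' [t' [a b ->]]].
  have -> : pt s' t' - pt s0 t0 = u * rc (s' - s0) + v * rc (t' - t0).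
    by rewrite /pt !rcB; ring.
  apply: le_trans (rnD _ _) _; rewrite !rnM !rn_rc /L mulrDl.
  apply: lerD; rewrite ler_wpM2l ?rn_ge0 // ler_norml; lra.
pose aff z : C := (g (pt s0 t0) - d * pt s0 t0) + d * z.
have := @par_dist g aff (pt s t) (u * rc (h k)) (v * rc (h k)) (e * (L * h k)).
rewrite par_affine subr0 => PD.
move: hc; apply: contraTT; rewrite -!ltNge => hc.
apply: le_lt_trans hc.
have k4 : (4 : R) ^+ k = (h k)^-1 * (h k)^-1.
  by rewrite /h invrK -exprMn; congr (_ ^+ _); lra.
apply: (@le_trans _ _ (4 ^+ k * (2 * (rn (u * rc (h k)) + rn (v * rc (h k))) * (e * (L * h k))))).
  rewrite ler_wpM2l ?exprn_ge0 //; apply: PD.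
  - move=> z /(inp _ _ _ _ Pk)[s' [t' [a b ->]]].
    by apply: ctg; exists s', t'; split=> //; lra.
  - move=> z _; apply: cforD; first exact: cfor_cst.
    by apply: cforM; [exact: cfor_cst|exact: cfor_id].
  - move=> z /near0 zn; have := hr z (le_lt_trans zn hk).
    have -> : g z - g (pt s0 t0) - d * (z - pt s0 t0) = g z - aff z by rewrite /aff; ring.
    by move=> q; apply: le_trans q _; rewrite ler_wpM2l // ltW.
rewrite !rnM !rn_rc ger0_norm ?(ltW hk0) // -mulrDl -/L k4.
rewrite le_eqVlt; apply/orP; left; apply/eqP; field.
by rewrite lt0r_neq0.
Qed.

End Goursat.

(** * Circle means and Cauchy's formula *)

Section CircleMean.
Variable R : realType.
Local Notation C := (Cplx R).
Implicit Types (k : C -> C) (a c : C).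

Definition cis (t : R) : C :=
  rc (cos (2 * pi * t)) + 'i%C * rc (sin (2 * pi * t)).

(** This is the contour integral of [k z / z] over the circle, divided by [2 pi i]; the Cauchy
    kernel therefore appears as [z / (z - h)] in what follows. *)
Definition circ (r : R) k : C := dint (fun t => k (rc r * cis t)).

Lemma rn_cis t : rn (cis t) = 1.
Proof.
apply/eqP; rewrite -(@eqrXn2 _ 2) ?rn_ge0 // rn_sqr /cis /= expr1n.
by apply/eqP; rewrite !(mul0r, mul1r, mulr0, addr0, subr0, add0r) cos2Dsin2.
Qed.

Lemma rn_circle (r t : R) : 0 <= r -> rn (rc r * cis t) = r.
Proof. by move=> r0; rewrite rnM rn_cis mulr1 rn_rc ger0_norm. Qed.

Lemma continuous_cis : continuous cis.
Proof.
move=> t; have c2 : {for t, continuous (fun t : R => 2 * pi * t)}.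
  by apply: cvgM; [exact: cvg_cst|exact: cvg_id].
change {for t, continuous (fun t : R => rc (cos (2 * pi * t)) + 'i%C * rc (sin (2 * pi * t)))}.
apply: cforD; first by apply: cfor_rc; apply: cfor_comp c2 _; exact: continuous_cos.
apply: cforM; first exact: cfor_cst.
by apply: cfor_rc; apply: cfor_comp c2 _; exact: continuous_sin.
Qed.

Lemma cexp_circle (r t : R) : 0 < r ->
  cexp (rc (ln r) + ('i%C * rc (2 * pi)) * rc t) = rc r * cis t.
Proof.
move=> r0; rewrite /cexp /cis /=.
rewrite !(mul0r, mul1r, mulr0, addr0, subr0, add0r, oppr0).
by rewrite lnK.
Qed.

Lemma cexp_period (z : C) : cexp (z + 'i%C * rc (2 * pi)) = cexp z.
Proof.
rewrite cexpD [X in _ * X](_ : _ = 1) ?mulr1 // /cexp /=.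
rewrite !(mul0r, mul1r, mulr0, addr0, subr0, add0r, oppr0) expR0 mulr_natl.
by rewrite -[pi *+ 2]add0r cosD2pi sinD2pi cos0 sin0 rc0 rc1 mulr0 addr0 mulr1.
Qed.

Lemma rn_cexp (z : C) : rn (cexp z) = expR (complex.Re z).
Proof.
rewrite /cexp rnM rn_rc ger0_norm ?expR_ge0 //.
rewrite [X in _ * X](_ : _ = 1) ?mulr1 //.
apply/eqP; rewrite -(@eqrXn2 _ 2) ?rn_ge0 // rn_sqr /= expr1n.
by apply/eqP; rewrite !(mul0r, mul1r, mulr0, addr0, subr0, add0r) cos2Dsin2.
Qed.

Lemma cont01_circle (r : R) k : 0 <= r ->
  (forall z, rn z = r -> {for z, continuous k}) ->
  cont01 (fun t => k (rc r * cis t)).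
Proof.
move=> r0 ck t _; apply: (@cfor_comp _ _ _ (fun t => rc r * cis t)).
  by apply: cforM; [exact: cfor_cst|exact: continuous_cis].
by apply: ck; rewrite rn_circle.
Qed.

(** The exponential maps a rectangle of height [2 pi] onto the annulus. In Goursat's theorem for
    [k (cexp z)] the two sides that differ by the period cancel, and the vertical sides are the two
    means. *)
Lemma circ_annulus k (r s : R) : 0 < r -> r <= s ->
  (forall z, r <= rn z <= s -> chol k z) -> circ r k = circ s k.
Proof.
move=> r0 rs ck; have s0 : 0 < s by lra.
pose p : C := rc (ln r); pose u : C := rc (ln s - ln r).
pose v : C := 'i%C * rc (2 * pi).
have ls : ln r <= ln s by rewrite ler_ln.
have cg z : inpar p u v z -> chol (fun z => k (cexp z)) z.
  move=> [x [y [x01 y01 ->]]]; apply: chol_comp; first exact: chol_cexp.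
  apply: ck; rewrite rn_cexp /=.
  rewrite !(mul0r, mul1r, mulr0, addr0, subr0, add0r, oppr0).
  set w := ln r + _.
  have w1 : ln r <= w by rewrite /w lerDl mulr_ge0 //; lra.
  have w2 : w <= ln s.
    by rewrite /w; have : (ln s - ln r) * x <= ln s - ln r by [rewrite ler_piMr //; lra]; lra.
  apply/andP; split; first by rewrite -[leLHS](lnK r0) ler_expR.
  by rewrite -[leRHS](lnK s0) ler_expR.
have := goursat cg; rewrite /par.
have -> : seg (fun z => k (cexp z)) (p + v) u = seg (fun z => k (cexp z)) p u.
  rewrite /seg; congr (_ * _); apply: dint_ext => t _.
  by rewrite addrAC cexp_period.
have -> : p + u = rc (ln s) by rewrite /p /u -rcD addrC subrK.
have E (x y z : C) : x + y - x - z = y - z by ring.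
rewrite E /seg -mulrBr => /eqP; rewrite mulf_eq0 => /orP[|].
  have pi2 : 0 < 2 * pi :> R by rewrite mulr_gt0 ?pi_gt0.
  by rewrite -rn_eq0 /v rnM rn_i mul1r rn_rc gtr0_norm // gt_eqF.
rewrite subr_eq0 => /eqP.
have e (x : R) : 0 < x -> dint (fun t => k (cexp (rc (ln x) + v * rc t))) = circ x k.
  by move=> x0; apply: dint_ext => t _; rewrite cexp_circle.
by rewrite !e.
Qed.

Lemma circ_continuous k (r d : R) : 0 < d -> 0 <= r - d ->
  (forall z, r - d < rn z < r + d -> {for z, continuous k}) ->
  {for r, continuous (circ^~ k)}.
Proof.
move=> d0 rd ck; apply: dint_continuous.
  near=> x; have xr : ball r d x by near: x; exact: nbhsx_ballx.
  rewrite -ball_normE /= ltr_norml in xr.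
  by apply: cont01_circle; [lra|move=> z zx; apply: ck; lra].
move=> t _; apply: (@cfor_comp _ _ _ (fun p : R * R => rc p.1 * cis p.2)).
  apply: cforM; first by apply: cfor_rc; exact: cvg_fst.
  by apply: cfor_comp; [exact: cvg_snd|exact: continuous_cis].
by apply: ck; rewrite rn_circle /=; lra.
Unshelve. all: by end_near. Qed.

Lemma rn_circ (r : R) k (M : R) : 0 <= r ->
  (forall z, rn z = r -> {for z, continuous k}) ->
  (forall z, rn z = r -> rn (k z) <= M) -> rn (circ r k) <= M.
Proof.
move=> r0 ck kM; apply: rn_dint; first exact: cont01_circle.
by move=> t _; apply: kM; rewrite rn_circle.
Qed.

Lemma circB (r : R) k1 k2 : 0 <= r ->
  (forall z, rn z = r -> {for z, continuous k1}) ->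
  (forall z, rn z = r -> {for z, continuous k2}) ->
  circ r (fun z => k1 z - k2 z) = circ r k1 - circ r k2.
Proof.
move=> r0 c1 c2.
exact: (dintB (cont01_circle r0 c1) (cont01_circle r0 c2)).
Qed.

Lemma circZ (r : R) (c : C) k : 0 <= r ->
  (forall z, rn z = r -> {for z, continuous k}) ->
  circ r (fun z => c * k z) = c * circ r k.
Proof. by move=> r0 c1; exact: (dintZ _ (cont01_circle r0 c1)). Qed.

Lemma circ_cst (r : R) (c : C) : circ r (fun=> c) = c.
Proof. exact: dint_cst. Qed.

Lemma circ_ext (r : R) k1 k2 : 0 <= r -> (forall z, rn z = r -> k1 z = k2 z) ->
  circ r k1 = circ r k2.
Proof. by move=> r0 h; apply: dint_ext => t _; apply: h; rewrite rn_circle. Qed.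

Lemma const_of_punctured (W : normedModType C) (f : R -> W) (x y m : R) :
  x <= m <= y -> {for m, continuous f} ->
  (forall s, x <= s < m -> f s = f x) ->
  (forall s, m < s <= y -> f s = f y) -> f x = f y.
Proof.
move=> xmy /cfor_rnP cf fx fy.
have lim (z : R) : (forall d : R, 0 < d -> exists2 s, `|s - m| < d & f s = f z) -> f z = f m.
  move=> H; apply/eqP; rewrite -subr_eq0 -rn_eq0 eq_le rn_ge0 andbT.
  apply/ler_addgt0Pr => e e0; rewrite add0r.
  have /nbhs_ballP[d /= d0 hd] := cf e e0.
  have [s sm <-] := H d d0; apply/ltW/hd.
  by rewrite -ball_normE /= distrC.
transitivity (f m).
  have [->//|xm] := eqVneq x m; apply: lim => d d0.
  have {}xm : x < m by rewrite lt_neqAle xm; lra.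
  exists (Num.max x (m - d / 2)); last by apply: fx; rewrite le_max lexx gt_max xm; lra.
  by rewrite ler0_norm; rewrite /Num.max; case: ifP; lra.
have [->//|ym] := eqVneq m y; apply/esym/lim => d d0.
have {}ym : m < y by rewrite lt_neqAle ym; lra.
exists (Num.min y (m + d / 2)); last by apply: fy; rewrite ge_min lexx lt_min ym; lra.
by rewrite ger0_norm; rewrite /Num.min; case: ifP; lra.
Qed.

(** At the point [a] only continuity is asked. The mean is constant in the radius below and above
    [rn a], and continuity in the radius joins the two constants. *)
Lemma circ_annulus1 k (a : C) (r s r0 s0 : R) : 0 <= r0 -> r0 < r -> r <= s -> s < s0 ->
  (forall z, r0 < rn z < s0 -> {for z, continuous k}) ->
  (forall z, r0 < rn z < s0 -> z != a -> chol k z) ->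
  circ r k = circ s k.
Proof.
move=> r00 r0r rs ss0 ck hk.
have [ra|ra] := ltrP (rn a) r.
  apply: circ_annulus => [||z zr]; [lra|lra|].
  by apply: hk; [lra|apply: contraTneq zr => ->; lra].
have [sa|sa] := ltrP s (rn a).
  apply: circ_annulus => [||z zr]; [lra|lra|].
  by apply: hk; [lra|apply: contraTneq zr => ->; lra].
apply: (@const_of_punctured C^o (circ^~ k) r s (rn a)); first by rewrite ra.
- pose d := Num.min (rn a - r0) (s0 - rn a).
  have d0 : 0 < d by rewrite lt_min; lra.
  have d1 : d <= rn a - r0 by rewrite ge_min lexx.
  have d2 : d <= s0 - rn a by rewrite ge_min lexx orbT.
  by apply: (@circ_continuous _ _ d); [lra|lra|move=> z zd; apply: ck; lra].
- move=> x xa; apply/esym/circ_annulus => [||z zr]; [lra|lra|].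
  by apply: hk; [lra|apply: contraTneq zr => ->; lra].
- move=> x xa; apply: circ_annulus => [||z zr]; [lra|lra|].
  by apply: hk; [lra|apply: contraTneq zr => ->; lra].
Qed.

(** Both exceptional points occur in [cauchy_formula]: 0 is a possible singularity of the function
    itself, [a] the point at which its difference quotient is formed. *)
Lemma mean_value1 k (a : C) (s s0 : R) : 0 < s -> s < s0 ->
  (forall z, rn z < s0 -> {for z, continuous k}) ->
  (forall z, rn z < s0 -> z != 0 -> z != a -> chol k z) ->
  circ s k = k 0.
Proof.
move=> s_gt0 ss0 ck hk.
apply/eqP; rewrite -subr_eq0 -rn_eq0 eq_le rn_ge0 andbT.
apply/ler_addgt0Pr => e e0; rewrite add0r.
have c0 : {for 0, continuous k} by apply: ck; rewrite rn0; lra.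
have /nbhs_rnP[d d0 hd] := (iffLR (cfor_rnP _ _) c0) e e0.
pose r := Num.min s (d / 2).
have r0 : 0 < r by rewrite lt_min; lra.
have r1 : r <= s by rewrite ge_min lexx.
have r2 : r <= d / 2 by rewrite ge_min lexx orbT.
clearbody r.
rewrite -(@circ_annulus1 k a r s (r / 2) s0); try lra; last first.
- by move=> z zr za; apply: hk => //; [lra|rewrite -rn_gt0; lra].
- by move=> z zr; apply: ck; lra.
rewrite -[k 0](circ_cst r) -circB; first last.
- by move=> z zr; exact: cfor_cst.
- by move=> z zr; apply: ck; lra.
- exact: ltW.
apply: rn_circ; first exact: ltW.
  by move=> z zr; apply: cforB; [apply: ck; lra|exact: cfor_cst].
by move=> z zr; apply/ltW/hd; rewrite subr0; lra.
Qed.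

(** The mean keeps its value when the radius grows, while [z / (z - h)] tends to 1. *)
Lemma circ_kernel_pole (h : C) (r : R) : rn h < r ->
  circ r (fun z => z / (z - h)) = 1.
Proof.
move=> hr; have r0 : 0 < r by apply: le_lt_trans hr; exact: rn_ge0.
have nz z : rn h < rn z -> z - h != 0.
  by move=> hz; rewrite subr_eq0; apply: contraTneq hz => ->; rewrite ltxx.
have cz z : rn h < rn z -> chol (fun z => z / (z - h)) z.
  move=> hz; apply: cholM; first exact: chol_id.
  apply: cholV; last exact: nz.
  by apply: cholB; [exact: chol_id|exact: chol_cst].
apply/eqP; rewrite -subr_eq0 -rn_eq0 eq_le rn_ge0 andbT.
apply/ler_addgt0Pr => e e0; rewrite add0r.
(* At this radius [rn h <= e * (s - rn h)], so the integrand is within [e] of 1. *)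
pose s := r + rn h / e.
have s1 : r <= s by rewrite lerDl divr_ge0 ?rn_ge0 // ltW.
rewrite (@circ_annulus _ r s) //; last by move=> z zr; apply: cz; lra.
have s0 : 0 <= s by lra.
rewrite -[1](circ_cst s) -circB; first last.
- by move=> z zr; exact: cfor_cst.
- by move=> z zr; apply: chol_continuous; apply: cz; lra.
- exact: s0.
apply: (rn_circ s0) => z zs.
  by apply: cforB; [apply: chol_continuous; apply: cz; lra|exact: cfor_cst].
have -> : z / (z - h) - 1 = h / (z - h) by field; apply: nz; lra.
rewrite rnM rnV ler_pdivrMr; last by rewrite rn_gt0; apply: nz; lra.
apply: (@le_trans _ _ (e * (s - rn h))); last first.
  by rewrite ler_wpM2l ?(ltW e0) // -zs rn_ler_sub.
rewrite /s; have -> : e * (r + rn h / e - rn h) = e * (r - rn h) + rn h.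
  by field; rewrite gt_eqF.
by rewrite lerDr mulr_ge0 //; lra.
Qed.

(** The function [K], a difference quotient at [h] multiplied by [z], is continuous at [h] and
    vanishes at 0, so its mean is 0. At 0 only continuity of [k] enters, and this is what later
    yields Riemann's theorem on removable singularities. *)
Lemma cauchy_formula k (h : C) (r s0 : R) : rn h < r -> r < s0 ->
  (forall z, rn z < s0 -> {for z, continuous k}) ->
  (forall z, rn z < s0 -> z != 0 -> chol k z) ->
  circ r (fun z => k z * (z / (z - h))) = k h.
Proof.
move=> hr rs ck hk; have r0 : 0 < r by apply: le_lt_trans hr; exact: rn_ge0.
have nz z : rn h < rn z -> z - h != 0.
  by move=> hz; rewrite subr_eq0; apply: contraTneq hz => ->; rewrite ltxx.
(* For [h = 0] the kernel is 1 and the claim is the mean value property. *)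
have [h0|h0] := eqVneq h 0.
  rewrite h0 -(@mean_value1 k 0 r s0 r0 rs ck); last by move=> z zs z0 _; exact: hk.
  apply: circ_ext; first exact: ltW.
  by move=> z zr; rewrite subr0 divff ?mulr1 // -rn_gt0 zr.
have [q cq /nbhs_rnP[d d0 kq]] := hk h ltac:(lra) h0.
pose K z := if z == h then q h * h else (k z - k h) / (z - h) * z.
have Kq : \forall z \near h, q z * z = K z.
  apply/nbhs_rnP; exists d => // z /kq e; rewrite /K.
  case: eqVneq => [->//|zh]; rewrite {}e addrAC subrr add0r mulfK // subr_eq0 //.
have Kz z : z != h -> \forall w \near z, (k w - k h) / (w - h) * w = K w.
  move=> zh; have : \forall w \near z, w - h != 0.
    apply: continuous_near_neq0; last by rewrite subr_eq0.
    by apply: cforB; [exact: cfor_id|exact: cfor_cst].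
  apply: filterS => w wh; rewrite /K; case: eqVneq => // e.
  by rewrite e subrr eqxx in wh.
have K0 : circ r K = 0.
  transitivity (K 0); last by rewrite /K eq_sym (negbTE h0) mulr0.
  apply: (@mean_value1 K h r s0 r0 rs).
  - move=> z zs; have [->|zh] := eqVneq z h.
      by apply: cfor_near Kq _; apply: cforM cq _; exact: cfor_id.
    apply: cfor_near (Kz _ zh) _; apply: cforM; last exact: cfor_id.
    apply: cforM; first by apply: cforB; [exact: ck|exact: cfor_cst].
    by apply: cforV; [apply: cforB; [exact: cfor_id|exact: cfor_cst]|rewrite subr_eq0].
  - move=> z zs z0 zh; apply: chol_near (Kz _ zh) _; apply: cholM; last exact: chol_id.
    apply: cholM; first by apply: cholB; [exact: hk|exact: chol_cst].
    by apply: cholV; [apply: cholB; [exact: chol_id|exact: chol_cst]|rewrite subr_eq0].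
have cker (z : C) : rn z = r -> {for z, continuous (fun z : C => z / (z - h))}.
  move=> zr; apply: cforM; first exact: cfor_id.
  apply: cforV; last by apply: nz; lra.
  by apply: cforB; [exact: cfor_id|exact: cfor_cst].
have ckk (z : C) : rn z = r -> {for z, continuous (fun z : C => k z * (z / (z - h)))}.
  by move=> zr; apply: cforM; [apply: ck; lra|exact: cker].
have : circ r K = circ r (fun z => k z * (z / (z - h)) - k h * (z / (z - h))).
  apply: circ_ext; first exact: ltW.
  move=> z zr; have zh : z - h != 0 by apply: nz; lra.
  by rewrite /K -subr_eq0 (negbTE zh); field.
rewrite K0 (circB (ltW r0) ckk); last first.
  by move=> z zr; apply: cforM; [exact: cfor_cst|exact: cker].
rewrite (circZ _ (ltW r0) cker) circ_kernel_pole // mulr1 => /eqP.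
by rewrite eq_sym subr_eq0 => /eqP.
Qed.

End CircleMean.

(** * Cauchy estimates, removable singularities and the Schwarz lemma *)

Section Bernoulli.
Variable R : realType.

Lemma bernoulli (x : R) n : 0 <= x -> 1 + n%:R * x <= (1 + x) ^+ n.
Proof.
move=> x0; elim: n => [|n IH]; first by rewrite mul0r addr0 expr0.
rewrite exprS; apply: (@le_trans _ _ ((1 + x) * (1 + n%:R * x))).
  by rewrite mulrSr; have : 0 <= n%:R * x * x by [rewrite !mulr_ge0]; lra.
by rewrite ler_wpM2l //; lra.
Qed.

(** If [x / y] exceeded 1, its powers would outgrow [A] by Bernoulli's inequality. The lemma removes
    constant factors from estimates proved for all powers. *)
Lemma ler_of_exprn (x y A : R) : 0 <= x -> 0 <= y ->
  (forall n, x ^+ n <= A * y ^+ n) -> x <= y.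
Proof.
move=> x0 y0 H; rewrite leNgt; apply/negP => yx.
have [y1|y1] := eqVneq y 0; first by have := H 1%N; rewrite y1 !expr1 mulr0; lra.
have {}y0 : 0 < y by rewrite lt0r y1.
pose t := x / y - 1.
have t0 : 0 < t by rewrite subr_gt0 ltr_pdivlMr // mul1r.
have B n : n%:R * t <= A.
  have := bernoulli n (ltW t0).
  have -> : 1 + t = x / y by rewrite /t addrC subrK.
  rewrite expr_div_n.
  have : x ^+ n / y ^+ n <= A by rewrite ler_pdivrMr ?exprn_gt0.
  by lra.
have := archi_boundP (_ : 0 <= `|A| / t); set n := Num.bound _.
rewrite ltr_pdivrMr // => /(_ (divr_ge0 (normr_ge0 _) (ltW t0))).
by have := B n; have := ler_norm A; lra.
Qed.

Lemma eq0_of_exprn (x M t : R) : 0 <= x -> 0 <= t -> t < 1 ->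
  (forall n, x <= M * t ^+ n) -> x = 0.
Proof.
move=> x0 t0 t1 H; apply/eqP; rewrite eq_le x0 andbT leNgt; apply/negP => xgt.
have : 1 <= t; last by lra.
apply: (@ler_of_exprn _ _ (M / x)) => // n.
by rewrite expr1n mulrAC ler_pdivlMr // mul1r.
Qed.

End Bernoulli.

Section DiscTheory.
Variable R : realType.
Local Notation C := (Cplx R).
Implicit Types (f k : C -> C) (a c h z : C).

Lemma is_cder_unique f a d1 d2 : is_cder f a d1 -> is_cder f a d2 -> d1 = d2.
Proof.
move=> [p [cp <- fp]] [q [cq <- fq]]; apply/eqP; rewrite -subr_eq0; apply/negPn/negP => ne.
have H : \forall z \near a, p z - q z != 0.
  exact: (@continuous_near_neq0 _ (fun z => p z - q z) a (cforB cp cq) ne).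
have /nbhs_rnP[r r0 hr] : \forall z \near a, (p z - q z) * (z - a) = 0 /\ p z - q z != 0.
  near=> z; split; last by near: z.
  by rewrite mulrBl; apply/eqP; rewrite subr_eq0 -(inj_eq (addrI (f a))); apply/eqP;
    rewrite -(near fp z) // -(near fq z).
have [] := hr (a + rc (r / 2)).
  by rewrite addrC addKr rn_rc ger0_norm; lra.
move=> /eqP; rewrite mulf_eq0 => /orP[->//|].
by rewrite addrC addKr rc_eq0 gt_eqF //; lra.
Unshelve. all: by end_near. Qed.

Definition cder f a : C := xget 0 (is_cder f a).

Lemma cderP f a : chol f a -> is_cder f a (cder f a).
Proof.
move=> [q cq fq]; rewrite /cder; apply: (@xgetPex _ 0 (is_cder f a)).
by exists (q a), q.
Qed.

Lemma cderE f a d : is_cder f a d -> cder f a = d.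
Proof. by move=> fd; exact: (is_cder_unique (cderP (is_cder_chol fd)) fd). Qed.

Lemma is_cder_near f g a d : (\forall z \near a, f z = g z) ->
  is_cder f a d -> is_cder g a d.
Proof.
move=> fg [q [cq qa fq]]; exists q; split; [exact: cq|exact: qa|near=> z].
by rewrite -(near fg z) // (near fq z) // (nbhs_singleton fg).
Unshelve. all: by end_near. Qed.

Lemma cder_near f g a : (\forall z \near a, f z = g z) -> cder f a = cder g a.
Proof.
move=> fg; rewrite /cder; congr xget; apply/seteqP; split=> d.
  exact: is_cder_near fg.
by apply: is_cder_near; apply: filterS fg => z ->.
Qed.

Lemma cderM f k a : chol f a -> chol k a ->
  cder (fun z => f z * k z) a = cder f a * k a + f a * cder k a.
Proof.
move=> hf hk; have ck := chol_continuous hk.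
have [p [cp <- fp]] := cderP hf; have [q [cq <- kq]] := cderP hk.
apply: cderE; exists (fun z => p z * k z + f a * q z); split; last first.
- near=> z; rewrite (near fp z) //.
  have e : q z * (z - a) = k z - k a by rewrite [in RHS](near kq z) // [RHS]addrC addKr.
  rewrite [RHS](_ : _ = f a * k a + p z * k z * (z - a) + f a * (q z * (z - a))).
    by rewrite e; ring.
  by ring.
- by [].
- apply: cforD; first exact: cforM cp ck.
  by apply: cforM cq; exact: cfor_cst.
Unshelve. all: by end_near. Qed.

Lemma cderD f k a : chol f a -> chol k a ->
  cder (fun z => f z + k z) a = cder f a + cder k a.
Proof.
move=> hf hk.
have [p [cp <- fp]] := cderP hf; have [q [cq <- kq]] := cderP hk.
apply: cderE; exists (fun z => p z + q z); split; [exact: cforD cp cq|by []|].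
by near=> z; rewrite (near fp z) // (near kq z) //; ring.
Unshelve. all: by end_near. Qed.

Lemma cder_cst (c a : C) : cder (fun=> c) a = 0.
Proof.
apply: cderE; exists (fun=> 0); split; [exact: cfor_cst|by []|].
by near=> z; rewrite mul0r addr0.
Unshelve. all: by end_near. Qed.

Lemma cder_id a : cder id a = 1.
Proof.
apply: cderE; exists (fun=> 1); split; [exact: cfor_cst|by []|].
by near=> z; rewrite mul1r addrC subrK.
Unshelve. all: by end_near. Qed.

Lemma cfor_shift k c h : {for c + h, continuous k} -> {for h, continuous (fun z => k (c + z))}.
Proof.
move=> ck; have ch : {for h, continuous (fun z => c + z)}.
  by apply: cforD; [exact: cfor_cst|exact: cfor_id].
exact: (@cfor_comp _ _ _ (fun z => c + z) k h ch ck).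
Qed.

Lemma chol_shift k c h : chol k (c + h) -> chol (fun z => k (c + z)) h.
Proof.
move=> ck; have ch : chol (fun z => c + z) h.
  by apply: cholD; [exact: chol_cst|exact: chol_id].
exact: (@chol_comp _ k (fun z => c + z) h ch ck).
Qed.

Lemma cfor_inv_sub h z : z - h != 0 -> {for z, continuous (fun z => (z - h)^-1)}.
Proof.
by move=> zh; apply: cforV; [apply: cforB; [exact: cfor_id|exact: cfor_cst]|exact: zh].
Qed.

Lemma rn_lt_sub_neq0 h z : rn h < rn z -> z - h != 0.
Proof. by rewrite subr_eq0; apply: contraTneq => ->; rewrite ltxx. Qed.

Section Disc.
Variables (k : C -> C) (c : C) (s0 r : R).
Hypotheses (r0 : 0 < r) (rs : r < s0).
Hypothesis ck : forall z, rn (z - c) < s0 -> {for z, continuous k}.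
Hypothesis hk : forall z, rn (z - c) < s0 -> z != c -> chol k z.

Let ck' z : rn z < s0 -> {for z, continuous (fun z => k (c + z))}.
Proof. by move=> zs; apply: cfor_shift; apply: ck; rewrite addrC addKr. Qed.

Let hk' z : rn z < s0 -> z != 0 -> chol (fun z => k (c + z)) z.
Proof.
move=> zs z0; apply: chol_shift; apply: hk; first by rewrite addrC addKr.
by rewrite -subr_eq0 addrC addKr.
Qed.

Lemma disc_cauchy h : rn h < r ->
  k (c + h) = circ r (fun z => k (c + z) * (z / (z - h))).
Proof. by move=> hr; rewrite (cauchy_formula hr rs ck' hk'). Qed.

(** The difference quotient of [k] between [c] and [c + h] as a Cauchy integral, which makes sense
    also for [h = 0], where it is the derivative. *)
Definition cquot h : C := circ r (fun z => k (c + z) / (z - h)).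

Let cker h : rn h < r -> forall z : C, rn z = r ->
  {for z, continuous (fun z => k (c + z) / (z - h))}.
Proof.
have r0' := r0; have rs' := rs.
move=> hr z zr; apply: cforM.
  apply: ck'; lra.
by apply: cfor_inv_sub; apply: rn_lt_sub_neq0; lra.
Qed.

Let rn00 : rn (0 : C) < r. Proof. by rewrite rn0. Qed.

Lemma disc_quot h : rn h < r -> k (c + h) = k c + cquot h * h.
Proof.
have r0' := r0; have rs' := rs.
move=> hr; have e0 := disc_cauchy rn00; rewrite addr0 in e0.
rewrite e0 (disc_cauchy hr) mulrC -(circZ _ (ltW r0) (cker hr)).
have cc z : rn z = r -> {for z, continuous (fun z => k (c + z) * (z / (z - 0)))}.
  move=> zr; apply: cforM; first by apply: ck'; lra.
  apply: cforM; first exact: cfor_id.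
  by apply: cfor_inv_sub; apply: rn_lt_sub_neq0; rewrite rn0; lra.
have ch z : rn z = r -> {for z, continuous (fun z => k (c + z) * (z / (z - h)))}.
  move=> zr; apply: cforM; first by apply: ck'; lra.
  apply: cforM; first exact: cfor_id.
  by apply: cfor_inv_sub; apply: rn_lt_sub_neq0; lra.
apply/eqP; rewrite addrC -subr_eq -(circB (ltW r0) ch cc); apply/eqP.
apply: circ_ext; first exact: ltW.
move=> z zr; have z0 : z != 0 by rewrite -rn_gt0 zr.
have zh : z - h != 0 by apply: rn_lt_sub_neq0; lra.
by rewrite subr0; field; rewrite zh z0.
Qed.

Section Bound.
Variable M : R.
Hypothesis kM : forall z, rn (z - c) = r -> rn (k z) <= M.

Let kM' z : rn z = r -> rn (k (c + z)) <= M.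
Proof. by move=> zr; apply: kM; rewrite addrC addKr. Qed.

Lemma circle_bound_ge0 : 0 <= M.
Proof. by apply: le_trans (kM' (_ : rn (rc r) = r)); rewrite ?rn_ge0 // rn_rc ger0_norm // ltW. Qed.

Lemma rn_cquot h : rn h < r -> rn (cquot h) <= M / (r - rn h).
Proof.
have r0' := r0; have rs' := rs.
move=> hr; apply: (rn_circ (ltW r0) (cker hr)) => z zr.
have zh : z - h != 0 by apply: rn_lt_sub_neq0; lra.
rewrite rnM rnV ler_pM ?invr_ge0 ?rn_ge0 //; first exact: kM'.
rewrite lef_pV2 ?posrE ?rn_gt0 //; last by lra.
by have := rn_ler_sub z h; rewrite zr.
Qed.

Lemma cquot_dist h : rn h < r -> rn (cquot h - cquot 0) <= M * rn h / (r * (r - rn h)).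
Proof.
have r0' := r0; have rs' := rs.
move=> hr; rewrite /cquot -(circB (ltW r0) (cker hr) (cker rn00)).
apply: (rn_circ (ltW r0)).
  by move=> z zr; apply: cforB; [exact: cker hr z zr|exact: cker rn00 z zr].
move=> z zr; have z0 : z != 0 by rewrite -rn_gt0 zr.
have zh : z - h != 0 by apply: rn_lt_sub_neq0; lra.
have -> : k (c + z) / (z - h) - k (c + z) / (z - 0) = k (c + z) * h / (z * (z - h)).
  by rewrite subr0; field; rewrite zh z0.
rewrite rnM rnV !rnM zr ler_pM ?invr_ge0 ?mulr_ge0 ?rn_ge0 ?(ltW r0) //.
  by rewrite ler_wpM2r ?rn_ge0 // kM'.
have rh : 0 < r - rn h by lra.
rewrite lef_pV2 ?posrE ?mulr_gt0 ?rn_gt0 // ler_wpM2l ?(ltW r0) //.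
by have := rn_ler_sub z h; rewrite zr.
Qed.

End Bound.

Lemma circle_bounded : exists M : R, forall z, rn (z - c) = r -> rn (k z) <= M.
Proof.
have r0' := r0; have rs' := rs.
have [||z zr zmax] := @compact_max _ _ (fun z => rn (k z)) _ _ (@compact_C_sphere _ c r).
- by exists (c + rc r); rewrite /= addrC addKr rn_rc ger0_norm // ltW.
- by move=> z /= zr; apply: cfor_rn; apply: ck; rewrite zr.
by exists (rn (k z)) => w wr; exact: zmax.
Qed.

Lemma disc_is_cder : is_cder k c (cquot 0).
Proof.
have r0' := r0; have rs' := rs.
have [M kM] := circle_bounded; have M0 := circle_bound_ge0 kM.
exists (fun z => cquot (z - c)); split.
- apply/cfor_rnP => e e0; rewrite subrr.
  pose d := Num.min (r / 2) (e * r * r / (2 * (M + 1))).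
  have M1 : 0 < 2 * (M + 1) by lra.
  have d0 : 0 < d.
    by rewrite lt_min; apply/andP; split; [lra|rewrite divr_gt0 // !mulr_gt0].
  have d1 : d <= r / 2 by rewrite ge_min lexx.
  have d2 : d <= e * r * r / (2 * (M + 1)) by rewrite ge_min lexx orbT.
  clearbody d; apply/nbhs_rnP; exists d => // z zd.
  have hr : rn (z - c) < r by lra.
  apply: le_lt_trans (cquot_dist kM hr) _.
  rewrite ltr_pdivrMr; last by rewrite mulr_gt0 //; lra.
  rewrite ler_pdivlMr // in d2.
  have t0 := rn_ge0 (z - c); set t := rn (z - c) in zd hr t0 *.
  have a1 : (M + 1) * t <= (M + 1) * d by rewrite ler_wpM2l; lra.
  have a2 : e * (r * (r / 2)) <= e * (r * (r - t)).
    by rewrite !ler_wpM2l ?(ltW e0) ?(ltW r0) //; lra.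
  have a3 : (M + 1) * t < e * (r * (r - t)); last by lra.
  have [t00|tp] := eqVneq t 0.
    by rewrite t00 mulr0 subr0; apply: mulr_gt0 => //; exact: mulr_gt0.
  have : (M + 1) * t < (M + 1) * d by rewrite ltr_pM2l; lra.
  lra.
- by rewrite subrr.
apply/nbhs_rnP; exists r => // z zr.
by rewrite -(disc_quot zr) addrC subrK.
Qed.

(** [disc_quot] supplies a continuous difference quotient at [c], obtained from Cauchy's formula
    with mere continuity at this point. *)
Lemma removable : chol k c.
Proof. exact: is_cder_chol disc_is_cder. Qed.

End Disc.

Section HoloDisc.
Variables (k : C -> C) (c : C) (s0 : R).
Hypothesis hk : forall z, rn (z - c) < s0 -> chol k z.

Let ck z : rn (z - c) < s0 -> {for z, continuous k}.
Proof. by move=> zs; apply: chol_continuous; exact: hk. Qed.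

Lemma disc_cder (r : R) : 0 < r -> r < s0 -> cder k c = circ r (fun z => k (c + z) / z).
Proof.
move=> r0 rs; rewrite (cderE (disc_is_cder r0 rs ck (fun z e _ => hk e))).
by rewrite /cquot; apply: circ_ext (ltW r0) _ => z _; rewrite subr0.
Qed.

(** Cauchy's formula for [k ^+ n] bounds [rn (k z) ^+ n] by [M ^+ n] times a constant independent of
    [n]; extracting roots removes the constant. *)
Lemma max_principle (r M : R) : 0 < r -> r < s0 ->
  (forall z, rn (z - c) = r -> rn (k z) <= M) ->
  forall z, rn (z - c) <= r -> rn (k z) <= M.
Proof.
move=> r0 rs kM z; rewrite le_eqVlt => /orP[/eqP/kM//|zr].
have M0 := circle_bound_ge0 r0 kM.
apply: (@ler_of_exprn _ _ _ (r / (r - rn (z - c)))); [exact: rn_ge0|exact: M0|move=> n].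
rewrite -rnX.
have hkn w : rn (w - c) < s0 -> chol (fun z => k z ^+ n) w by move=> /hk; exact: cholX.
have ckn w : rn (w - c) < s0 -> {for w, continuous (fun z => k z ^+ n)}.
  by move=> /hkn; exact: chol_continuous.
have := disc_cauchy rs ckn (fun z e _ => hkn _ e) zr.
rewrite addrC subrK => ->.
apply: (rn_circ (ltW r0)).
  move=> w wr; have wz : w - (z - c) != 0 by apply: rn_lt_sub_neq0; lra.
  apply: cforM; first by apply: (@cfor_shift (fun w => k w ^+ n)); apply: ckn; rewrite addrC addKr; lra.
  by apply: cforM; [exact: cfor_id|exact: cfor_inv_sub].
move=> w wr; have wz : w - (z - c) != 0 by apply: rn_lt_sub_neq0; lra.
rewrite mulrC !rnM rnV wr rnX ler_pM //.
- by rewrite divr_ge0 ?rn_ge0 // ltW.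
- by rewrite exprn_ge0 ?rn_ge0.
- rewrite ler_pM ?invr_ge0 ?rn_ge0 ?(ltW r0) //.
  rewrite lef_pV2 ?posrE ?rn_gt0 //; last by lra.
  by have := rn_ler_sub w (z - c); rewrite wr.
- rewrite lerXn2r ?nnegrE ?rn_ge0 //.
  by apply: kM; rewrite addrC addKr.
Qed.

End HoloDisc.

(** Without a zero, the maximum principle for [1 / k] would give [rn (k c) >= m]. *)
Lemma zero_in_disc k c (s0 r m : R) : 0 < r -> r < s0 -> 0 < m ->
  (forall z, rn (z - c) < s0 -> chol k z) ->
  (forall z, r <= rn (z - c) < s0 -> m <= rn (k z)) -> rn (k c) < m ->
  exists2 z, rn (z - c) < r & k z = 0.
Proof.
move=> r0 rs m0 hk km kc; apply: contrapT => H.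
have nz z : rn (z - c) < s0 -> k z != 0.
  move=> zs; have [rz|zr] := lerP r (rn (z - c)).
    by rewrite -rn_gt0; apply: lt_le_trans (km _ _) => //; rewrite rz.
  by apply/eqP => kz; apply: H; exists z.
have c0 : rn (c - c) < s0 by rewrite subrr rn0; lra.
have : rn (k c)^-1 <= m^-1.
  apply: (@max_principle (fun z => (k z)^-1) c s0 _ r _ r0 rs).
  - by move=> z zs; exact: cholV (hk _ zs) (nz _ zs).
  - move=> z zr; rewrite rnV lef_pV2 ?posrE ?rn_gt0 //; last by apply: nz; lra.
    by apply: km; lra.
  - by rewrite subrr rn0 ltW.
rewrite rnV lef_pV2 ?posrE ?rn_gt0 ?nz //.
by lra.
Qed.

Section CauchyEstimates.
Variables (k : C -> C) (c : C) (s M : R).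
Hypothesis s0 : 0 < s.
Hypothesis hk : forall z, rn (z - c) < s -> chol k z.
Hypothesis kM : forall z, rn (z - c) < s -> rn (k z) <= M.

Let ck z : rn (z - c) < s -> {for z, continuous k}.
Proof. by move=> zs; apply: chol_continuous; exact: hk. Qed.

(** For [rn (z - c) <= s / 2] this radius leaves a distance of at least [s / 4] to the circle; the
    resulting constants 4 and 16/3 are rounded up to 8. *)
Let r := 3 / 4 * s.
Let r0 : 0 < r. Proof. by have := s0; rewrite /r; lra. Qed.
Let rs : r < s. Proof. by have := s0; rewrite /r; lra. Qed.
Let kr z : rn (z - c) = r -> rn (k z) <= M.
Proof. by move=> zr; apply: kM; rewrite zr. Qed.
Let dq := @disc_quot k c s r r0 rs ck (fun z e _ => hk e).

Lemma cauchy_lip z : rn (z - c) <= s / 2 -> rn (k z - k c) <= 8 * M / s * rn (z - c).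
Proof.
have s0' := s0.
move=> zs; have zr : rn (z - c) < r by rewrite /r; lra.
have r0' := r0; have rs' := rs.
have M0 := circle_bound_ge0 r0 kr.
have := dq zr; rewrite addrC subrK => ->; rewrite addrC addKr rnM ler_wpM2r ?rn_ge0 //.
apply: le_trans (rn_cquot r0 rs ck kr zr) _.
have d0 : 0 < r - rn (z - c) by lra.
rewrite ler_pdivrMr // mulrAC ler_pdivlMr //.
have : M * s <= M * (8 * (r - rn (z - c))) by rewrite ler_wpM2l // /r; lra.
lra.
Qed.

Lemma cauchy_taylor1 z : rn (z - c) <= s / 2 ->
  rn (k z - k c - cder k c * (z - c)) <= 8 * M / s ^+ 2 * rn (z - c) ^+ 2.
Proof.
have s0' := s0.
move=> zs; have zr : rn (z - c) < r by rewrite /r; lra.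
have r0' := r0; have rs' := rs.
have M0 := circle_bound_ge0 r0 kr.
rewrite (cderE (disc_is_cder r0 rs ck (fun z e _ => hk e))).
have := dq zr; rewrite addrC subrK => ->.
have E (x y u v : C) : x + y * v - x - u * v = (y - u) * v by ring.
rewrite E rnM [rn (z - c) ^+ 2]expr2 mulrA ler_wpM2r ?rn_ge0 //.
apply: le_trans (cquot_dist r0 rs ck kr zr) _.
have d0 : 0 < r - rn (z - c) by lra.
rewrite mulrAC ler_wpM2r ?rn_ge0 // ler_pdivrMr ?mulr_gt0 //.
rewrite mulrAC ler_pdivlMr ?exprn_gt0 //.
have : M * (s * s) <= M * (8 * (r * (r - rn (z - c)))).
  rewrite ler_wpM2l //.
  have : r * (r - rn (z - c)) >= 3/4 * s * (s / 4).
    by rewrite ler_pM //; rewrite /r; lra.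
  by have : 0 <= s * s by [rewrite mulr_ge0 // ltW]; lra.
by rewrite expr2; lra.
Qed.

End CauchyEstimates.

(* A bounded isolated singularity at [a] is harmless: multiplying powers of the
   difference quotient by [z - a] makes them continuous there. *)
Lemma schwarz_punctured k (a : C) (B t : R) : a != 0 -> t < 1 ->
  (forall z, rn z < 1 -> z != a -> chol k z) ->
  (forall z, rn z < 1 -> z != a -> rn (k z) <= B) ->
  (forall z, t < rn z < 1 -> z != a -> rn (k z) <= 1) ->
  k 0 = 0 -> forall z, rn z < 1 -> z != a -> rn (k z) <= rn z.
Proof.
move=> a0 t1 hk kB k1 k00 z z1 za.
have [->|z0] := eqVneq z 0; first by rewrite k00 !rn0.
have h0 : chol k 0 by apply: hk; rewrite ?rn0 // eq_sym.
have [q0 [cq0 _ kq0]] := cderP h0.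
(* The quotient [k w / w], completed at 0 by the derivative; the claim is that it is bounded by
   1. *)
pose q w := if w == 0 then q0 0 else k w / w.
have qE w : w != 0 -> q w = k w / w by rewrite /q => /negbTE ->.
have qnear w : w != 0 -> \forall y \near w, k y / y = q y.
  move=> w0; apply: filterS (@continuous_near_neq0 _ id w (@cfor_id _ w) w0).
  by move=> y y0; rewrite qE.
have hq w : w != 0 -> w != a -> rn w < 1 -> chol q w.
  move=> w0 wa w1; apply: chol_near (qnear _ w0) _.
  by apply: cholM; [exact: hk|exact: cholV (chol_id _) w0].
have q00 : {for 0, continuous q}.
  apply: cfor_near cq0; apply: filterS kq0 => y yE; rewrite /q.
  by case: eqVneq => [->//|y0]; rewrite yE k00 add0r subr0 mulfK.
have hq0 : chol q 0.
  pose d := Num.min 1 (rn a).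
  have d0 : 0 < d by rewrite lt_min ltr01 rn_gt0.
  have d1 : d <= 1 by rewrite ge_min lexx.
  have d2 : d <= rn a by rewrite ge_min lexx orbT.
  clearbody d.
  have hqd w : rn (w - 0) < d -> w != 0 -> chol q w.
    rewrite subr0 => wd w0; apply: (hq _ w0); last by lra.
    by apply: contraTneq wd => ->; lra.
  apply: (@removable q 0 d (d / 2)); [lra|lra| |exact: hqd].
  move=> w wd; have [->|w0] := eqVneq w 0; first exact: q00.
  by apply: chol_continuous; exact: hqd.
have hqa w : rn w < 1 -> w != a -> chol q w.
  by move=> w1 wa; have [->|w0] := eqVneq w 0; [exact: hq0|exact: hq].
have rz0 : 0 < rn z by rewrite rn_gt0.
suff : rn (q z) <= 1 by rewrite qE // rnM rnV ler_pdivrMr // mul1r.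
have [B' [B0 hB']] : exists B' : R, 0 <= B' /\ forall w, rn w < 1 -> w != a -> w != 0 -> rn (q w) <= B' / rn w.
  exists (Num.max B 0); split; first by rewrite le_max lexx orbT.
  move=> w w1 wa w0; rewrite qE // rnM rnV ler_wpM2r ?invr_ge0 ?rn_ge0 //.
  by rewrite le_max kB.
pose u n w := q w ^+ n * (w - a).
have hu n w : rn w < 1 -> w != a -> chol (u n) w.
  move=> w1 wa; apply: cholM; first by apply: cholX; exact: hqa.
  by apply: cholB; [exact: chol_id|exact: chol_cst].
have cua n : rn a < 1 -> {for a, continuous (u n)}.
  move=> a1; apply/cfor_rnP => e e0.
  have ra0 : 0 < rn a by rewrite rn_gt0.
  pose A := (B' / (rn a / 2)) ^+ n.
  have A0 : 0 <= A by rewrite exprn_ge0 // divr_ge0 //; lra.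
  pose d := Num.min (Num.min (rn a / 2) (1 - rn a)) (e / (A + 1)).
  have A1 : 0 < A + 1 by lra.
  have e3 : 0 < e / (A + 1) by rewrite divr_gt0.
  have d0 : 0 < d by rewrite !lt_min e3 andbT; apply/andP; split; lra.
  have d1 : d <= rn a / 2 by rewrite !ge_min lexx.
  have d2 : d <= 1 - rn a by rewrite !ge_min lexx orbT.
  have d3 : d <= e / (A + 1) by rewrite !ge_min lexx !orbT.
  clearbody d; apply/nbhs_rnP; exists d => // w wd.
  rewrite /u subrr mulr0 subr0.
  have [->|wa] := eqVneq w a; first by rewrite subrr mulr0 rn0.
  have w1 : rn a / 2 <= rn w by have := rn_ler_sub a w; rewrite rnC; lra.
  have w2 : rn w < 1 by have := rn_ler_sub w a; lra.
  have w0 : w != 0 by rewrite -rn_gt0; lra.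
  rewrite rnM rnX.
  have qA : rn (q w) ^+ n <= A.
    rewrite lerXn2r ?nnegrE ?rn_ge0 ?divr_ge0 //; first by lra.
    apply: le_trans (hB' w w2 wa w0) _.
    by rewrite ler_wpM2l // lef_pV2 ?posrE //; lra.
  apply: (@le_lt_trans _ _ (A * rn (w - a))); first by rewrite ler_wpM2r ?rn_ge0.
  rewrite ler_pdivlMr // in d3.
  have : A * rn (w - a) <= A * d by rewrite ler_wpM2l // ltW.
  lra.
have hu' n w : rn w < 1 -> chol (u n) w.
  move=> w1; have [wa|] := eqVneq w a; last exact: hu.
  rewrite {}wa in w1 *.
  apply: (@removable (u n) a (1 - rn a) ((1 - rn a) / 2)); [lra|lra| |].
    move=> y ya; have [->|y0] := eqVneq y a; first exact: cua.
    by apply: chol_continuous; apply: hu => //; have := rn_ler_sub y a; lra.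
  by move=> y ya y0; apply: hu => //; have := rn_ler_sub y a; lra.
(* On the circle of radius [s] the quotient is at most [1 / s], and the factor [w - a] contributes a
   constant independent of [n], which [ler_of_exprn] discards. *)
have main s : Num.max (Num.max t (rn z)) 0 < s -> s < 1 -> rn (q z) <= s^-1.
  rewrite !gt_max => /andP[/andP[ts zs] sp] s1.
  have za0 : 0 < rn (z - a) by rewrite rn_gt0 subr_eq0.
  apply: (@ler_of_exprn _ _ _ ((1 + rn a) / rn (z - a))); [exact: rn_ge0|by rewrite invr_ge0 ltW|].
  move=> n; rewrite mulrAC ler_pdivlMr // -rnX -rnM.
  apply: (@max_principle (u n) 0 1 _ s); rewrite ?subr0; [|exact: sp|exact: s1| |exact: ltW].
    by move=> w; rewrite subr0; exact: hu'.
  move=> w; rewrite subr0 => ws.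
  rewrite /u; have [->|wa] := eqVneq w a.
    by rewrite subrr mulr0 rn0 mulr_ge0 ?exprn_ge0 ?invr_ge0 ?(ltW sp) // addr_ge0 // rn_ge0.
  rewrite rnM rnX mulrC ler_pM ?exprn_ge0 ?rn_ge0 //.
    by apply: le_trans (rnB _ _) _; rewrite ws; lra.
  rewrite lerXn2r ?nnegrE ?rn_ge0 ?invr_ge0 ?(ltW sp) //.
  have w0 : w != 0 by rewrite -rn_gt0 ws.
  rewrite qE // rnM rnV ws ler_piMl ?invr_ge0 ?(ltW sp) // k1 // ws.
  by rewrite ts.
apply/ler_addgt0Pr => e e0.
pose m := Num.max (Num.max t (rn z)) 0.
have m1 : m < 1 by rewrite !gt_max t1 z1 ltr01.
have m0 : 0 <= m by rewrite le_max lexx orbT.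
pose s := Num.max ((m + 1) / 2) (1 + e)^-1.
have e1 : (1 + e)^-1 < 1 by rewrite invf_lt1; lra.
have sm : m < s by rewrite lt_max; apply/orP; left; lra.
have s1 : s < 1 by rewrite gt_max e1 andbT; lra.
have se : (1 + e)^-1 <= s by rewrite le_max lexx orbT.
apply: le_trans (main s sm s1) _.
by rewrite -[leRHS]invrK lef_pV2 ?posrE ?invr_gt0 //; lra.
Qed.

End DiscTheory.

(** * Hurwitz theorem *)

Section Parametric.
Variable R : realType.
Local Notation C := (Cplx R).

(** The retraction of R onto [0, 1]; composing with it extends an integrand continuously beyond the
    end points, as [cont01] demands. *)
Definition clip01 (t : R) : R := Num.max 0 (Num.min 1 t).

Lemma clip01_bound t : 0 <= clip01 t <= 1.
Proof. by rewrite /clip01 le_max lexx /= ge_max ler01 ge_min lexx. Qed.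

Lemma clip01_id t : 0 <= t <= 1 -> clip01 t = t.
Proof. by move=> /andP[t0 t1]; rewrite /clip01 min_r // max_r. Qed.

Lemma clip01E t : clip01 t = if t < 0 then 0 else if 1 < t then 1 else t.
Proof.
rewrite /clip01; case: ltP => t0; first by rewrite min_r ?max_l; lra.
by case: ltP => t1; rewrite max_r; lra.
Qed.

Lemma continuous_clip01 : continuous clip01.
Proof.
move=> t; apply/cvgrPdist_lt => e e0; apply/nbhs_ballP; exists e => //= s ts.
apply: le_lt_trans ts; rewrite ler_norml !clip01E.
case: (ltP t 0) => ?; case: (ltP 1 t) => ?; case: (ltP s 0) => ?; case: (ltP 1 s) => ?;
  have [h|h] := lerP 0 (t - s); rewrite ?(ger0_norm h) ?(ltr0_norm h);
  by apply/andP; split; lra.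
Qed.

Lemma cfor_slice (T U W : topologicalType) (f : T -> U -> W) (x : T) (u : U) :
  {for (x, u), continuous (fun p => f p.1 p.2)} -> {for u, continuous (f x)}.
Proof.
move=> cf; have cp : {for u, continuous (fun v : U => (x, v))}.
  by apply: cfor_pair; [exact: cfor_cst|exact: cfor_id].
exact: (cfor_comp cp cf).
Qed.

Lemma cfor_slice' (T U W : topologicalType) (f : T -> U -> W) (x : T) (u : U) :
  {for (x, u), continuous (fun p => f p.1 p.2)} -> {for x, continuous (f^~ u)}.
Proof.
move=> cf; have cp : {for x, continuous (fun y : T => (y, u))}.
  by apply: cfor_pair; [exact: cfor_id|exact: cfor_cst].
exact: (cfor_comp cp cf).
Qed.

(** By [cauchy_taylor1] the first-order remainder in [z] is at most [K * rn (z - c) ^+ 2] with [K]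
    independent of the parameter, and this bound survives integration. Compactness of the parameter
    interval supplies the uniform bound [M] behind [K]. *)
Lemma chol_dint (f : C -> R -> C) (c : C) (s : R) : 0 < s ->
  (forall (t : R) z, 0 <= t <= 1 -> rn (z - c) < s -> chol (f^~ t) z) ->
  (forall (t : R) z, 0 <= t <= 1 -> rn (z - c) < s ->
     {for (z, t), continuous (fun p => f p.1 p.2)}) ->
  chol (fun z => dint (f z)) c.
Proof.
move=> s0 hf cf.
have cs : rn (c - c) < s by rewrite subrr rn0.
have cfz z : rn (z - c) < s -> cont01 (f z).
  by move=> zs t t01; apply: (@cfor_slice _ _ _ f); exact: cf.
have [M [s1 [M0 [s10 s1s hM]]]] : exists M s1 : R, 0 <= M /\ [/\ 0 < s1, s1 <= s &
    forall (t : R) z, 0 <= t <= 1 -> rn (z - c) < s1 -> rn (f z t) <= M].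
  have := near_unif01 ltr01 (cfz c cs) (fun t t01 => cf t c t01 cs).
  move=> /nbhs_rnP[d d0 hd].
  have [||t t01 tM] := @compact_max R _ (fun t => rn (f c t)) _ _ (@segment_compact R 0 1).
  - by exists 0; rewrite /= in_itv /= lexx ler01.
  - move=> t; rewrite /= in_itv /= => t01.
    by apply: cfor_rn; exact: (cfz c cs).
  exists (rn (f c t) + 1), (Num.min d s); split; first by rewrite addr_ge0 ?rn_ge0.
  split; [by rewrite lt_min d0|by rewrite ge_min lexx orbT|].
  move=> u z u01; rewrite lt_min => /andP[zd zs].
  have := hd z zd u u01; have := tM u; rewrite /= in_itv /= => /(_ u01).
  have := rn_ler_sub (f z u) (f c u); lra.
pose d t := cder (f^~ t) c.
have est (t : R) z : 0 <= t <= 1 -> rn (z - c) <= s1 / 2 ->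
    rn (f z t - f c t - d t * (z - c)) <= 8 * M / s1 ^+ 2 * rn (z - c) ^+ 2.
  move=> t01 zs; apply: (@cauchy_taylor1 _ (f^~ t) c s1 M s10) => //.
    by move=> w ws; apply: hf => //; apply: lt_le_trans ws _.
  by move=> w ws; exact: hM.
set K := 8 * M / s1 ^+ 2 in est.
have K0 : 0 <= K by rewrite divr_ge0 ?exprn_ge0 ?mulr_ge0 // ltW.
(* The derivatives are approximated, uniformly in the parameter, by difference quotients [Q] that
   are continuous in it, hence are continuous themselves. *)
have cd : cont01 (fun t => d (clip01 t)).
  move=> t0 t01; apply/cfor_rnP => e e0.
  pose h := Num.min (s1 / 2) (e / (4 * (K + 1))).
  have K4 : 0 < 4 * (K + 1) by lra.
  have h0 : 0 < h by rewrite lt_min divr_gt0 // divr_gt0.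
  have h1 : h <= s1 / 2 by rewrite ge_min lexx.
  have h2 : h <= e / (4 * (K + 1)) by rewrite ge_min lexx orbT.
  clearbody h.
  pose z := c + rc h.
  have zc : z - c = rc h by rewrite /z addrC addKr.
  have rzc : rn (z - c) = h by rewrite zc rn_rc ger0_norm // ltW.
  have zs : rn (z - c) < s by lra.
  pose Q t := (f z t - f c t) / rc h.
  have cQ : {for t0, continuous (fun t => Q (clip01 t))}.
    apply: (@cfor_comp _ _ _ clip01 Q); first exact: continuous_clip01.
    rewrite clip01_id //; apply: cforM; last exact: cfor_cst.
    by apply: cforB; [exact: cfz|exact: cfz].
  have Qd t : rn (Q (clip01 t) - d (clip01 t)) <= e / 4.
    have := est (clip01 t) z (clip01_bound t); rewrite rzc => /(_ h1).
    rewrite zc; have rh : rc h != 0 by rewrite rc_eq0 gt_eqF.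
    have -> : f z (clip01 t) - f c (clip01 t) - d (clip01 t) * rc h =
       (Q (clip01 t) - d (clip01 t)) * rc h by rewrite /Q; field.
    rewrite rnM rn_rc (gtr0_norm h0) expr2 mulrA ler_pM2r // => H.
    apply: le_trans H _; rewrite ler_pdivlMr // in h2; lra.
  have e2 : 0 < e / 4 by lra.
  near=> t.
  have : rn (Q (clip01 t) - Q (clip01 t0)) < e / 4.
    by near: t; exact: (iffLR (cfor_rnP _ _) cQ).
  have := Qd t; have := Qd t0.
  have := rn_sub (d (clip01 t)) (Q (clip01 t)) (d (clip01 t0)).
  have := rn_sub (Q (clip01 t)) (Q (clip01 t0)) (d (clip01 t0)).
  rewrite (rnC (d (clip01 t)) (Q (clip01 t))); lra.
apply/cholP; exists (dint (fun t => d (clip01 t))) => e e0.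
pose r := Num.min (s1 / 2) (e / (K + 1)).
have K1 : 0 < K + 1 by lra.
have r0 : 0 < r by rewrite lt_min divr_gt0 // divr_gt0.
have r1 : r <= s1 / 2 by rewrite ge_min lexx.
have r2 : r <= e / (K + 1) by rewrite ge_min lexx orbT.
clearbody r; exists r => // z zr.
have zs : rn (z - c) < s by lra.
have c1 : cont01 (fun t => (z - c) * d (clip01 t)) by apply: cont01M cd; exact: cont01_cst.
have c2 : cont01 (fun t => f z t - f c t).
  by move=> t t01; apply: cforB; [exact: cfz|exact: cfz].
rewrite -(dintB (cfz z zs) (cfz c cs)) [_ * (z - c)]mulrC -(dintZ _ cd) -(dintB c2 c1).
apply: (@le_trans _ _ (K * rn (z - c) ^+ 2)).
  apply: rn_dint.
    by move=> t t01; apply: cforB; [exact: c2|exact: c1].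
  move=> t t01; rewrite clip01_id // mulrC; apply: est => //; lra.
rewrite expr2 mulrA ler_wpM2r ?rn_ge0 //.
rewrite ler_pdivlMr // in r2.
have : K * rn (z - c) <= K * r by rewrite ler_wpM2l // ltW.
lra.
Unshelve. all: by end_near. Qed.

(** Dividing [0, 1] into [n] steps bounds the total increment by [K / n]. This takes the place of a
    vanishing derivative along curves that are only Lipschitz. *)
Lemma subdivision_const (W : normedModType C) (f : R -> W) (K : R) :
  (forall s t : R, 0 <= s <= 1 -> 0 <= t <= 1 -> rn (f s - f t) <= K * (s - t) ^+ 2) ->
  f 0 = f 1.
Proof.
move=> H.
have K0 : 0 <= K.
  have := H 1 0; rewrite subr0 expr1n mulr1 !lexx !ler01 => /(_ isT isT).
  by apply: le_trans; exact: rn_ge0.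
have step n j : (0 < n)%N -> (j <= n)%N ->
    rn (f (j%:R / n%:R) - f 0) <= j%:R * (K / n%:R ^+ 2).
  move=> n0; have n0' : 0 < n%:R :> R by rewrite ltr0n.
  elim: j => [_|j IH jn]; first by rewrite !mul0r subrr rn0.
  have jn1 k : (k <= n)%N -> 0 <= (k%:R / n%:R : R) <= 1.
    by move=> kn; rewrite divr_ge0 //= ler_pdivrMr // mul1r ler_nat.
  apply: le_trans (rn_sub _ (f (j%:R / n%:R)) _) _.
  rewrite -[j.+1]addn1 natrD [X in _ <= X]mulrDl mul1r addrC.
  apply: lerD; first by apply: IH; exact: ltnW.
  apply: le_trans (H _ _ _ _) _.
  - by rewrite -natrD addn1; exact: jn1.
  - by apply: jn1; exact: ltnW.
  by rewrite -mulrBl addrC addKr mul1r exprVn.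
apply/esym/eqP; rewrite -subr_eq0 -rn_eq0 eq_le rn_ge0 andbT.
apply/ler_addgt0Pr => e e0; rewrite add0r.
have b0 : 0 <= K / e by rewrite divr_ge0 // ltW.
have := archi_boundP b0; set n := Num.bound _ => nK.
have n0 : (0 < n)%N by rewrite -(ltr0n R); apply: le_lt_trans nK.
have n0' : 0 < n%:R :> R by rewrite ltr0n.
have := step n n n0 (leqnn n); rewrite divff ?gt_eqF // => h.
apply: le_trans h _; rewrite expr2 invfM !mulrA [n%:R * K]mulrC mulfK ?gt_eqF //.
rewrite ler_pdivrMr //; rewrite ltr_pdivrMr // in nK; lra.
Qed.

(** On a closed annulus around the isolated zero, [rn (F x0 z)] has a minimum [m > 0]. For nearby
    [x] the values on the annulus stay above [m / 2] and the value at 0 stays below, so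
    [zero_in_disc] applies. *)
Lemma hurwitz (T : topologicalType) (F : T -> C -> C) (x0 : T) (s r : R) :
  0 < r -> r < s ->
  (\forall x \near x0, forall z, rn z < s -> chol (F x) z) ->
  (forall z, rn z < s -> {for (x0, z), continuous (fun p => F p.1 p.2)}) ->
  (forall z, 0 < rn z < s -> F x0 z != 0) -> F x0 0 = 0 ->
  \forall x \near x0, exists2 z, rn z < r & F x z = 0.
Proof.
move=> r0 rs hF cF nF F0.
pose s1 := (r + s) / 2.
have cA := @compact_C_annulus R 0 r s1.
have cz z : rn z < s -> {for z, continuous (F x0)}.
  by move=> zs; apply: (@cfor_slice _ _ _ F); exact: cF.
have [||z zA zm] := @compact_min R _ (fun z => rn (F x0 z)) _ _ cA.
- by exists (rc r); rewrite /= subr0 rn_rc ger0_norm /s1; lra.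
- by move=> z; rewrite /= subr0 => zA; apply: cfor_rn; apply: cz; rewrite /s1 in zA; lra.
rewrite /= subr0 in zA.
set m := rn (F x0 z) in zm.
have m0 : 0 < m by rewrite rn_gt0; apply: nF; rewrite /s1 in zA; lra.
have m2 : 0 < m / 4 by lra.
have near0 : \forall x \near x0, rn (F x 0) < m / 2.
  have z0 : rn (0 : C) < s by rewrite rn0; lra.
  have := iffLR (cfor_rnP _ _) (cfor_slice' (cF 0 z0)) _ m2.
  by apply: filterS => x; rewrite F0 subr0; lra.
have nearA : \forall x \near x0, [set z : C | r <= rn (z - 0) <= s1] `<=` (fun z => m / 2 < rn (F x z)).
  apply: (iffLR (compact_near_coveringP _) cA) => w wA.
  have wm := zm w wA; rewrite /= subr0 in wA.
  have ws : rn w < s by rewrite /s1 in wA; lra.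
  have := iffLR (cfor_rnP _ _) (cF w ws) _ m2.
  case=> -[A B] /= [nA nB] hAB; exists (B, A) => //=.
  move=> [y x] /= [By Ax]; have := hAB (x, y) (conj Ax By); rewrite /=.
  have := rn_ler_sub (F x0 w) (F x y); rewrite (rnC (F x0 w)); lra.
near=> x.
have [] : exists2 z, rn (z - 0) < r & F x z = 0.
  apply: (@zero_in_disc _ (F x) 0 s1 r (m / 2)) => //; try by rewrite /s1; lra.
  - move=> w; rewrite subr0 => ws.
    have : forall z, rn z < s -> chol (F x) z by near: x.
    by apply; rewrite /s1 in ws; lra.
  - move=> w wA; apply/ltW.
    have : [set z : C | r <= rn (z - 0) <= s1] `<=` (fun z => m / 2 < rn (F x z)) by near: x.
    by apply => /=; lra.
  - by near: x.
by move=> w; rewrite subr0 => wr wF; exists w.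
Unshelve. all: by end_near. Qed.

(** Suppose the derivative vanishes at 0. The divided difference [G 0] then has an isolated zero at
    0, so by Hurwitz's theorem [G z] has a zero [w] for every small [z]. Injectivity gives [w = z]:
    the derivative vanishes near 0, and [p] is constant on a segment. *)
Lemma injective_cder_neq0 (p : C -> C) (s : R) : 0 < s ->
  (forall z, rn z < s -> chol p z) ->
  (forall z w, rn z < s -> rn w < s -> p z = p w -> z = w) -> cder p 0 != 0.
Proof.
move=> s0 hp ip; apply/eqP => p0.
pose r := s / 2.
have r0 : 0 < r by rewrite /r; lra.
have rs : r < s by rewrite /r; lra.
have cp z : rn z < s -> {for z, continuous p} by move=> /hp; exact: chol_continuous.
(* The divided difference [(p w - p z) / (w - z)] as a Cauchy integral, jointly continuous also at
   the diagonal, where it is the derivative. *)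
pose G z w := circ r (fun y => p y * (y / ((y - z) * (y - w)))).
have cont_sub (T : topologicalType) (x : T) (u v : T -> C) :
    {for x, continuous u} -> {for x, continuous v} ->
    {for x, continuous (fun y => u y - v y)} by move=> cu cv; exact: cforB cu cv.
have jc (z w : C) (t : R) : rn z < r -> rn w < r ->
    {for ((z, w), t), continuous (fun q : (C * C) * R => p (rc r * cis q.2) *
      (rc r * cis q.2 / ((rc r * cis q.2 - q.1.1) * (rc r * cis q.2 - q.1.2))))}.
  move=> zr wr.
  have cy : {for ((z, w), t), continuous (fun q : (C * C) * R => rc r * cis q.2)}.
    apply: cforM; first exact: cfor_cst.
    by apply: cfor_comp; [exact: cvg_snd|exact: continuous_cis].
  have yr : rn (rc r * cis t) = r by rewrite rn_circle // ltW.
  apply: cforM; first by apply: (cfor_comp cy); apply: cp; rewrite yr.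
  apply: cforM; first exact: cy.
  apply: cforV; last first.
    by rewrite /= mulf_neq0 // rn_lt_sub_neq0 ?yr.
  apply: cforM; apply: cforB cy _.
    by apply: (@cfor_comp _ _ _ (fun q : (C * C) * R => q.1) fst); [exact: cvg_fst|exact: cvg_fst].
  by apply: (@cfor_comp _ _ _ (fun q : (C * C) * R => q.1) snd); [exact: cvg_fst|exact: cvg_snd].
have c01 (z w : C) : rn z < r -> rn w < r -> cont01 (fun t => p (rc r * cis t) *
      (rc r * cis t / ((rc r * cis t - z) * (rc r * cis t - w)))).
  move=> zr wr t t01.
  exact: (@cfor_slice _ _ _ (fun (q : C * C) (t : R) => p (rc r * cis t) *
      (rc r * cis t / ((rc r * cis t - q.1) * (rc r * cis t - q.2)))) (z, w) t (jc z w t zr wr)).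
have cG z w : rn z < r -> rn w < r -> {for (z, w), continuous (fun q => G q.1 q.2)}.
  move=> zr wr; apply: dint_continuous.
    have : \forall q \near ((z, w) : C * C), rn q.1 < r /\ rn q.2 < r.
      exists ([set u | rn (u - z) < r - rn z], [set u | rn (u - w) < r - rn w]).
        split; apply/nbhs_rnP; [exists (r - rn z)|exists (r - rn w)] => //; lra.
      move=> [u v] /= [uz vw]; have := rn_ler_sub u z; have := rn_ler_sub v w; lra.
    by apply: filterS => q [q1 q2]; exact: c01.
  by move=> t _; exact: jc.
have GE z w : rn z < r -> rn w < r -> p w = p z + G z w * (w - z).
  move=> zr wr.
  have F u : rn u < r -> p u = circ r (fun y => p y * (y / (y - u))).
    by move=> ur; rewrite (cauchy_formula ur rs) // => y ys _; exact: hp.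
  have cF u : rn u < r -> forall y : C, rn y = r -> {for y, continuous (fun y => p y * (y / (y - u)))}.
    move=> ur y yr; apply: cforM; first by apply: cp; rewrite yr.
    apply: cforM; first exact: cfor_id.
    by apply: cfor_inv_sub; apply: rn_lt_sub_neq0; rewrite yr.
  apply/eqP; rewrite addrC -subr_eq (F w wr) (F z zr) -(circB (ltW r0) (cF w wr) (cF z zr)).
  rewrite /G mulrC /circ -(dintZ _ (c01 z w zr wr)); apply/eqP.
  apply: dint_ext => t _.
  have yz : rc r * cis t - z != 0 by apply: rn_lt_sub_neq0; rewrite rn_circle // ltW.
  have yw : rc r * cis t - w != 0 by apply: rn_lt_sub_neq0; rewrite rn_circle // ltW.
  by field; rewrite yz yw.
have rn00 : rn (0 : C) < r by rewrite rn0.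
have cderG z : rn z < r -> cder p z = G z z.
  move=> zr; apply: cderE; exists (G z); split.
  - exact: (@cfor_slice _ _ _ G z z (cG z z zr zr)).
  - by [].
  - apply/nbhs_rnP; exists (r - rn z); first by lra.
    by move=> w wz; apply: GE => //; have := rn_ler_sub w z; lra.
have hG z w : rn z < r -> rn w < r -> chol (G z) w.
  move=> zr wr; apply: (@chol_dint _ _ (r - rn w)); first by lra.
    move=> t u t01 uw; have ur : rn u < r by have := rn_ler_sub u w; lra.
    have yz : rc r * cis t - z != 0 by apply: rn_lt_sub_neq0; rewrite rn_circle // ltW.
    have yu : rc r * cis t - u != 0 by apply: rn_lt_sub_neq0; rewrite rn_circle // ltW.
    apply: cholM; first exact: chol_cst.
    apply: cholM; first exact: chol_cst.
    apply: cholV; last by rewrite mulf_neq0.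
    apply: cholM; first exact: chol_cst.
    by apply: cholB; [exact: chol_cst|exact: chol_id].
  move=> t u t01 uw; have ur : rn u < r by have := rn_ler_sub u w; lra.
  have c3 : {for (u, t), continuous (fun q : C * R => ((z, q.1), q.2))}.
    apply: cfor_pair; last exact: cvg_snd.
    by apply: cfor_pair; [exact: cfor_cst|exact: cvg_fst].
  exact: (cfor_comp c3 (jc z u t zr ur)).
have G00 : G 0 0 = 0 by rewrite -cderG.
have := @hurwitz C G 0 r (r / 2) ltac:(lra) ltac:(lra) _ _ _ G00.
move=> H; have {}H : \forall z \near (0 : C), exists2 w, rn w < r / 2 & G z w = 0.
  apply: H.
  - apply/nbhs_rnP; exists r => // z; rewrite subr0 => zr w wr; exact: hG.
  - by move=> w wr; exact: cG.
  - move=> w /andP[w0 wr]; apply/eqP => Gw.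
    have := GE 0 w rn00 wr; rewrite Gw mul0r addr0 => /ip e.
    by move: w0; rewrite e ?rn0 ?ltxx //; lra.
have /nbhs_rnP[d d0 hd] := H.
pose u := Num.min d r.
have u0 : 0 < u by rewrite lt_min d0.
have ud : u <= d by rewrite ge_min lexx.
have ur : u <= r by rewrite ge_min lexx orbT.
clearbody u.
have c0 z : rn z < u -> cder p z = 0.
  move=> zu; have zr : rn z < r by lra.
  have [|w wr Gw] := hd z; first by rewrite subr0; lra.
  have wr' : rn w < r by lra.
  rewrite cderG //; have := GE z w zr wr'; rewrite Gw mul0r addr0 => /ip e.
  by rewrite -{2}e ?Gw //; lra.
have [M Mp] : exists M : R, forall z, rn z <= r -> rn (p z) <= M.
  have [||z _ zM] := @compact_max R _ (fun z => rn (p z)) _ _ (@compact_C_annulus R 0 0 r).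
  - by exists 0; rewrite /= subrr rn0 lexx ltW.
  - by move=> z /=; rewrite subr0 => zr; apply: cfor_rn; apply: cp; lra.
  by exists (rn (p z)) => w wr; apply: zM; rewrite /= subr0 rn_ge0.
(* From 0 to [h = u / 4] the second-order Cauchy estimate applies with radius [u / 2] at every
   point, and the vanishing derivative leaves quadratic increments. *)
have [h [h0 uh]] : exists h : R, 0 < h /\ u = 4 * h by exists (u / 4); split; lra.
have : p (rc (0 * h)) = p (rc (1 * h)).
  apply: (@subdivision_const C (fun t => p (rc (t * h))) (8 * M / (u / 2) ^+ 2 * h ^+ 2)).
  move=> a b a01 b01.
  have ah : 0 <= a * h <= h by rewrite mulr_ge0 ?ler_piMl //=; lra.
  have bh : 0 <= b * h <= h by rewrite mulr_ge0 ?ler_piMl //=; lra.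
  have rb : rn (rc (b * h)) <= h by rewrite rn_rc ger0_norm; lra.
  have := @cauchy_taylor1 _ p (rc (b * h)) (u / 2) M ltac:(lra) _ _ (rc (a * h)).
  rewrite c0; last by lra.
  rewrite mul0r subr0 -rcB -mulrBl rn_rc => HH.
  apply: le_trans (HH _ _ _) _.
  - move=> z zb; apply: hp; have := rn_ler_sub z (rc (b * h)); lra.
  - move=> z zb; apply: Mp; have := rn_ler_sub z (rc (b * h)); lra.
  - rewrite mulrBl ler_norml; lra.
  rewrite real_normK ?num_real // le_eqVlt; apply/orP; left; apply/eqP.
  by move: (8 * M / (u / 2) ^+ 2) => X; ring.
rewrite mul0r mul1r => /ip; rewrite rc0 rn0 rn_rc ger0_norm; last by lra.
move=> /(_ s0) e.
have : rc h = 0 by rewrite -e //; rewrite /r in ur; lra.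
move=> /eqP; rewrite rc_eq0 => /eqP; lra.
Qed.

End Parametric.

(** * Functions holomorphic along complex lines *)

Section LineHolomorphic.
Variable R : realType.
Local Notation C := (Cplx R).
Variable W : normedModType C.
Implicit Types (p : W -> C) (x y a v w e : W).

(** Gateaux holomorphy together with continuity. It passes to directional derivatives by
    differentiation under the integral, so that [dv] can be iterated. *)
Definition lhol p x := {for x, continuous p} /\
  forall v, chol (fun z : C => p (x + z *: v)) 0.

Definition dv v p x : C := cder (fun z : C => p (x + z *: v)) 0.

Lemma cfor_line x v (z : C) : {for z, continuous (fun z : C => x + z *: v)}.
Proof.
apply: cforDv; first exact: cfor_cst.
by apply: cforZv; [exact: cfor_id|exact: cfor_cst].
Qed.

Lemma is_cder_shift (k : C -> C) (c d : C) :
  is_cder k 0 d -> is_cder (fun z => k (z - c)) c d.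
Proof.
move=> [q [cq <- /nbhs_rnP[r r0 kq]]]; exists (fun z => q (z - c)); split.
- apply: (@cfor_comp _ _ _ (fun z => z - c) q); last by rewrite subrr.
  by apply: cforB; [exact: cfor_id|exact: cfor_cst].
- by rewrite subrr.
- apply/nbhs_rnP; exists r => // z zc; rewrite subrr kq ?subr0 //.
Qed.

Lemma lhol_line p x v (z : C) : lhol p (x + z *: v) ->
  is_cder (fun z : C => p (x + z *: v)) z (dv v p (x + z *: v)).
Proof.
move=> [_ /(_ v) /cderP]; rewrite -/(dv v p (x + z *: v)) => /(is_cder_shift z).
apply: is_cder_near; near=> u.
by rewrite scalerBl -addrA [z *: v + _]addrC subrK.
Unshelve. all: by end_near. Qed.

Lemma lhol_chol p x v (z : C) : lhol p (x + z *: v) ->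
  chol (fun z : C => p (x + z *: v)) z.
Proof. by move=> /lhol_line /is_cder_chol. Qed.

Lemma dvZ p x v (c : C) : lhol p x -> dv (c *: v) p x = c * dv v p x.
Proof.
move=> [_ /(_ v) /cderP[q [cq qE /nbhs_rnP[r r0 pq]]]].
rewrite -/(dv v p x) in qE.
have cc : {for 0, continuous (fun z : C => z * c)}.
  by apply: cforM; [exact: cfor_id|exact: cfor_cst].
apply: cderE; exists (fun z => q (z * c) * c); split.
- apply: cforM; last exact: cfor_cst.
  have cq' : {for 0 * c, continuous q} by rewrite mul0r; exact: cq.
  exact: (@cfor_comp _ _ _ (fun z : C => z * c) q 0 cc cq').
- by rewrite mul0r qE mulrC.
have := iffLR (cfor_rnP _ _) cc r r0; apply: filterS => z; rewrite mul0r => zr.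
by have := pq (z * c) zr; rewrite !scale0r !subr0 scalerA => ->; ring.
Qed.

Lemma lhol_bounded_near p x : {for x, continuous p} -> exists M s : R,
  [/\ 0 < s, 0 <= M & forall y, rn (y - x) < s -> rn (p y) <= M].
Proof.
move=> /continuous_rnP /(_ 1 ltr01)[s s0 hs]; exists (rn (p x) + 1), s; split=> //.
  by rewrite addr_ge0 ?rn_ge0.
by move=> y /hs; have := rn_ler_sub (p y) (p x); lra.
Qed.

Lemma lhol_cst (c : C) x : lhol (fun=> c) x.
Proof. by split=> [|v]; [exact: cfor_cst|exact: chol_cst]. Qed.

Lemma lholD p q x : lhol p x -> lhol q x -> lhol (fun y => p y + q y) x.
Proof.
by move=> [cp hp] [cq hq]; split=> [|v]; [exact: cforD cp cq|exact: cholD (hp v) (hq v)].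
Qed.

Lemma lholM p q x : lhol p x -> lhol q x -> lhol (fun y => p y * q y) x.
Proof.
by move=> [cp hp] [cq hq]; split=> [|v]; [exact: cforM cp cq|exact: cholM (hp v) (hq v)].
Qed.

Lemma lhol_ext p q x : p =1 q -> lhol p x -> lhol q x.
Proof. by move=> /funext ->. Qed.

Lemma lhol_sum (I : Type) (s : seq I) (F : I -> W -> C) x :
  (forall i, lhol (F i) x) -> lhol (fun y => \sum_(i <- s) F i y) x.
Proof.
move=> hF; elim: s => [|i s IH].
  by apply: lhol_ext (lhol_cst 0 x) => y; rewrite big_nil.
by apply: lhol_ext (lholD (hF i) IH) => y; rewrite big_cons.
Qed.

Lemma lhol_prod (I : Type) (s : seq I) (F : I -> W -> C) x :
  (forall i, lhol (F i) x) -> lhol (fun y => \prod_(i <- s) F i y) x.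
Proof.
move=> hF; elim: s => [|i s IH].
  by apply: lhol_ext (lhol_cst 1 x) => y; rewrite big_nil.
by apply: lhol_ext (lholM (hF i) IH) => y; rewrite big_cons.
Qed.

Lemma radius_exists (g t : R) : 0 < g -> 0 <= t -> exists2 r : R, 0 < r & r * t < g.
Proof.
move=> g0 t0; exists (g / (1 + t)); first by rewrite divr_gt0 // ltr_pwDl.
by rewrite mulrAC ltr_pdivrMr ?ltr_pwDl // mulrDr mulr1; lra.
Qed.

Section Ball.
Variables (p : W -> C) (a : W) (s : R).
Hypothesis hp : forall x, rn (x - a) < s -> lhol p x.

Lemma ball_shift x u (r : R) : rn (x - a) + r < s -> rn u <= r -> rn (x + u - a) < s.
Proof. by move=> h ur; rewrite addrAC; apply: le_lt_trans (rnD _ _) _; lra. Qed.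

Lemma dv_circ v x (r : R) : 0 < r -> rn (x - a) + r * rn v < s ->
  dv v p x = circ r (fun z => p (x + z *: v) / z).
Proof.
move=> r0 xr; have [t t0 tv] : exists2 t : R, 0 < t & t * rn v < s - rn (x - a) - r * rn v.
  by apply: radius_exists; [lra|exact: rn_ge0].
rewrite /dv (@disc_cder _ (fun z => p (x + z *: v)) 0 (r + t) _ r); first last.
- by lra.
- by [].
- move=> z; rewrite subr0 => zr; apply: lhol_chol; apply: hp.
  apply: (@ball_shift _ _ ((r + t) * rn v)); first by lra.
  by rewrite rnZ ler_wpM2r ?rn_ge0 // ltW.
by apply: circ_ext; [exact: ltW|move=> z _; rewrite add0r].
Qed.

(** On a small ball [dv v p] is a Cauchy integral of [p] over circles in direction [v]; such an
    integral is continuous by [dint_continuous] and holomorphic along lines by [chol_dint]. *)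
Lemma lhol_dv_center v : 0 < s -> lhol (dv v p) a.
Proof.
move=> s0; have [r r0 rv] : exists2 r : R, 0 < r & r * rn v < s / 2.
  by apply: radius_exists; [lra|exact: rn_ge0].
have E y : rn (y - a) < s / 2 -> dv v p y = circ r (fun z => p (y + z *: v) / z).
  by move=> ya; apply: dv_circ => //; lra.
have jc (T : topologicalType) (u : T -> W) (x : T) (t : R) :
    {for x, continuous u} -> rn (u x - a) < s / 2 ->
    {for (x, t), continuous (fun q : T * R => p (u q.1 + (rc r * cis q.2) *: v) / (rc r * cis q.2))}.
  move=> cu ux.
  have cz : {for (x, t), continuous (fun q : T * R => rc r * cis q.2)}.
    apply: cforM; first exact: cfor_cst.
    by apply: cfor_comp; [exact: cvg_snd|exact: continuous_cis].
  apply: cforM; last first.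
    by apply: (cforV cz); rewrite -rn_gt0 rn_circle // ltW.
  apply: (@cfor_comp _ _ _ (fun q : T * R => u q.1 + (rc r * cis q.2) *: v) p).
    apply: cforDv; first by apply: (@cfor_comp _ _ _ fst u) => //; exact: cvg_fst.
    by apply: (cforZv cz); exact: cfor_cst.
  have [] // := hp (_ : rn (u x + (rc r * cis t) *: v - a) < s).
  apply: (@ball_shift _ _ (r * rn v)); first by lra.
  by rewrite rnZ rn_circle // ltW.
split.
  apply: (@cfor_near _ _ (fun y => circ r (fun z => p (y + z *: v) / z))).
    by apply/nbhs_rnP; exists (s / 2); [lra|move=> y ya; rewrite E].
  have aa : rn (a - a) < s / 2 by rewrite subrr rn0; lra.
  apply: dint_continuous.
    apply/nbhs_rnP; exists (s / 2); first by lra.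
    move=> y ya t t01.
    exact: (@cfor_slice _ _ _ (fun y t => p (y + (rc r * cis t) *: v) / (rc r * cis t)) y t (@jc W id y t (@cfor_id _ _) ya)).
  move=> t _; exact: (@jc W id a t (@cfor_id _ _) aa).
move=> w; have [d d0 dw] : exists2 d : R, 0 < d & d * rn w < s / 4.
  by apply: radius_exists; [lra|exact: rn_ge0].
have near_a (z : C) : rn z < d -> rn (a + z *: w - a) < s / 4.
  by move=> zd; rewrite addrC addKr rnZ; apply: le_lt_trans dw; rewrite ler_wpM2r ?rn_ge0 // ltW.
suff H : chol (fun z : C => circ r (fun b => p (a + z *: w + b *: v) / b)) 0.
  refine (chol_near _ H); apply/nbhs_rnP; exists d => // z; rewrite subr0 => /near_a h.
  by rewrite E //; lra.
apply: (@chol_dint _ _ 0 d d0).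
  move=> t z t01; rewrite subr0 => zd.
  apply: cholM; last exact: chol_cst.
  apply: (@chol_near R (fun z : C => p (a + (rc r * cis t) *: v + z *: w)) (fun z : C => p (a + z *: w + (rc r * cis t) *: v)) z).
    by near=> u; rewrite addrAC.
  apply: lhol_chol; apply: hp; rewrite [a + _ + _]addrAC.
  apply: (@ball_shift _ _ (r * rn v)); first by have := near_a z zd; lra.
  by rewrite rnZ rn_circle // ltW.
move=> t z t01; rewrite subr0 => zd.
have za : rn (a + z *: w - a) < s / 2 by have := near_a z zd; lra.
exact: (@jc C (fun z : C => a + z *: w) z t (@cfor_line a w z) za).
Unshelve. all: by end_near. Qed.

Lemma lhol_lip (M : R) x y : 0 < s -> (forall x, rn (x - a) < s -> rn (p x) <= M) ->
  rn (x - a) < s / 8 -> rn (y - a) < s / 8 ->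
  rn (p y - p x) <= 16 * M / s * rn (y - x).
Proof.
move=> s0 pM xa ya; have [->|yx] := eqVneq y x; first by rewrite !subrr !rn0 mulr0.
have v0 : 0 < rn (y - x) by rewrite rn_gt0 subr_eq0.
have v1 : rn (y - x) < s / 4 by have := rn_sub y a x; rewrite (rnC a x); lra.
(* On the line through [x] and [y], with [y] at parameter 1, the disc of radius [d > 2] stays in the
   ball, and 1 lies in its inner half, where the Cauchy estimates hold. *)
pose d := s / 2 / rn (y - x).
have d0 : 0 < d by rewrite !divr_gt0.
have inb (z : C) : rn z < d -> rn (x + z *: (y - x) - a) < s.
  move=> zd; apply: (@ball_shift _ _ (s / 2)); first by lra.
  rewrite rnZ; rewrite ltr_pdivlMr // in zd; exact: ltW.
have := @cauchy_lip _ (fun z => p (x + z *: (y - x))) 0 d M d0 _ _ 1.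
rewrite scale1r scale0r addr0 subr0 rn1 mulr1 [x + _]addrC subrK => H.
apply: le_trans (H _ _ _) _.
- by move=> z; rewrite subr0 => zd; apply: lhol_chol; apply: hp; exact: inb.
- by move=> z; rewrite subr0 => zd; apply: pM; exact: inb.
- by rewrite /d -mulrA -invfM ler_pdivlMr; lra.
rewrite /d le_eqVlt; apply/orP; left; apply/eqP; field.
by rewrite gt_eqF //= gt_eqF.
Qed.

Lemma lhol_taylor1 (M : R) x y : 0 < s -> (forall x, rn (x - a) < s -> rn (p x) <= M) ->
  rn (x - a) < s / 8 -> rn (y - a) < s / 8 ->
  rn (p y - p x - dv (y - x) p x) <= 32 * M / s ^+ 2 * rn (y - x) ^+ 2.
Proof.
move=> s0 pM xa ya; have [->|yx] := eqVneq y x.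
  rewrite !subrr /dv (_ : (fun z : C => _) = fun=> p x).
    by rewrite cder_cst subrr !rn0 expr0n /= mulr0.
  by apply/funext => z; rewrite scaler0 addr0.
have v0 : 0 < rn (y - x) by rewrite rn_gt0 subr_eq0.
have v1 : rn (y - x) < s / 4 by have := rn_sub y a x; rewrite (rnC a x); lra.
pose d := s / 2 / rn (y - x).
have d0 : 0 < d by rewrite !divr_gt0.
have inb (z : C) : rn z < d -> rn (x + z *: (y - x) - a) < s.
  move=> zd; apply: (@ball_shift _ _ (s / 2)); first by lra.
  rewrite rnZ; rewrite ltr_pdivlMr // in zd; exact: ltW.
have := @cauchy_taylor1 _ (fun z => p (x + z *: (y - x))) 0 d M d0 _ _ 1.
rewrite scale1r scale0r addr0 subr0 rn1 expr1n !mulr1 [x + _]addrC subrK => H.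
apply: le_trans (H _ _ _) _.
- by move=> z; rewrite subr0 => zd; apply: lhol_chol; apply: hp; exact: inb.
- by move=> z; rewrite subr0 => zd; apply: pM; exact: inb.
- by rewrite /d -mulrA -invfM ler_pdivlMr; lra.
rewrite /d le_eqVlt; apply/orP; left; apply/eqP; field.
by rewrite gt_eqF //= gt_eqF.
Qed.

(** The linear Taylor term between two points of the curve vanishes, so increments are quadratic in
    the parameter and [subdivision_const] applies. *)
Lemma const_on_curve (M L : R) (g : R -> W) : 0 < s ->
  (forall x, rn (x - a) < s -> rn (p x) <= M) ->
  (forall t : R, 0 <= t <= 1 -> rn (g t - a) < s / 8) ->
  (forall t u : R, 0 <= t <= 1 -> 0 <= u <= 1 -> rn (g t - g u) <= L * `|t - u|) ->
  (forall t u : R, 0 <= t <= 1 -> 0 <= u <= 1 -> dv (g t - g u) p (g u) = 0) ->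
  p (g 0) = p (g 1).
Proof.
move=> s0 pM gs gL g0.
apply: (@subdivision_const _ C (fun t => p (g t)) (32 * M / s ^+ 2 * L ^+ 2)).
move=> t u t01 u01.
have := lhol_taylor1 s0 pM (gs u u01) (gs t t01); rewrite g0 // subr0 => H.
apply: le_trans H _; set K := 32 * M / s ^+ 2.
rewrite -[K * _ * _]mulrA; apply: ler_wpM2l.
  have M0 : 0 <= M by apply: le_trans (pM a _); rewrite ?rn_ge0 // subrr rn0.
  by rewrite divr_ge0 ?exprn_ge0 ?mulr_ge0 // ltW.
rewrite -[(t - u) ^+ 2]real_normK ?num_real // -exprMn.
rewrite lerXn2r ?nnegrE ?rn_ge0 //; last exact: gL.
by apply: le_trans (gL t u t01 u01); exact: rn_ge0.
Qed.

End Ball.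

Lemma lhol_dv p a s v : (forall x, rn (x - a) < s -> lhol p x) ->
  forall x, rn (x - a) < s -> lhol (dv v p) x.
Proof.
move=> hp x xa; apply: (@lhol_dv_center p x (s - rn (x - a))); last by lra.
by move=> y yx; apply: hp; have := rn_sub y x a; lra.
Qed.

Lemma lhol_iter_dv p a s e j : (forall x, rn (x - a) < s -> lhol p x) ->
  forall x, rn (x - a) < s -> lhol (iter j (dv e) p) x.
Proof. by move=> hp; elim: j => [//|j IH] /=; exact: lhol_dv. Qed.

End LineHolomorphic.

(** * Identity theorem from vanishing derivatives *)

Section TaylorZero.
Variable R : realType.
Local Notation C := (Cplx R).

Lemma div_id (g : C -> C) (s : R) : 0 < s ->
  (forall z, rn z < s -> chol g z) -> g 0 = 0 ->
  exists q : C -> C, (forall z, rn z < s -> chol q z) /\ forall z, g z = z * q z.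
Proof.
move=> s0 hg g0; have h0 : chol g 0 by apply: hg; rewrite rn0.
have [q0 [cq0 _ gq0]] := cderP h0.
pose q z := if z == 0 then q0 0 else g z / z.
have qE z : z != 0 -> q z = g z / z by rewrite /q => /negbTE ->.
have hq z : rn z < s -> z != 0 -> chol q z.
  move=> zs z0; apply: (@chol_near _ (fun z => g z / z)).
    apply: filterS (@continuous_near_neq0 _ id z (@cfor_id _ z) z0).
    by move=> y y0; rewrite qE.
  by apply: cholM; [exact: hg|exact: cholV (chol_id _) z0].
exists q; split; last first.
  move=> z; have [->|z0] := eqVneq z 0; first by rewrite g0 mul0r.
  by rewrite qE // mulrC divfK.
move=> z zs; have [->|z0] := eqVneq z 0; last exact: hq.
apply: (@removable _ q 0 s (s / 2)); [lra|lra| |by move=> w; rewrite subr0; exact: hq].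
move=> w; rewrite subr0 => ws; have [->|w0] := eqVneq w 0; last first.
  by apply: chol_continuous; exact: hq.
apply: cfor_near cq0; apply: filterS gq0 => y yE; rewrite /q.
by case: eqVneq => [->//|y0]; rewrite yE g0 add0r subr0 mulfK.
Qed.

Lemma chol_cder (g : C -> C) (s : R) :
  (forall z, rn z < s -> chol g z) -> forall z, rn z < s -> chol (cder g) z.
Proof.
move=> hg z zs.
have hl (x : C) : rn (x - 0) < s -> lhol g x.
  rewrite subr0 => xs; split=> [|v]; first by apply: chol_continuous; exact: hg.
  apply: (@chol_comp _ g (fun z => x + z *: v)); last by rewrite scale0r addr0; exact: hg.
  apply: cholD; first exact: chol_cst.
  by apply: (@chol_near _ (fun z => z * v)); [near=> u|apply: cholM; [exact: chol_id|exact: chol_cst]].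
have E (u : C) : (0 : C) + u *: (1 : C) = u by rewrite add0r -[RHS]mulr1.
have := @lhol_dv R C g 0 s 1 hl (0 + z *: (1 : C)).
rewrite {1}E subr0 => /(_ zs) /lhol_chol; apply: chol_near; apply/nbhs_rnP.
exists (s - rn z); first by lra.
move=> u uz; have us : rn u < s by have := rn_ler_sub u z; lra.
have K : lhol g ((0 : C) + u *: (1 : C)) by rewrite E; apply: hl; rewrite subr0.
rewrite -(cderE (lhol_line K)); transitivity (cder g u); last by [].
by apply: cder_near; near=> y; rewrite E.
Unshelve. all: by end_near. Qed.

Lemma chol_iter_cder (g : C -> C) (s : R) j :
  (forall z, rn z < s -> chol g z) -> forall z, rn z < s -> chol (iter j (@cder R) g) z.
Proof. by move=> hg; elim: j => [//|j IH] /=; exact: chol_cder. Qed.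

(** Leibniz's rule for a factor [z]; at [z = 0] it shows that the derivatives of [q] vanish together
    with those of [g]. *)
Lemma iter_cder_mulX (g q : C -> C) (s : R) :
  (forall z, rn z < s -> chol q z) -> (forall z, g z = z * q z) ->
  forall j z, rn z < s -> iter j.+1 (@cder R) g z =
    z * iter j.+1 (@cder R) q z + j.+1%:R * iter j (@cder R) q z.
Proof.
move=> hq gq; elim=> [|j IH] z zs.
  rewrite /= (_ : g = fun z => z * q z); last exact/funext.
  by rewrite (cderM (@chol_id _ z) (hq _ zs)) cder_id mul1r addrC.
rewrite [LHS]/=.
have -> : cder (cder (iter j (@cder R) g)) z =
  cder (fun z => z * iter j.+1 (@cder R) q z + j.+1%:R * iter j (@cder R) q z) z.
  apply: cder_near; apply/nbhs_rnP; exists (s - rn z); first by lra.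
  by move=> u uz; rewrite -IH //; have := rn_ler_sub u z; lra.
have h1 := chol_iter_cder j.+1 hq zs; have h2 := chol_iter_cder j hq zs.
rewrite (cderD (cholM (@chol_id _ z) h1) (cholM (@chol_cst _ j.+1%:R z) h2)).
rewrite (cderM (@chol_id _ z) h1) (cderM (@chol_cst _ j.+1%:R z) h2) cder_id cder_cst.
by rewrite !iterS [j.+2%:R]mulrSr; ring.
Qed.

Lemma div_idX (g : C -> C) (s : R) j : 0 < s ->
  (forall z, rn z < s -> chol g z) -> (forall i, iter i (@cder R) g 0 = 0) ->
  exists q : C -> C, (forall z, rn z < s -> chol q z) /\ forall z, g z = z ^+ j * q z.
Proof.
move=> s0; elim: j g => [|j IH] g hg g0.
  by exists g; split=> // z; rewrite expr0 mul1r.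
have [q1 [hq1 gq1]] := div_id s0 hg (g0 0%N).
have [|q [hq qE]] := IH q1 hq1.
  move=> i; have s00 : rn (0 : C) < s by rewrite rn0.
  have := iter_cder_mulX hq1 gq1 i s00; rewrite g0 mul0r add0r => /esym/eqP.
  by rewrite mulf_eq0 pnatr_eq0 /= => /eqP.
by exists q; split=> // z; rewrite gq1 qE exprS mulrA.
Qed.

(** For each [n] the function is [z ^+ n * q]; the maximum principle for [q] gives the bound
    [M * (rn z / r) ^+ n], which tends to 0. *)
Lemma taylor_zero (g : C -> C) (s : R) : 0 < s ->
  (forall z, rn z < s -> chol g z) -> (forall i, iter i (@cder R) g 0 = 0) ->
  forall z, rn z < s -> g z = 0.
Proof.
move=> s0 hg g0 z zs.
pose r := (s + rn z) / 2; have z0 := rn_ge0 z.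
have r0 : 0 < r by rewrite /r; lra.
have rs : r < s by rewrite /r; lra.
have zr : rn z < r by rewrite /r; lra.
have [M hM] : exists M : R, forall w, rn (w - 0) = r -> rn (g w) <= M.
  apply: (@circle_bounded _ g 0 s r r0 rs) => w; rewrite subr0 => ws.
  by apply: chol_continuous; exact: hg.
apply/eqP; rewrite -rn_eq0; apply/eqP.
apply: (@eq0_of_exprn _ _ M (rn z / r)); [exact: rn_ge0|by rewrite divr_ge0 // ltW| |].
  by rewrite ltr_pdivrMr // mul1r.
move=> n; have [q [hq gq]] := div_idX n s0 hg g0.
rewrite gq rnM rnX expr_div_n mulrA [M * _]mulrC -mulrA.
rewrite ler_wpM2l ?exprn_ge0 ?rn_ge0 //.
apply: (@max_principle _ q 0 s _ r); rewrite ?subr0 //; last exact: ltW.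
  by move=> w; rewrite subr0; exact: hq.
move=> w wr; have := hM w wr; rewrite gq rnM rnX.
rewrite subr0 in wr; rewrite wr ler_pdivlMr ?exprn_gt0 // mulrC //.
Qed.

(** Restriction to the line turns iterated directional derivatives into iterated derivatives in one
    variable. *)
Lemma dv_taylor_zero (W : normedModType C) (p : W -> C) (a e : W) (s : R) : 0 < s ->
  (forall x, rn (x - a) < s -> lhol p x) ->
  (forall j, iter j (dv e) p a = 0) ->
  forall z : C, rn z * rn e < s -> p (a + z *: e) = 0.
Proof.
move=> s0 hp h0 z zs.
have [e0|e0] := eqVneq (rn e) 0.
  have := h0 0%N => /=; move/eqP: e0; rewrite rn_eq0 => /eqP ->.
  by rewrite scaler0 addr0.
have {}e0 : 0 < rn e by rewrite lt0r e0 rn_ge0.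
pose s1 := s / rn e; have s10 : 0 < s1 by rewrite divr_gt0.
have inb (u : C) : rn u < s1 -> rn (a + u *: e - a) < s.
  by rewrite addrC addKr rnZ ltr_pdivlMr.
pose g (u : C) := p (a + u *: e).
have E j : forall u : C, rn u < s1 -> iter j (@cder R) g u = iter j (dv e) p (a + u *: e).
  elim: j => [//|j IH] u us /=.
  transitivity (cder (fun u : C => iter j (dv e) p (a + u *: e)) u).
    apply: cder_near; apply/nbhs_rnP; exists (s1 - rn u); first by lra.
    by move=> w wu; apply: IH; have := rn_ler_sub w u; lra.
  apply: cderE; apply: lhol_line; apply: (lhol_iter_dv _ _ hp); exact: inb.
apply: (@taylor_zero g s1 s10).
- by move=> u us; apply: lhol_chol; apply: hp; exact: inb.
- by move=> i; rewrite E ?rn0 // scale0r addr0.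
- by rewrite /s1 ltr_pdivlMr.
Qed.

End TaylorZero.

(** * The inverse mapping theorem *)

Section Frechet.
Variable R : realType.
Local Notation C := (Cplx R).
Variable n : nat.
Local Notation V := 'rV[C]_n.
Implicit Types (f : V -> V) (A B : 'M[C]_n).

(** Frechet differentiability with a matrix that acts on row vectors from the right, so that
    composition gives [A *m B] and kernels are left kernels. *)
Definition fder f (x : V) A := forall e : R, 0 < e -> exists2 d : R, 0 < d &
  forall h, rn h < d -> rn (f (x + h) - f x - h *m A) <= e * rn h.

Lemma mulmx_bound B : exists2 c : R, 0 < c & forall v : V, rn (v *m B) <= c * rn v.
Proof.
pose c := \sum_i \sum_j rn (B i j).
have c0 : 0 <= c by rewrite sumr_ge0 // => i _; rewrite sumr_ge0 // => j _; exact: rn_ge0.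
exists (1 + c); first by lra.
move=> v; apply: rn_rV_le => [|j].
  by rewrite mulr_ge0 ?rn_ge0 //; lra.
rewrite mxE; apply: le_trans (rn_sum _ _ _) _.
apply: (@le_trans _ _ (c * rn v)); last by rewrite ler_wpM2r ?rn_ge0 //; lra.
rewrite /c mulr_suml; apply: ler_sum => i _; rewrite rnM mulrC.
apply: ler_pM; rewrite ?rn_ge0 //; last exact: rn_coord.
by rewrite (bigD1 j) //= lerDl sumr_ge0 // => k _; exact: rn_ge0.
Qed.

Lemma fder_continuous f x A : fder f x A -> {for x, continuous f}.
Proof.
move=> fA; apply/cfor_rnP => e e0.
have [c c0 cA] := mulmx_bound A; have [d d0 hd] := fA 1 ltr01.
pose r := Num.min d (e / (2 * (1 + c))).
have c2 : 0 < 2 * (1 + c) by lra.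
have r0 : 0 < r by rewrite lt_min d0 divr_gt0.
have r1 : r <= d by rewrite ge_min lexx.
have r2 : r <= e / (2 * (1 + c)) by rewrite ge_min lexx orbT.
clearbody r; apply/nbhs_rnP; exists r => // y yr.
have := hd (y - x) ltac:(lra); rewrite [x + _]addrC subrK mul1r => H.
have := cA (y - x); have := rnD (f y - f x - (y - x) *m A) ((y - x) *m A).
rewrite subrK; rewrite ler_pdivlMr // in r2.
have t0 := rn_ge0 (y - x).
have : (1 + c) * rn (y - x) <= (1 + c) * r by rewrite ler_wpM2l //; [clear -c0|clear -yr]; lra.
move: H; move: (rn (y - x)) (rn (f y - f x)) (rn (f y - f x - (y - x) *m A))
  (rn ((y - x) *m A)) => p q s u H; clear -H r2 e0; lra.
Qed.

Lemma fder_line f x A v j : fder f x A ->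
  is_cder (fun z : C => f (x + z *: v) ord0 j) 0 ((v *m A) ord0 j).
Proof.
move=> fA; apply/is_cderP => e e0.
have [d d0 hd] := fA (e / (1 + rn v)) ltac:(by rewrite divr_gt0 // ltr_pwDl ?rn_ge0).
have [r r0 rv] := radius_exists d0 (rn_ge0 v).
exists r => // z; rewrite subr0 scale0r addr0 => zr.
have zd : rn (z *: v) < d.
  by rewrite rnZ; apply: le_lt_trans rv; rewrite ler_wpM2r ?rn_ge0 // ltW.
have := hd _ zd; rewrite -scalemxAl => H.
have := rn_coord (f (x + z *: v) - f x - z *: (v *m A)) j; rewrite !mxE mulrC => K.
apply: le_trans K (le_trans H _); rewrite rnZ mulrAC ler_pdivrMr ?ltr_pwDl ?rn_ge0 //.
rewrite -mulrA ler_wpM2l ?(ltW e0) // ler_wpM2l ?rn_ge0 //.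
by rewrite lerDr ler01.
Qed.

Lemma fder_lhol f x A j : fder f x A -> lhol (fun y => f y ord0 j) x.
Proof.
move=> fA; split=> [|v]; last exact: is_cder_chol (fder_line v j fA).
apply: (@cfor_comp _ _ _ f (fun y : V => y ord0 j)); first exact: fder_continuous fA.
exact: continuous_coord.
Qed.

Lemma fder_dv f x A v j : fder f x A ->
  dv v (fun y => f y ord0 j) x = (v *m A) ord0 j.
Proof. by move=> fA; exact: cderE (fder_line v j fA). Qed.

Lemma fder_mx B x : fder (mulmxr B) x B.
Proof.
move=> e e0; exists 1 => // h _.
by rewrite /= mulmxDl [x *m B + _]addrC addrK subrr rn0 mulr_ge0 ?rn_ge0 // ltW.
Qed.

Lemma fderD f g x A B : fder f x A -> fder g x B -> fder (fun y => f y + g y) x (A + B).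
Proof.
move=> fA gB e e0; have e2 : 0 < e / 2 by lra.
have [d d0 hd] := fA _ e2; have [d' d'0 hd'] := gB _ e2.
exists (Num.min d d'); first by rewrite lt_min d0.
move=> h; rewrite lt_min => /andP[h1 h2]; rewrite mulmxDr.
have -> : f (x + h) + g (x + h) - (f x + g x) - (h *m A + h *m B) =
   (f (x + h) - f x - h *m A) + (g (x + h) - g x - h *m B).
  by apply/rowP => j; rewrite !mxE; ring.
apply: le_trans (rnD _ _) _; have := hd h h1; have := hd' h h2; lra.
Qed.

Lemma fder_comp f g x A B : fder f x A -> fder g (f x) B ->
  fder (fun y => g (f y)) x (A *m B).
Proof.
move=> fA gB e e0.
have [a a0 hA] := mulmx_bound A; have [b b0 hB] := mulmx_bound B.
have e1 : 0 < Num.min 1 (e / (2 * b)) by rewrite lt_min ltr01 divr_gt0 // mulr_gt0.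
have e2 : 0 < e / (2 * (1 + a)) by rewrite divr_gt0 // mulr_gt0 //; lra.
have [d d0 hd] := fA _ e1; have [d' d'0 hd'] := gB _ e2.
have [r r0 rd'] := @radius_exists R d' (1 + a) d'0 ltac:(lra).
exists (Num.min d r); first by rewrite lt_min d0.
move=> h; rewrite lt_min => /andP[h1 h2].
pose k := f (x + h) - f x.
have t0 := rn_ge0 h.
have H1 : rn (k - h *m A) <= Num.min 1 (e / (2 * b)) * rn h by exact: hd.
have H2 : rn (k - h *m A) <= rn h.
  by apply: le_trans H1 _; rewrite ler_piMl // ge_min lexx.
have {}H1 : rn (k - h *m A) <= e / (2 * b) * rn h.
  by apply: le_trans H1 _; rewrite ler_wpM2r // ge_min lexx orbT.
have kh : rn k <= (1 + a) * rn h.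
  by have := rnD (k - h *m A) (h *m A); rewrite subrK; have := hA h; lra.
have kd : rn k < d'.
  apply: le_lt_trans kh _; apply: le_lt_trans rd'.
  by rewrite mulrC ler_wpM2r //; lra.
have := hd' k kd; rewrite /k [f x + _]addrC subrK -/k => H3.
have -> : g (f (x + h)) - g (f x) - h *m (A *m B) =
   (g (f (x + h)) - g (f x) - k *m B) + (k - h *m A) *m B.
  rewrite [(k - _) *m B]mulmxBl mulmxA; move: (k *m B) (h *m A *m B) => X Y.
  by apply/rowP => j; rewrite !mxE; ring.
apply: le_trans (rnD _ _) _.
have H4 := hB (k - h *m A).
have H5 : b * rn (k - h *m A) <= e / 2 * rn h.
  have -> : e / 2 * rn h = b * (e / (2 * b) * rn h) by field; rewrite gt_eqF.
  by rewrite ler_pM2l.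
have H6 : e / (2 * (1 + a)) * rn k <= e / 2 * rn h.
  have -> : e / 2 * rn h = e / (2 * (1 + a)) * ((1 + a) * rn h).
    by field; rewrite gt_eqF //; clear -a0; lra.
  by rewrite ler_pM2l.
move: H3 H4 H5 H6; move: (rn (k - h *m A)) (rn k) (rn h) => p q s; clear; lra.
Qed.

Lemma nonunit_kernel A : A \notin unitmx -> exists2 v : V, v != 0 & v *m A = 0.
Proof.
rewrite -row_free_unit -kermx_eq0 => K0.
exists (nz_row (kermx A)); first by rewrite nz_row_eq0.
by apply/sub_kermxP; exact: nz_row_sub.
Qed.

Lemma compact_rV_ball (a : V) (r : R) : compact [set x : V | rn (x - a) <= r].
Proof.
apply: (@compact_rV_bounded _ _ _ (rn a + r)).
  have := closed_preimage (@continuous_rn_sub _ _ a) (@closed_le R r).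
  by [].
by move=> x /= xr; have := rn_ler_sub x a; lra.
Qed.

Lemma convex_split (p q v : V) (t : C) :
  p - v = (p - q - t *: (v - q)) - (1 - t) *: (v - q).
Proof. by apply/rowP => j; rewrite !mxE; ring. Qed.

Lemma sub_split (p q x y k : V) : (p - x - k) - (q - y - k) = p - q - (x - y).
Proof. by apply/rowP => j; rewrite !mxE; ring. Qed.

(** Take a point where [rn (f x - v)] is minimal; the boundary condition makes it interior. If the
    minimum were positive, a small step along the preimage of [v - f x] under [J x] would lower it.
    The triangle inequality suffices for this, so the sup norm is admissible. *)
Lemma rn_min_root f (J : V -> 'M[C]_n) (a v : V) (r : R) : 0 < r ->
  (forall x, rn (x - a) <= r -> fder f x (J x) /\ J x \in unitmx) ->
  (forall x, rn (x - a) = r -> rn (f a - v) < rn (f x - v)) ->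
  exists2 x, rn (x - a) < r & f x = v.
Proof.
move=> r0 fJ fS.
have cf x : rn (x - a) <= r -> {for x, continuous f}.
  by move=> /fJ[fx _]; exact: fder_continuous fx.
have aa : rn (a - a) <= r by rewrite subrr rn0 ltW.
have [||x xr xm] := @compact_min R _ (fun x => rn (f x - v)) _ _ (@compact_rV_ball a r).
- by exists a.
- move=> x /= xr; apply: (@cfor_comp _ _ _ f (fun y => rn (y - v))); first exact: cf.
  exact: continuous_rn_sub.
have xr' : rn (x - a) < r.
  rewrite lt_neqAle xr andbT; apply/eqP => /fS; have := xm a aa.
  by rewrite leNgt => /negP.
exists x => //; apply/eqP; rewrite -subr_eq0 -rn_eq0 eq_le rn_ge0 andbT leNgt.
apply/negP => w0; have [fx Jx] := fJ x xr.
pose w := v - f x; pose u := w *m invmx (J x).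
have w0' : 0 < rn w by rewrite /w rnC.
have uJ : u *m J x = w by rewrite /u mulmxKV.
have [e e0 eu] := radius_exists w0' (rn_ge0 u).
have [d d0 hd] := fx e e0.
have [t t0 tu] := @radius_exists R (Num.min d (r - rn (x - a))) (rn u)
  ltac:(by rewrite lt_min d0 subr_gt0) (rn_ge0 u).
pose t1 := Num.min t (1 / 2).
have t10 : 0 < t1 by rewrite lt_min t0 divr_gt0.
have t11 : t1 <= t by rewrite ge_min lexx.
have t12 : t1 <= 1 / 2 by rewrite ge_min lexx orbT.
clearbody t1.
have ru0 := rn_ge0 u.
have rtu : rn (rc t1 *: u) = t1 * rn u by rewrite rnZ rn_rc ger0_norm // ltW.
have : t1 * rn u < Num.min d (r - rn (x - a)).
  by apply: le_lt_trans tu; rewrite ler_wpM2r.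
rewrite lt_min => /andP[td tr].
have := hd (rc t1 *: u); rewrite rtu => /(_ td).
rewrite -scalemxAl uJ => H.
have /xm : rn (x + rc t1 *: u - a) <= r.
  by rewrite addrAC; apply: le_trans (rnD _ _) _; rewrite rtu; clear -tr; lra.
apply/negP; rewrite -ltNge (rnC (f x)) -/w.
have -> : f (x + rc t1 *: u) - v =
   (f (x + rc t1 *: u) - f x - rc t1 *: w) - (rc (1 - t1)) *: w.
  by rewrite rcB rc1; exact: convex_split.
move: H; set q := f _ - f x - _; clearbody q => H.
apply: le_lt_trans (rnB _ _) _; rewrite rnZ rn_rc ger0_norm; last by clear -t12; lra.
have : t1 * (e * rn u) < t1 * rn w by rewrite ltr_pM2l.
move: (rn w) (rn u) (rn q) H => W U Q; clear; lra.
Qed.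

(** The remainder of the affine approximation is holomorphic and small on a ball, and Cauchy's
    estimate makes it Lipschitz with a small constant on a smaller ball. *)
Lemma strict_estimate f (J : V -> 'M[C]_n) (a : V) (s : R) : 0 < s ->
  (forall x, rn (x - a) < s -> fder f x (J x)) ->
  forall e : R, 0 < e -> exists r : R, [/\ 0 < r, r <= s &
    forall x y, rn (x - a) < r -> rn (y - a) < r ->
      rn (f y - f x - (y - x) *m J a) <= e * rn (y - x)].
Proof.
move=> s0 fJ e e0; have aa : rn (a - a) < s by rewrite subrr rn0.
(* The 16 is the constant of [lhol_lip], applied with the bound [e / 16 * d1] on a ball of radius
   [d1]. *)
have e1 : 0 < e / 16 by lra.
have [d d0 hd] := fJ a aa _ e1.
pose d1 := Num.min d s.
have d10 : 0 < d1 by rewrite lt_min d0.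
have d1d : d1 <= d by rewrite ge_min lexx.
have d1s : d1 <= s by rewrite ge_min lexx orbT.
clearbody d1; exists (d1 / 8); split; [lra|lra|move=> x y xa ya].
pose G z := f z + z *m (- J a) - (f a - a *m J a).
have Gs z : rn (z - a) < d1 -> rn (G z) <= e / 16 * d1.
  move=> za; have := hd (z - a) ltac:(lra); rewrite [a + _]addrC subrK => H.
  have -> : G z = f z - f a - (z - a) *m J a.
    by rewrite /G mulmxN mulmxBl; apply/rowP => j; rewrite !mxE; ring.
  apply: le_trans H _; rewrite ler_pM2l //; exact: ltW.
apply: rn_rV_le; first by rewrite mulr_ge0 ?rn_ge0 // ltW.
move=> j.
have hG z : rn (z - a) < d1 -> lhol (fun z => G z ord0 j) z.
  move=> za.
  have fz : fder (fun z => f z + z *m (- J a)) z (J z - J a).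
    by apply: fderD; [apply: fJ; lra|exact: fder_mx].
  have := lholD (fder_lhol j fz) (lhol_cst (- ((f a - a *m J a) ord0 j)) z).
  by apply: lhol_ext => q; rewrite /G !mxE.
have := @lhol_lip _ _ _ a d1 hG (e / 16 * d1) x y d10 _ xa ya.
have -> : G y ord0 j - G x ord0 j = (f y - f x - (y - x) *m J a) ord0 j.
  have <- : G y - G x = f y - f x - (y - x) *m J a; last by rewrite !mxE.
  by rewrite /G mulmxBl !mulmxN; exact: sub_split.
move=> H; apply: le_trans (H _) _.
  by move=> z za; apply: le_trans (rn_coord _ _) (Gs z za).
rewrite le_eqVlt; apply/orP; left; apply/eqP; field; rewrite ?gt_eqF //.
Qed.

(** The strict estimate with constant [1 / (2 c)], where [c] bounds the inverse of [J a], gives a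
    lower Lipschitz bound for [f]. From it come injectivity, invertibility of [J] nearby,
    surjectivity through [rn_min_root], and differentiability of the inverse. *)
Lemma local_inverse f (J : V -> 'M[C]_n) (a : V) (s : R) : 0 < s ->
  (forall x, rn (x - a) < s -> fder f x (J x)) -> J a \in unitmx ->
  exists r rho : R, exists g : V -> V, [/\ 0 < r, r <= s, 0 < rho,
    forall v, rn (v - f a) < rho -> [/\ rn (g v - a) < r, f (g v) = v,
      J (g v) \in unitmx & fder g v (invmx (J (g v)))] &
    forall x y, rn (x - a) < r -> rn (y - a) < r -> f x = f y -> x = y].
Proof.
move=> s0 fJ Ja.
have [c c0 hc] := mulmx_bound (invmx (J a)).
have c2 : 0 < (2 * c)^-1 by rewrite invr_gt0 mulr_gt0.
have [r [r0 rs est]] := strict_estimate s0 fJ c2.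
have lower x y : rn (x - a) < r -> rn (y - a) < r -> rn (y - x) <= 2 * c * rn (f y - f x).
  move=> xr yr; have := est x y xr yr => H.
  have := hc ((y - x) *m J a); rewrite mulmxK // => K.
  have := rnD (f y - f x) (- (f y - f x - (y - x) *m J a)).
  rewrite rnN opprB addrC subrK => L.
  have : c * rn ((y - x) *m J a) <= c * (rn (f y - f x) + (2 * c)^-1 * rn (y - x)).
    by rewrite ler_pM2l //; apply: le_trans L _; rewrite lerD2l.
  have -> : c * (rn (f y - f x) + (2 * c)^-1 * rn (y - x)) = c * rn (f y - f x) + rn (y - x) / 2.
    by field; rewrite gt_eqF.
  move=> K3; move: (le_trans K K3); clear; move: (rn (y - x)) (rn (f y - f x)) => p q; lra.
have inj x y : rn (x - a) < r -> rn (y - a) < r -> f x = f y -> x = y.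
  move=> xr yr fxy; have := lower x y xr yr; rewrite fxy subrr rn0 mulr0 => h.
  by apply/esym/eqP; rewrite -subr_eq0 -rn_eq0 eq_le h rn_ge0.
(* Along a kernel vector of [J x] the map [f] would move too slowly for the lower bound. *)
have unit x : rn (x - a) < r -> J x \in unitmx.
  move=> xr; have [//|/nonunit_kernel[v v0 vJ]] := boolP (J x \in unitmx); exfalso.
  have e4 : 0 < (4 * c)^-1 by rewrite invr_gt0 mulr_gt0.
  have [d d0 hd] := fJ x ltac:(lra) _ e4.
  have [t t0 tv] := @radius_exists R (Num.min d (r - rn (x - a))) (rn v)
    ltac:(by rewrite lt_min d0 subr_gt0) (rn_ge0 v).
  have rtv : rn (rc t *: v) = t * rn v by rewrite rnZ rn_rc ger0_norm // ltW.
  move: tv; rewrite lt_min => /andP[td tr].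
  have := hd (rc t *: v); rewrite rtv => /(_ td).
  rewrite -scalemxAl vJ scaler0 subr0 => H.
  have := lower x (x + rc t *: v) xr.
  rewrite [x + _ - x]addrC addKr rtv => L.
  have {}L := L ltac:(by rewrite addrAC; apply: le_lt_trans (rnD _ _) _; rewrite rtv -ltrBrDl).
  have p0 : 0 < t * rn v by rewrite mulr_gt0 // rn_gt0.
  have : 2 * c * rn (f (x + rc t *: v) - f x) <= 2 * c * ((4 * c)^-1 * (t * rn v)).
    by rewrite ler_pM2l // mulr_gt0.
  have -> : 2 * c * ((4 * c)^-1 * (t * rn v)) = t * rn v / 2 by field; rewrite gt_eqF.
  lra.
(* On the sphere of radius [r / 2] the lower bound reads [rn (f x - f a) >= 4 * rho], so for
   [rn (v - f a) < rho] the value of [rn (f x - v)] there exceeds that at [a]. *)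
pose rho := r / (16 * c).
have rho0 : 0 < rho by rewrite divr_gt0 // mulr_gt0.
have aa : rn (a - a) < r by rewrite subrr rn0.
have surj v : rn (v - f a) < rho -> exists x, rn (x - a) < r /\ f x = v.
  move=> vr; have [|x xr|x xr fx] := @rn_min_root f J a v (r / 2) ltac:(lra).
  - by move=> x xr; split; [apply: fJ; lra|apply: unit; lra].
  - have := lower a x aa ltac:(lra); rewrite xr => L.
    have : rho * (8 * c) = r / 2 by rewrite /rho; field; rewrite ?gt_eqF //.
    have := rn_sub (f x) v (f a); rewrite (rnC (f a) v).
    have : 4 * rho <= rn (f x - f a).
      rewrite -(ler_pM2l (_ : 0 < 2 * c)) ?mulr_gt0 //; apply: le_trans L.
      by rewrite /rho le_eqVlt; apply/orP; left; apply/eqP; field; rewrite ?gt_eqF //.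
    move: vr; move: (rn (f x - f a)) (rn (f x - v)) (rn (v - f a)) => p q s1; lra.
  by exists x; split=> //; lra.
have [g hg] : exists g : V -> V, forall v, rn (v - f a) < rho -> rn (g v - a) < r /\ f (g v) = v.
  have /choice[g hg] : forall v, exists x, rn (v - f a) < rho -> rn (x - a) < r /\ f x = v.
    move=> v; have [/surj[x hx]|nv] := pselect (rn (v - f a) < rho); first by exists x.
    by exists 0 => /nv.
  by exists g.
exists r, rho, g; split=> // v vr; have [gr fg] := hg v vr.
split=> //; first exact: unit.
move=> e e0; set x := g v in gr fg *.
have [c' c'0 hc'] := mulmx_bound (invmx (J x)).
have e1 : 0 < e / (2 * c * c') by rewrite divr_gt0 // !mulr_gt0.
have [d d0 hd] := fJ x ltac:(lra) _ e1.
pose d1 := Num.min (d / (2 * c)) (rho - rn (v - f a)).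
exists d1; first by rewrite lt_min divr_gt0 ?mulr_gt0 //= subr_gt0.
move=> h; rewrite lt_min => /andP[h1 h2].
have vh : rn (v + h - f a) < rho by rewrite addrAC; apply: le_lt_trans (rnD _ _) _; lra.
have [yr fy] := hg _ vh; set y := g (v + h) in yr fy *.
have Ly := lower x y gr yr; rewrite fy fg [v + h - v]addrC addKr in Ly.
have yd : rn (y - x) < d.
  by apply: le_lt_trans Ly _; rewrite mulrC -ltr_pdivlMr // mulr_gt0.
have := hd (y - x) yd; rewrite [x + _]addrC subrK fy fg [v + h - v]addrC addKr => H.
have -> : y - x - h *m invmx (J x) = (- (h - (y - x) *m J x)) *m invmx (J x).
  by rewrite opprB mulmxBl mulmxK ?unit.
apply: le_trans (hc' _) _; rewrite rnN.
have : c' * rn (h - (y - x) *m J x) <= c' * (e / (2 * c * c') * (2 * c * rn h)).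
  rewrite ler_pM2l //; apply: le_trans H _; rewrite ler_pM2l //.
have -> : c' * (e / (2 * c * c') * (2 * c * rn h)) = e * rn h.
  by field; rewrite !gt_eqF.
by [].
Qed.

End Frechet.

(** * Osgood's theorem *)

Section Osgood.
Variable R : realType.
Local Notation C := (Cplx R).
Variable n : nat.
Local Notation V := 'rV[C]_n.
Implicit Types (f : V -> V) (J : V -> 'M[C]_n) (a b e : V).

Lemma rowP_eq0 (v : V) : (forall j, v ord0 j = 0) -> v = 0.
Proof. by move=> v0; apply/rowP => j; rewrite v0 mxE. Qed.

Lemma subDl (b x y : V) : (b + x) - (b + y) = x - y.
Proof. by apply/rowP => j; rewrite !mxE; ring. Qed.

Lemma rank1_scalar (B : 'M[C]_n) (w1 w : V) : (\rank (kermx B) <= 1)%N ->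
  w1 != 0 -> w1 *m B = 0 -> w *m B = 0 -> exists c, w = c *: w1.
Proof.
move=> rB w10 /sub_kermxP w1B /sub_kermxP wB.
have r1 : \rank w1 = 1%N by rewrite rank_rV w10.
have := mxrank_leqif_sup w1B; rewrite r1 => -[_ /esym].
have -> : (1 == \rank (kermx B))%N.
  by rewrite eqn_leq rB andbT -r1 mxrankS.
move=> Kw; have /sub_rVP[c ->] := submx_trans wB Kw; by exists c.
Qed.

(* The scalar case: along a line on which [f] moves in a single complex
   direction, injectivity forbids a zero of the derivative. *)
Lemma no_critical_line f J b (rho : R) e (B : 'M[C]_n) : 0 < rho -> e != 0 ->
  (forall x, rn (x - b) < rho -> fder f x (J x)) ->
  (forall x y, rn (x - b) < rho -> rn (y - b) < rho -> f x = f y -> x = y) ->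
  (forall x y, rn (x - b) < rho -> rn (y - b) < rho ->
     (exists z : C, x - y = z *: e) -> (f x - f y) *m B = 0) ->
  (\rank (kermx B) <= 1)%N -> e *m J b = 0 -> False.
Proof.
move=> rho0 e0 fJ inj fB rB eJ.
have ne0 : 0 < rn e by rewrite rn_gt0.
pose s := rho / rn e; have s0 : 0 < s by rewrite divr_gt0.
have inb (z : C) : rn z < s -> rn (b + z *: e - b) < rho.
  by rewrite addrC addKr rnZ ltr_pdivlMr.
have b0 : rn (b - b) < rho by rewrite subrr rn0.
have linj (z w : C) : rn z < s -> rn w < s -> f (b + z *: e) = f (b + w *: e) -> z = w.
  move=> zs ws /(inj _ _ (inb z zs) (inb w ws)) /addrI /eqP.
  by rewrite -subr_eq0 -scalerBl scaler_eq0 (negbTE e0) orbF subr_eq0 => /eqP.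
have [z1 z1s z10] : exists2 z1 : C, rn z1 < s & z1 != 0.
  exists (rc (s / 2)); first by rewrite rn_rc gtr0_norm; lra.
  by rewrite rc_eq0 gt_eqF //; lra.
pose w1 := f (b + z1 *: e) - f b.
have w10 : w1 != 0.
  apply: contraNneq z10 => /eqP; rewrite subr_eq0 => /eqP ef.
  apply/eqP; apply: linj; rewrite ?rn0 //.
  by rewrite scale0r addr0.
have kB (z w : C) : rn z < s -> rn w < s -> (f (b + z *: e) - f (b + w *: e)) *m B = 0.
  move=> zs ws; apply: fB; [exact: inb|exact: inb|exists (z - w)].
  by rewrite opprD addrACA subrr add0r scalerBl.
have w1B : w1 *m B = 0.
  have := kB z1 0 z1s; rewrite rn0 scale0r addr0; exact.
have [i wi] : exists i, w1 ord0 i != 0.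
  apply: contrapT => H; move/eqP: w10; apply; apply: rowP_eq0 => i.
  by apply/eqP/negPn/negP => wi; apply: H; exists i.
suff : cder (fun z : C => f (b + z *: e) ord0 i) 0 != 0.
  rewrite (_ : cder _ 0 = 0) ?eqxx //.
  by rewrite -/(dv e (fun y => f y ord0 i) b) (fder_dv e i (fJ b b0)) eJ mxE.
apply: (@injective_cder_neq0 R _ s s0).
  move=> z zs; apply: (@lhol_chol _ _ (fun y : V => f y ord0 i) b e z).
  by apply: fder_lhol; apply: fJ; exact: inb.
move=> z w zs ws pzw; apply: linj => //; apply/eqP; rewrite -subr_eq0.
have [c cE] := rank1_scalar rB w10 w1B (kB z w zs ws).
have : (c *: w1) ord0 i = 0 by rewrite -cE !mxE pzw subrr.
rewrite mxE => /eqP; rewrite mulf_eq0 (negbTE wi) orbF => /eqP c0.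
by rewrite cE c0 scale0r.
Qed.

(** The matrix is rebuilt from directional derivatives because its entries are then holomorphic by
    [lhol_dv], whereas [J] is given only point by point. *)
Definition jac f (y : V) : 'M[C]_n :=
  \matrix_(i, j) dv (delta_mx 0 i) (fun x => f x ord0 j) y.

Lemma jacE f y A : fder f y A -> jac f y = A.
Proof.
move=> fA; apply/matrixP => i j; rewrite mxE (fder_dv _ j fA).
by rewrite -rowE mxE.
Qed.

Lemma lhol_det_jac f J b (rho : R) :
  (forall x, rn (x - b) < rho -> fder f x (J x)) ->
  forall x, rn (x - b) < rho -> lhol (fun y => \det (jac f y)) x.
Proof.
move=> fJ x xb; rewrite /determinant.
apply: lhol_sum => s; apply: lholM; first exact: lhol_cst.
apply: lhol_prod => i.
have := @lhol_dv _ _ (fun x => f x ord0 (s i)) b rho (delta_mx 0 i) _ x xb.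
move=> H; have {}H := H (fun y yb => fder_lhol (s i) (fJ y yb)).
by apply: lhol_ext H => y; rewrite mxE.
Qed.

Lemma span_kernel (A : 'M[C]_n) (e e1 : V) (t z : C) :
  e *m A = 0 -> e1 *m A = 0 -> (t *: e1 + z *: e) *m A = 0.
Proof. by move=> h h1; rewrite mulmxDl -!scalemxAl h h1 !scaler0 addr0. Qed.

Lemma affine2_sub (x0 e e1 : V) (t u z w : C) :
  (x0 + t *: e1 + z *: e) - (x0 + u *: e1 + w *: e) = (t - u) *: e1 + (z - w) *: e.
Proof. by apply/rowP => i; rewrite !mxE; ring. Qed.

Lemma fder_const_on_curve f J b (rho : R) :
  (forall x, rn (x - b) < rho -> fder f x (J x)) ->
  forall x0, rn (x0 - b) < rho -> exists2 d : R, 0 < d &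
    forall (g : R -> V) (L : R), (forall t : R, 0 <= t <= 1 -> rn (g t - x0) < d) ->
    (forall t u : R, 0 <= t <= 1 -> 0 <= u <= 1 -> rn (g t - g u) <= L * `|t - u|) ->
    (forall t u : R, 0 <= t <= 1 -> 0 <= u <= 1 -> (g t - g u) *m J (g u) = 0) ->
    f (g 0) = f (g 1).
Proof.
move=> fJ x0 x0b; have /cfor_rnP/(_ 1 ltr01)/nbhs_rnP[d d0 hd] := fder_continuous (fJ x0 x0b).
pose d1 := Num.min d (rho - rn (x0 - b)).
have d10 : 0 < d1 by rewrite lt_min d0 subr_gt0.
have d1d : d1 <= d by rewrite ge_min lexx.
have d1r : d1 <= rho - rn (x0 - b) by rewrite ge_min lexx orbT.
clearbody d1; exists (d1 / 8); first by lra.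
have inb x : rn (x - x0) < d1 -> rn (x - b) < rho.
  move=> xx; apply: le_lt_trans (rn_sub x x0 b) _.
  by rewrite -ltrBrDr; apply: lt_le_trans d1r.
move=> g L gd gL gJ; apply/rowP => i.
apply: (@const_on_curve _ _ (fun y => f y ord0 i) x0 d1 _ (rn (f x0) + 1) L g) => //.
- by move=> x xx; apply: fder_lhol; apply: fJ; exact: inb.
- move=> x xx; apply: le_trans (rn_coord _ _) _.
  by have := hd x (lt_le_trans xx d1d); have := rn_ler_sub (f x) (f x0); clear; lra.
- move=> t u t01 u01; rewrite (fder_dv _ i (fJ (g u) _)).
    by rewrite gJ // mxE.
  by apply: inb; have := gd u u01; lra.
Qed.

(** A quantitative form of the implicit function theorem: since [phi] is Lipschitz near [x0] and
    expands along [e], its zeros on lines parallel to [e] depend on the line in a Lipschitz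
    manner. *)
Lemma simple_zero_line (phi : V -> C) x0 e (r : R) : 0 < r ->
  (forall x, rn (x - x0) < r -> lhol phi x) -> dv e phi x0 != 0 ->
  exists d m K K2 : R, [/\ [/\ 0 < d, d <= r & 0 < m], [/\ 0 <= K & 0 < K2],
    forall x y, rn (x - x0) < d -> rn (y - x0) < d ->
      rn (phi y - phi x) <= K * rn (y - x) &
    forall x (z : C), rn (x - x0) < d -> rn (x + z *: e - x0) < d ->
      rn z * K2 <= m -> rn z * m <= rn (phi (x + z *: e) - phi x)].
Proof.
move=> r0 phil dphi.
have x00 : rn (x0 - x0) < r by rewrite subrr rn0.
(* Of [4 * m], the variation of [dv e phi] near [x0] consumes [2 * m] and the Taylor remainder
   another [m]. *)
have [m m0 mE] : exists2 m : R, 0 < m & rn (dv e phi x0) = 4 * m.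
  have : 0 < rn (dv e phi x0) by rewrite rn_gt0.
  by exists (rn (dv e phi x0) / 4); lra.
have m2 : 0 < 2 * m by lra.
have dphil : lhol (dv e phi) x0 by exact: lhol_dv phil x0 x00.
have [d1 d10 hd1] := iffLR (nbhs_rnP _ _) (iffLR (cfor_rnP _ _) dphil.1 _ m2).
have [M [d2 [d20 M0 hM]]] := lhol_bounded_near (phil x0 x00).1.
have [d [d0 dd1 dd2 dr]] : exists d : R, [/\ 0 < d, d <= d1, d <= d2 & d <= r].
  exists (Num.min (Num.min d1 d2) r).
  by rewrite !lt_min d10 d20 r0 !ge_min !lexx !orbT.
have phil' x : rn (x - x0) < d -> lhol phi x.
  by move=> xx; apply: phil; exact: lt_le_trans xx dr.
have hM' x : rn (x - x0) < d -> rn (phi x) <= M.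
  by move=> xx; apply: hM; exact: lt_le_trans xx dd2.
exists (d / 8), m, (16 * M / d), (32 * M / d ^+ 2 * rn e ^+ 2 + 1); split.
- by split=> //; lra.
- split; first by rewrite divr_ge0 ?mulr_ge0 // ltW.
  by rewrite ltr_wpDl // mulr_ge0 ?divr_ge0 ?exprn_ge0 ?mulr_ge0 ?rn_ge0 // ltW.
- by move=> x y; exact: lhol_lip.
move=> x z xx xz zm.
have := lhol_taylor1 phil' d0 hM' xx xz; rewrite [x + _ - x]addrC addKr.
have xd : rn (x - x0) < d by move: d0 xx; clear; lra.
rewrite (dvZ e z (phil' x xd)) rnZ exprMn => T.
have {}T : rn (phi (x + z *: e) - phi x - z * dv e phi x) <= rn z * m.
  apply: le_trans T _; apply: (@le_trans _ _ (rn z * (rn z * (32 * M / d ^+ 2 * rn e ^+ 2)))).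
    by rewrite le_eqVlt; apply/orP; left; apply/eqP; ring.
  rewrite ler_wpM2l ?rn_ge0 //; apply: le_trans zm.
  by rewrite ler_wpM2l ?rn_ge0 // lerDl.
have dm : 2 * m <= rn (dv e phi x).
  have h1 := hd1 x (lt_le_trans xd dd1); have := rn_ler_sub (dv e phi x0) (dv e phi x).
  rewrite [X in _ <= X]rnC => h2; move: (le_lt_trans h2 h1); rewrite mE.
  by move: (rn (dv e phi x)) => p; clear; lra.
have := rn_ler_sub (z * dv e phi x) (phi (x + z *: e) - phi x).
rewrite (rnC (z * _)) rnM => T2.
have := ler_wpM2l (rn_ge0 z) dm => T3.
by move: T T2 T3; move: (rn (_ - _ - _)) (rn (phi _ - _)) (rn z) (rn (dv _ _ _)) => q1 q2 q3 q4; clear; lra.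
Qed.

(* If the kernel of the derivative contains a fixed plane at every critical
   point, the critical set contains a Lipschitz curve inside that plane, along
   which [f] has to be constant. *)
Lemma no_critical_plane f J b (rho : R) e e1 : 0 < rho ->
  (forall x, rn (x - b) < rho -> fder f x (J x)) ->
  (forall x y, rn (x - b) < rho -> rn (y - b) < rho -> f x = f y -> x = y) ->
  (forall t z : C, t *: e1 + z *: e = 0 -> t = 0 /\ z = 0) ->
  (forall x, rn (x - b) < rho -> J x \notin unitmx -> e *m J x = 0 /\ e1 *m J x = 0) ->
  J b \notin unitmx -> False.
Proof.
move=> rho0 fJ inj indep ker Jb.
have b0 : rn (b - b) < rho by rewrite subrr rn0.
have e0 : e != 0.
  by apply/eqP => e0; have [_ /eqP] := indep 0 1 ltac:(by rewrite e0 scaler0 scale0r addr0); rewrite oner_eq0.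
have ne0 : 0 < rn e by rewrite rn_gt0.
pose h y := \det (jac f y).
have hl : forall x, rn (x - b) < rho -> lhol h x := lhol_det_jac fJ.
have hE x : rn (x - b) < rho -> h x = 0 -> J x \notin unitmx.
  by move=> xb; rewrite /h (jacE (fJ x xb)) unitmxE unitfE => ->; rewrite eqxx.
have hE' x : rn (x - b) < rho -> J x \notin unitmx -> h x = 0.
  by move=> xb; rewrite /h (jacE (fJ x xb)) unitmxE unitfE => /negPn/eqP.
have fl j x : rn (x - b) < rho -> lhol (fun y => f y ord0 j) x.
  by move=> xb; exact: fder_lhol (fJ x xb).
have curve := fder_const_on_curve fJ.
(* The least [j] with [P j] is positive, as [h x = 0]. The derivative of order [j - 1], called [phi]
   below, then vanishes at all critical points of the plane near [b] and has a simple zero along [e]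
   at one of them. *)
pose P (j : nat) := `[< exists t z : C, let x := b + (t *: e1 + z *: e) in
  [/\ rn (x - b) < rho / 2, h x = 0 & iter j (dv e) h x != 0] >].
(* Otherwise all derivatives of [h] along [e] vanish at [b], the line through [b] is critical, and
   [f] is constant on a segment of it. *)
have exP : exists j, P j.
  apply: contrapT => nP.
  have h0 j : iter j (dv e) h b = 0.
    apply/eqP/negPn/negP => hj; apply: nP; exists j; apply/asboolP.
    exists 0, 0 => /=; rewrite !scale0r !addr0 subrr rn0; split=> //; first by lra.
    exact: hE'.
  have hz := dv_taylor_zero rho0 hl h0.
  have [d d0 hd] := curve b b0.
  have [tau tau0 td] := @radius_exists R (Num.min d rho) (rn e) ltac:(by rewrite lt_min d0) (rn_ge0 e).
  move: td; rewrite lt_min => /andP[td tr].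
  have tb (t : R) : 0 <= t <= 1 -> rn (b + rc (t * tau) *: e - b) <= tau * rn e.
    move=> t01; rewrite addrC addKr rnZ rn_rc normrM (gtr0_norm tau0) ger0_norm; last by lra.
    by rewrite -mulrA ler_piMl ?mulr_ge0 ?rn_ge0 //; [exact: ltW|lra].
  have := hd (fun t => b + rc (t * tau) *: e) (tau * rn e) _ _ _.
  move=> H; have {}H := H _ _ _.
  have : f (b + rc (0 * tau) *: e) = f (b + rc (1 * tau) *: e).
    apply: H.
    - by move=> t t01; apply: le_lt_trans (tb t t01) td.
    - move=> t u t01 u01; rewrite subDl -scalerBl -rcB -mulrBl.
      rewrite rnZ rn_rc normrM (gtr0_norm tau0).
      by rewrite le_eqVlt; apply/orP; left; apply/eqP; ring.
    - move=> t u t01 u01; rewrite subDl -scalerBl -scalemxAl.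
      have ub := le_lt_trans (tb u u01) tr.
      have [-> _] := ker _ ub (hE _ ub (hz (rc (u * tau)) ltac:(by move: ub; rewrite addrC addKr rnZ))).
      by rewrite scaler0.
  move=> /inj E; have {E} := E _ _; rewrite mul0r mul1r rc0 scale0r addr0 => E.
  have /eqP := E b0 ltac:(by have := tb 1 ltac:(lra); rewrite mul1r => q; exact: le_lt_trans q tr).
  rewrite -subr_eq0 opprD addrA subrr add0r oppr_eq0 scaler_eq0 (negbTE e0) orbF rc_eq0.
  by rewrite gt_eqF.
case: (ex_minnP exP) => j /asboolP[t0 [z0]]; set x0 := b + _ => -[x0b hx0 jx0] jmin.
case: j jx0 jmin => [|j] jx0 jmin; first by rewrite /= hx0 eqxx in jx0.
pose phi := iter j (dv e) h.
have phil x : rn (x - b) < rho -> lhol phi x by exact: lhol_iter_dv.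
pose X (t z : C) := x0 + t *: e1 + z *: e.
have phiZ t z : rn (X t z - b) < rho / 2 -> h (X t z) = 0 -> phi (X t z) = 0.
  move=> xb xh; apply/eqP/negPn/negP => px.
  have : P j.
    apply/asboolP; exists (t0 + t), (z0 + z).
    suff -> : b + ((t0 + t) *: e1 + (z0 + z) *: e) = X t z by [].
    by rewrite /X /x0 !scalerDl -!addrA; congr (b + _); congr (_ + _); rewrite addrCA.
  by move=> /jmin; rewrite ltnn.
have hx0' : h (X 0 0) = 0 by rewrite /X !scale0r !addr0.
have X0 (z : C) : X 0 z = x0 + z *: e by rewrite /X scale0r addr0.
have X00 : X 0 0 = x0 by rewrite /X !scale0r !addr0.
have dphi : dv e phi x0 != 0 by [].
clearbody x0.
have x0b' : rn (x0 - b) < rho by clear -x0b rho0; lra.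
have [r [r0 rx]] : exists r : R, 0 < r /\ forall x, rn (x - x0) < r -> rn (x - b) < rho / 2.
  exists (rho / 2 - rn (x0 - b)); split; first by rewrite subr_gt0.
  by move=> x; rewrite ltrBrDr; apply: le_lt_trans; exact: rn_sub.
have rx' x : rn (x - x0) < r -> rn (x - b) < rho by move=> /rx; clear -rho0; lra.
have [d [m [K [K2 [[d0 dr m0] [K0 K20] lip simple]]]]] :=
  simple_zero_line r0 (fun x xr => phil x (rx' x xr)) dphi.
clear dphi jx0 jmin; clearbody phi; clear exP P hE'; clearbody h.
have [d3 d30 hd3] := curve x0 x0b'.
have [sg [sg0 sgd sgd3 sgm]] : exists sg : R, [/\ 0 < sg, sg * (rn e1 + rn e) < d, sg * (rn e1 + rn e) < d3 & 2 * sg * K2 <= m].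
  have [u u0 ud] := @radius_exists R (Num.min d d3) (rn e1 + rn e) ltac:(by rewrite lt_min d0) ltac:(by rewrite addr_ge0 ?rn_ge0).
  have m2 : 0 < m / 2 by rewrite divr_gt0.
  have [w w0 wm] := @radius_exists R (m / 2) K2 m2 (ltW K20).
  have le : Num.min u w * (rn e1 + rn e) <= u * (rn e1 + rn e).
    by rewrite ler_wpM2r ?addr_ge0 ?rn_ge0 // ge_min lexx.
  have le' : Num.min u w * K2 <= w * K2 by rewrite ler_wpM2r ?ge_min ?lexx ?orbT // ltW.
  move: ud; rewrite lt_min => /andP[ud1 ud2].
  exists (Num.min u w); split; first by rewrite lt_min u0.
  - exact: le_lt_trans le ud1.
  - exact: le_lt_trans le ud2.
  - by clear -le' wm; lra.
have XB (t z : C) : rn t < sg -> rn z < sg -> rn (X t z - x0) <= sg * (rn e1 + rn e).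
  move=> ts zs; have -> : X t z - x0 = t *: e1 + z *: e.
    by rewrite /X -[x0 + _ + _]addrA [x0 + _]addrC addrK.
  apply: le_trans (rnD _ _) _; rewrite !rnZ mulrDr.
  by apply: lerD; rewrite ler_wpM2r ?rn_ge0 // ltW.
have Xd (t z : C) : rn t < sg -> rn z < sg -> rn (X t z - x0) < d.
  by move=> ts zs; exact: le_lt_trans (XB t z ts zs) sgd.
have Xr (t z : C) : rn t < sg -> rn z < sg -> rn (X t z - b) < rho / 2.
  by move=> ts zs; apply: rx; exact: lt_le_trans (Xd t z ts zs) dr.
have Xr' (t z : C) : rn t < sg -> rn z < sg -> rn (X t z - b) < rho.
  by move=> ts zs; apply: rx'; exact: lt_le_trans (Xd t z ts zs) dr.
have r00 : rn (0 : C) < sg by rewrite rn0.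
have phi0 : phi x0 = 0 by rewrite -X00; apply: phiZ => //; exact: Xr.
have sg2 : 0 < sg / 2 by rewrite divr_gt0.
have sg2' : sg / 2 < sg by clear -sg0; lra.
(* The zero of [h] on the line through [x0] is isolated, because [phi] vanishes at each zero of [h]
   and expands along [e]; Hurwitz's theorem moves it to the neighbouring lines. *)
have H : \forall t \near (0 : C), exists2 z, rn z < sg / 2 & h (X t z) = 0.
  refine (@hurwitz R C (fun t z => h (X t z)) 0 sg (sg / 2) sg2 sg2' _ _ _ hx0').
  - apply/nbhs_rnP; exists sg => // t; rewrite subr0 => ts z zs.
    by apply: lhol_chol; apply: hl; exact: Xr'.
  - move=> z zs; apply: (@cfor_comp _ _ _ (fun p : C * C => X p.1 p.2) h).
      apply: cforDv.
        apply: cforDv; first exact: cfor_cst.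
        by apply: cforZv; [exact: cvg_fst|exact: cfor_cst].
      by apply: cforZv; [exact: cvg_snd|exact: cfor_cst].
    exact: (hl _ (Xr' 0 z r00 zs)).1.
  - move=> z /andP[zp zs]; apply/eqP => hz.
    have := phiZ 0 z (Xr _ _ r00 zs) hz; rewrite X0 => pz.
    have x0x0 : rn (x0 - x0) < d by rewrite subrr rn0.
    have zd : rn (x0 + z *: e - x0) < d by rewrite -X0; exact: Xd.
    have := simple x0 z x0x0 zd; rewrite pz phi0 subrr rn0 => S.
    have : rn z * m <= 0.
      apply: S; apply: le_trans sgm; rewrite ler_wpM2r ?(ltW K20) //.
      by clear -zs sg0; lra.
    by rewrite leNgt mulr_gt0.
have [tau0 tau00 htau] := iffLR (nbhs_rnP _ _) H.
have [tau [tau_gt0 tau1 tau2]] : exists tau : R, [/\ 0 < tau, tau < tau0 & tau < sg].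
  exists (Num.min tau0 sg / 2).
  have m1 : Num.min tau0 sg <= tau0 by rewrite ge_min lexx.
  have m2 : Num.min tau0 sg <= sg by rewrite ge_min lexx orbT.
  have m3 : 0 < Num.min tau0 sg by rewrite lt_min tau00.
  by move: m1 m2 m3; move: (Num.min _ _) => q; clear; split; lra.
have tt (t : R) : 0 <= t <= 1 -> rn (rc (t * tau)) <= tau.
  move=> /andP[t0' t1']; rewrite rn_rc ger0_norm ?mulr_ge0 ?(ltW tau_gt0) //.
  by rewrite ler_piMl // ltW.
have /choice[Z hZ] : forall t : R, exists z : C, 0 <= t <= 1 ->
    rn z < sg / 2 /\ h (X (rc (t * tau)) z) = 0.
  move=> t; have [t01|nt] := pselect (0 <= t <= 1); last by exists 0 => /nt.
  have [|z zs hz] := htau (rc (t * tau)); last by exists z.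
  by rewrite subr0; apply: le_lt_trans (tt t t01) tau1.
have Zs t : 0 <= t <= 1 -> rn (Z t) < sg by move=> /hZ[zs _]; exact: lt_trans zs sg2'.
have ts (t : R) : 0 <= t <= 1 -> rn (rc (t * tau)) < sg.
  by move=> /tt h1; exact: le_lt_trans h1 tau2.
pose g t := X (rc (t * tau)) (Z t).
have gphi t : 0 <= t <= 1 -> phi (g t) = 0.
  by move=> t01; apply: phiZ; [apply: Xr; [exact: ts|exact: Zs]|exact: (hZ t t01).2].
have gB t u : g t - g u = rc ((t - u) * tau) *: e1 + (Z t - Z u) *: e.
  by rewrite /g /X affine2_sub mulrBl rcB.
pose L1 := K * (tau * rn e1) / m.
(* The point [y] has the [e1]-coordinate of [g u] and the [e]-coordinate of [g t]: it differs from
   [g u] along [e], where [phi] expands, and from [g t] along [e1], where the Lipschitz bound is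
   used. *)
have ZL t u : 0 <= t <= 1 -> 0 <= u <= 1 -> rn (Z t - Z u) <= L1 * `|t - u|.
  move=> t01 u01.
  have [y [yE yd yB]] : exists y, [/\ g u + (Z t - Z u) *: e = y,
      rn (y - x0) < d & y - g t = rc ((u - t) * tau) *: e1].
    exists (X (rc (u * tau)) (Z t)); split.
    - by rewrite /g /X scalerBl -addrA [Z u *: e + _]addrC subrK.
    - by apply: Xd; [exact: ts|exact: Zs].
    - by rewrite /g /X affine2_sub subrr scale0r addr0 mulrBl rcB.
  have S : rn (Z t - Z u) * m <= rn (phi y).
    have := simple (g u) (Z t - Z u) (Xd _ _ (ts u u01) (Zs u u01)).
    rewrite yE (gphi u u01) subr0; apply; first exact: yd.
    apply: le_trans sgm; rewrite ler_wpM2r ?(ltW K20) //.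
    apply: le_trans (rnB _ _) _; have := (hZ t t01).1; have := (hZ u u01).1.
    by move: (rn _) (rn _) => q1 q2; clear -sg0; lra.
  have := lip (g t) y (Xd _ _ (ts t t01) (Zs t t01)) yd.
  rewrite yB (gphi t t01) subr0.
  rewrite rnZ rn_rc normrM (gtr0_norm tau_gt0) distrC => S2.
  rewrite /L1 mulrAC ler_pdivlMr //; apply: le_trans S (le_trans S2 _).
  by rewrite -!mulrA ler_wpM2l // mulrC mulrA.
have E : f (g 0) = f (g 1).
  apply: (hd3 g (tau * rn e1 + L1 * rn e)).
  - by move=> t t01; exact: le_lt_trans (XB _ _ (ts t t01) (Zs t t01)) sgd3.
  - move=> t u t01 u01; rewrite gB; apply: le_trans (rnD _ _) _.
    rewrite !rnZ rn_rc normrM (gtr0_norm tau_gt0) mulrDl; apply: lerD.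
      by rewrite mulrC mulrA mulrAC [rn e1 * _]mulrC.
    by rewrite mulrAC ler_wpM2r ?rn_ge0 // ZL.
  - move=> t u t01 u01; rewrite gB.
    have gb := Xr' _ _ (ts u u01) (Zs u u01).
    have [h1 h2] := ker _ gb (hE _ gb (hZ u u01).2).
    exact: span_kernel.
have i0 : 0 <= (0 : R) <= 1 by rewrite lexx ler01.
have i1 : 0 <= (1 : R) <= 1 by rewrite lexx ler01.
have := inj _ _ (Xr' _ _ (ts 0 i0) (Zs 0 i0)) (Xr' _ _ (ts 1 i1) (Zs 1 i1)) E.
rewrite -!/(g _) => /eqP; rewrite eq_sym -subr_eq0 gB subr0 mul1r => /eqP /indep[/eqP].
by rewrite rc_eq0 gt_eqF.
Qed.

Section GeneralizedInverse.
Variables A B : 'M[C]_n.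
Hypothesis ABA : A *m B *m A = A.

(** [B] is a generalized inverse of [A], so that [A *m B] is a projection with the left kernel of
    [A]. *)
Lemma ginv_compl : (1%:M - A *m B) *m (A *m B) = 0.
Proof. by rewrite mulmxBl mul1mx [A *m B *m _]mulmxA ABA subrr. Qed.

Lemma ginv_rank : (\rank A <= \rank (A *m B))%N.
Proof. by rewrite -{1}ABA mxrankM_maxl. Qed.

Lemma ginv_rank2 : (\rank A <= \rank (B *m (A *m B)))%N.
Proof.
have e : A *m (B *m (A *m B)) *m A = A by rewrite !mulmxA ABA ABA.
by rewrite -{1}e (leq_trans (mxrankM_maxl _ _)) // mxrankM_maxr.
Qed.

End GeneralizedInverse.

(* Osgood's theorem.  At a critical point of maximal rank k, a local inverse Psi
   of [f *m B + id *m S] straightens k components of [f], and at every critical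
   point of [f \o Psi] the derivative has the same kernel; its dimension is
   treated by [no_critical_line] if it is 1 and by [no_critical_plane] otherwise. *)
Lemma injective_jacobian_unit f J (U : set V) :
  (forall x, U x -> nbhs x U) -> (forall x, U x -> fder f x (J x)) ->
  (forall x y, U x -> U y -> f x = f y -> x = y) ->
  forall x, U x -> J x \in unitmx.
Proof.
move=> oU fJ inj x1 Ux1; have [//|nx1] := boolP (J x1 \in unitmx); exfalso.
pose P (k : nat) := `[< exists x, [/\ U x, J x \notin unitmx & \rank (J x) = k] >].
have exP : exists k, P k by exists (\rank (J x1)); apply/asboolP; exists x1.
have Pn k : P k -> (k <= n)%N by move=> /asboolP[x [_ _ <-]]; exact: rank_leq_row.
case: (ex_maxnP exP Pn) => k /asboolP[a [Ua na rk]] kmax.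
have {}kmax x : U x -> J x \notin unitmx -> (\rank (J x) <= k)%N.
  by move=> Ux nx; apply: kmax; apply/asboolP; exists x.
have [s s0 sU] := iffLR (nbhs_rnP _ _) (oU a Ua).
have [A AE] : exists A, J a = A by exists (J a).
have [B ABA] : exists B, A *m B *m A = A by exists (pinvmx A); exact: mulmxKpV (submx_refl A).
rewrite AE in rk.
have [Q QE] : exists Q, Q = A *m B by exists (A *m B).
have [S SE] : exists S, S = 1%:M - Q by exists (1%:M - Q).
have SQ : S *m Q = 0 by rewrite SE QE; exact: ginv_compl.
have rQ : (k <= \rank Q)%N by rewrite -rk QE; exact: ginv_rank.
have rBQ : (k <= \rank (B *m Q))%N by rewrite -rk QE; exact: ginv_rank2.
(* [S] completes [A *m B] to the identity, which is thus the derivative of [Phi] at [a]. *)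
pose Phi x := f x *m B + x *m S.
have PhiJ x : rn (x - a) < s -> fder Phi x (J x *m B + S).
  move=> xa; apply: fderD; last exact: fder_mx.
  exact: (fder_comp (g := mulmxr B) (fJ x (sU x xa)) (@fder_mx _ _ B (f x))).
have Ja : J a *m B + S \in unitmx by rewrite AE SE -QE addrC subrK unitmx1.
have [r [rho [Psi [r0 rs rho0 hPsi injPhi]]]] := local_inverse s0 PhiJ Ja.
pose b := Phi a.
have b0 : rn (b - b) < rho by rewrite subrr rn0.
have PsiU y : rn (y - b) < rho -> U (Psi y).
  by move=> /hPsi[h _ _ _]; apply: sU; exact: lt_le_trans h rs.
have Psib : Psi b = a.
  have [h1 h2 _ _] := hPsi b b0; apply: injPhi => //.
  by rewrite subrr rn0.
pose F y := f (Psi y).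
pose T y := invmx (J (Psi y) *m B + S).
pose K y := T y *m J (Psi y).
have FK y : rn (y - b) < rho -> fder F y (K y).
  move=> yb; have [_ _ _ h] := hPsi y yb.
  exact: fder_comp h (fJ _ (PsiU y yb)).
have Tu y : rn (y - b) < rho -> T y *m (J (Psi y) *m B + S) = 1%:M.
  by move=> /hPsi[_ _ h _]; rewrite /T mulVmx.
have injF x y : rn (x - b) < rho -> rn (y - b) < rho -> F x = F y -> x = y.
  move=> xb yb /(inj _ _ (PsiU x xb) (PsiU y yb)) e.
  by have [_ <- _ _] := hPsi x xb; have [_ <- _ _] := hPsi y yb; rewrite e.
(* In the coordinates given by [Psi], the part [F y *m (B *m Q)] is the linear map [Q], of rank at
   least [k]. *)
have FBQ y : rn (y - b) < rho -> F y *m (B *m Q) = y *m Q.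
  move=> yb; have [_ e _ _] := hPsi y yb.
  by rewrite -[in RHS]e /Phi mulmxDl -!mulmxA SQ mulmx0 addr0 /F.
have KBQ y : rn (y - b) < rho -> K y *m (B *m Q) = Q.
  move=> /Tu; rewrite mulmxDr => e; have {}e := congr1 (mulmx^~ Q) e.
  rewrite mulmxDl mul1mx -[T y *m S *m Q]mulmxA SQ mulmx0 addr0 in e.
  by rewrite /K !mulmxA in e *.
have nJ y : rn (y - b) < rho -> K y \notin unitmx -> J (Psi y) \notin unitmx.
  move=> yb; apply: contra => uJ; rewrite /K unitmx_mul uJ andbT.
  by have [_ _ h _] := hPsi y yb; rewrite /T unitmx_inv.
have rker M0 : \rank (kermx (M0 : 'M[C]_n)) = (n - \rank M0)%N by exact: mxrank_ker.
(* [Q] factors through [K y], so the kernel of [K y] lies in that of [Q]; by maximality of [k] its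
   dimension is no smaller. Hence the kernel is the same at all critical points. *)
have kerK y : rn (y - b) < rho -> K y \notin unitmx ->
    forall v : V, v *m A = 0 -> v *m K y = 0.
  move=> yb nK v vA; apply/sub_kermxP.
  have KQ : (kermx (K y) <= kermx Q)%MS.
    by apply/sub_kermxP; rewrite -(KBQ y yb) mulmxA mulmx_ker mul0mx.
  have rKy : (\rank (K y) <= k)%N.
    apply: leq_trans (mxrankM_maxr _ _) _; apply: kmax; first exact: PsiU.
    exact: nJ.
  have le : (\rank (kermx Q) <= \rank (kermx (K y)))%N.
    exact: leq_trans (eq_leq (rker Q)) (leq_trans (leq_sub2l n (leq_trans rKy rQ))
      (eq_leq (esym (rker (K y))))).
  have QK : (kermx Q <= kermx (K y))%MS by rewrite -(geq_leqif (mxrank_leqif_sup KQ)).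
  apply: submx_trans QK; apply/sub_kermxP.
  by rewrite QE mulmxA vA mul0mx.
have nKb : K b \notin unitmx.
  by rewrite /K unitmx_mul Psib negb_and na orbT.
have kn : (k < n)%N.
  rewrite ltn_neqAle -{2}rk rank_leq_row andbT; apply: contra na => /eqP kn.
  by rewrite -row_free_unit /row_free AE rk kn.
pose e := nz_row (kermx A).
have e0 : e != 0.
  rewrite /e nz_row_eq0 -mxrank_eq0 rker rk subn_eq0 -ltnNge //.
have eA : e *m A = 0 by apply/sub_kermxP; exact: nz_row_sub.
have [rA|rA] := leqP (\rank (kermx A)) 1.
  apply: (@no_critical_line F K b rho e (B *m Q) rho0 e0 FK injF); last exact: kerK.
    move=> x y xb yb [z xy]; rewrite mulmxBl !FBQ // -mulmxBl xy -scalemxAl.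
    by rewrite QE mulmxA eA mul0mx scaler0.
  by rewrite rker; apply: leq_trans rA; rewrite rker rk leq_sub2l.
have /row_subPn[i Ki] : ~~ (kermx A <= e)%MS.
  apply: contraL rA => /mxrankS; rewrite rank_rV e0 -leqNgt.
  by [].
pose e1 := row i (kermx A).
have e1A : e1 *m A = 0 by apply/sub_kermxP; exact: row_sub.
apply: (@no_critical_plane F K b rho e e1 rho0 FK injF) => //.
  move=> t z tz.
  have t0 : t = 0.
    apply/eqP/negPn/negP => t0; move/negP: Ki; apply; apply/sub_rVP.
    exists (- (t^-1 * z)); rewrite -/e1 scaleNr -scalerA -[e1]scale1r -(mulVf t0) -scalerA.
    by rewrite -scalerN; congr (_ *: _); apply/eqP; rewrite -addr_eq0 tz.
  move: tz; rewrite t0 scale0r add0r => /eqP; rewrite scaler_eq0 (negbTE e0) orbF.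
  by move=> /eqP.
by move=> x xb nx; split; apply: kerK.
Qed.

End Osgood.

(** * Transfer from Frechet differentiability *)

Section Bridge.
Variable R : realType.
Local Notation C := (Cplx R).

Lemma diff_rn (W W' : normedModType C) (f : W -> W') (x : W) : differentiable f x ->
  forall e : R, 0 < e -> exists2 d : R, 0 < d &
    forall h, rn h < d -> rn (f (x + h) - f x - 'd f x h) <= e * rn h.
Proof.
move=> df e e0; have /eqaddoP H := diff_locally df.
have /H /nbhs_rnP[d d0 hd] : 0 < rc e by rewrite -rc0 ltr_rc.
exists d => // h hh; have := hd h; rewrite subr0 => /(_ hh) /=.
by rewrite 2!fctE /= !rnE -rcM ler_rc opprD addrA [h + x]addrC.
Qed.

Lemma chol_path (n : nat) (g : C -> 'rV[C]_n) (a : C) :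
  (forall j, chol (fun t => g t ord0 j) a) ->
  exists v : 'rV[C]_n, forall e : R, 0 < e -> exists2 d : R, 0 < d &
    forall t, rn (t - a) < d -> rn (g t - g a - (t - a) *: v) <= e * rn (t - a).
Proof.
move=> hg; have /choice[v hv] : forall j, exists d, is_cder (fun t => g t ord0 j) a d.
  by move=> j; apply: chol_is_cder.
exists (\row_j v j) => e e0.
have H : \forall t \near a, forall j,
    rn (g t ord0 j - g a ord0 j - v j * (t - a)) <= e * rn (t - a).
  apply: (@filter_forall _ _ (fun j t => rn (g t ord0 j - g a ord0 j - v j * (t - a)) <=
    e * rn (t - a)) (nbhs a)) => j.
  have /is_cderP /(_ e e0)[r r0 hr] := hv j.
  by apply/nbhs_rnP; exists r.
have /nbhs_rnP[d d0 hd] := H; exists d => // t /hd ht.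
apply: rn_rV_le => [|j]; first by rewrite mulr_ge0 ?rn_ge0 // ltW.
by rewrite !mxE [(t - a) * _]mulrC.
Qed.

(** The chain rule along a path that is holomorphic in each coordinate; the differential is bounded
    through its values on the standard basis. *)
Lemma chol_diff (n : nat) (f : 'rV[C]_n -> C^o) (g : C -> 'rV[C]_n) (a : C) :
  differentiable f (g a) -> (forall j, chol (fun t => g t ord0 j) a) ->
  chol (fun t => f (g t) : C) a.
Proof.
move=> df /chol_path[v hv].
pose L := 'd f (g a).
have [B B0 LB] : exists2 B : R, 0 < B & forall w, rn (L w) <= B * rn w.
  pose c := \sum_j rn (L (delta_mx 0 j)).
  have c0 : 0 <= c by rewrite sumr_ge0 // => j _; exact: rn_ge0.
  exists (1 + c); first by lra.
  move=> w; apply: (@le_trans _ _ (c * rn w)); last first.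
    by rewrite ler_wpM2r ?rn_ge0 // lerDr ler01.
  rewrite {1}(row_sum_delta w) linear_sum; apply: le_trans (rn_sum _ _ _) _.
  rewrite /c mulr_suml; apply: ler_sum => j _; rewrite linearZ rnZ mulrC.
  by rewrite ler_wpM2l ?rn_ge0 // rn_coord.
apply/(@is_cder_chol _ _ _ (L v))/is_cderP => e e0.
have v0 := rn_ge0 v.
pose e1 := e / (2 * (1 + rn v)).
have e10 : 0 < e1 by rewrite divr_gt0 //; lra.
have [d1 d10 h1] := diff_rn df e10.
pose e2 := Num.min 1 (e / (2 * B)).
have e20 : 0 < e2 by rewrite lt_min ltr01 divr_gt0 //; lra.
have [d2 d20 h2] := hv e2 e20.
pose d := Num.min d2 (d1 / (1 + rn v)).
have d0 : 0 < d by rewrite lt_min d20 divr_gt0 //; lra.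
exists d => // t; rewrite lt_min => /andP[td2 td1].
set s := rn (t - a) in td1 td2 *; have s0 : 0 <= s by exact: rn_ge0.
have H2 := h2 t td2; rewrite -/s in H2.
have e2l : e2 <= 1 by rewrite ge_min lexx.
have gs : rn (g t - g a) <= (1 + rn v) * s.
  have := rnD (g t - g a - (t - a) *: v) ((t - a) *: v); rewrite subrK rnZ -/s => H.
  have : e2 * s <= 1 * s by rewrite ler_wpM2r.
  clear -H H2; lra.
have gd : rn (g t - g a) < d1.
  by apply: le_lt_trans gs _; rewrite mulrC -ltr_pdivlMr //; lra.
have := h1 _ gd; rewrite [g a + _]addrC subrK => H1.
have E : f (g t) - f (g a) - L v * (t - a) =
    (f (g t) - f (g a) - L (g t - g a)) + L (g t - g a - (t - a) *: v).
  have -> : L (g t - g a - (t - a) *: v) = L (g t - g a) - (t - a) * (L v : C) :> C.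
    by rewrite linearB linearZ.
  rewrite addrA subrK; congr (_ - _); exact: mulrC.
rewrite E; apply: le_trans (rnD _ _) _.
apply: (@le_trans _ _ (e1 * ((1 + rn v) * s) + B * (e2 * s))).
  apply: lerD; first by apply: le_trans H1 _; rewrite ler_wpM2l // ltW.
  by apply: le_trans (LB _) _; rewrite ler_wpM2l // ltW.
have -> : e1 * ((1 + rn v) * s) = e / 2 * s by rewrite /e1; field; lra.
have : B * (e2 * s) <= e / 2 * s.
  rewrite mulrA ler_wpM2r //.
  have : e2 <= e / (2 * B) by rewrite ge_min lexx orbT.
  by rewrite ler_pdivlMr; lra.
clear; lra.
Qed.

Lemma differentiable_fder (n : nat) (f : 'rV[C]_n -> 'rV[C]_n) (x : 'rV[C]_n) :
  differentiable f x -> fder f x (lin1_mx ('d f x)).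
Proof.
move=> df e e0; have [d d0 hd] := diff_rn df e0; exists d => // h hh.
by rewrite mul_rV_lin1; exact: hd.
Qed.

Lemma injective_local_inverse (n : nat) (f : 'rV[C]_n -> 'rV[C]_n)
    (U : set 'rV[C]_n) (a : 'rV[C]_n) :
  (forall x, U x -> nbhs x U) -> (forall x, U x -> differentiable f x) ->
  set_inj U f -> U a -> exists2 g : 'rV[C]_n -> 'rV[C]_n,
    g (f a) = a & exists2 d : R, 0 < d & forall v, rn (v - f a) < d ->
    [/\ U (g v), f (g v) = v, {for v, continuous g} &
        forall j, lhol (fun y => g y ord0 j) v].
Proof.
move=> oU df injf Ua.
have fJ x : U x -> fder f x (lin1_mx ('d f x)) by move=> /df; exact: differentiable_fder.
have inj x y : U x -> U y -> f x = f y -> x = y.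
  by move=> Ux Uy; apply: injf; rewrite inE.
have /nbhs_rnP[s s0 hs] := oU _ Ua.
have Ju := injective_jacobian_unit oU fJ inj.
have [r [d [g [r0 rs d0 hg _]]]] := local_inverse s0 (fun x xs => fJ x (hs x xs)) (Ju _ Ua).
exists g.
  have [gr fg _ _] := hg (f a) ltac:(by rewrite subrr rn0).
  by apply: inj fg => //; apply: hs; apply: lt_le_trans rs.
exists d => // v /hg[gr fg _ gd]; split => //.
- by apply: hs; apply: lt_le_trans rs.
- exact: fder_continuous gd.
- by move=> j; apply: fder_lhol gd.
Qed.

End Bridge.

(** * Hartogs extension across a ball *)

Lemma lip_continuous (R : realType) (W : normedModType (Cplx R)) (N : W -> R) (K : R) :
  0 < K -> (forall x y, `|N x - N y| <= K * rn (x - y)) -> continuous N.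
Proof.
move=> K0 hK x; apply/cvgrPdist_lt => e e0.
apply/nbhs_rnP; exists (e / K); first exact: divr_gt0.
by move=> y; rewrite ltr_pdivlMr // rnC mulrC; apply: le_lt_trans.
Qed.

Section ComplexNorm.
Variable R : realType.
Local Notation C := (Cplx R).
Variable n : nat.
Local Notation V := 'rV[C]_n.

(** The last clause makes the norm definite and normalizes it against the sup norm; with [cn_bound]
    each such norm gives the topology of C^n. *)
Definition cnorm (N : V -> R) := [/\ forall c x, N (c *: x) = rn c * N x,
  forall x y, N (x + y) <= N x + N y & forall x, rn x <= N x].

Variable N : V -> R.
Hypothesis hN : cnorm N.

Lemma cnZ c x : N (c *: x) = rn c * N x. Proof. by case: hN. Qed.
Lemma cnD x y : N (x + y) <= N x + N y. Proof. by case: hN. Qed.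
Lemma rn_cn x : rn x <= N x. Proof. by case: hN. Qed.
Lemma cn_ge0 x : 0 <= N x. Proof. exact: le_trans (rn_ge0 x) (rn_cn x). Qed.
Lemma cn0 : N 0 = 0. Proof. by rewrite -(scale0r 0) cnZ rn0 mul0r. Qed.
Lemma cn_gt0 x : x != 0 -> 0 < N x.
Proof. by rewrite -rn_gt0 => /lt_le_trans; apply; exact: rn_cn. Qed.
Lemma cn_eq0 x : (N x == 0) = (x == 0).
Proof.
have [->|/cn_gt0 h] := eqVneq x 0; first by rewrite cn0 eqxx.
by rewrite gt_eqF.
Qed.
Lemma cnN x : N (- x) = N x.
Proof. by rewrite -scaleN1r cnZ rnN rn1 mul1r. Qed.
Lemma cn_subr x y : N x - N y <= N (x - y).
Proof. by have := cnD (x - y) y; rewrite subrK; lra. Qed.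
Lemma cn_rc t x : 0 <= t -> N (rc t *: x) = t * N x.
Proof. by move=> t0; rewrite cnZ rn_rc ger0_norm. Qed.

Lemma cn_bound : exists2 K : R, 0 < K & forall x, N x <= K * rn x.
Proof.
pose c := \sum_j N (delta_mx 0 j).
have c0 : 0 <= c by rewrite sumr_ge0 // => j _; exact: cn_ge0.
exists (1 + c); first by lra.
move=> x; apply: (@le_trans _ _ (c * rn x)); last first.
  by rewrite ler_wpM2r ?rn_ge0 // lerDr ler01.
have sumD (s : seq 'I_n) (F : 'I_n -> V) : N (\sum_(j <- s) F j) <= \sum_(j <- s) N (F j).
  elim: s => [|j s IH]; first by rewrite !big_nil cn0.
  by rewrite !big_cons; apply: le_trans (cnD _ _) _; rewrite lerD2l.
rewrite {1}(row_sum_delta x); apply: le_trans (sumD _ _) _.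
rewrite /c mulr_suml; apply: ler_sum => j _; rewrite cnZ mulrC.
by rewrite ler_wpM2l ?cn_ge0 // rn_coord.
Qed.

Lemma cn_continuous : continuous N.
Proof.
have [K K0 hK] := cn_bound; apply: (lip_continuous K0) => x y.
have h1 := cn_subr x y; have h2 := cn_subr y x; have h3 := hK (x - y).
have h4 : N (y - x) = N (x - y) by rewrite -cnN opprB.
by rewrite ler_norml; lra.
Qed.

Lemma cfor_cn (T : topologicalType) (g : T -> V) a : {for a, continuous g} ->
  {for a, continuous (fun x => N (g x))}.
Proof. by move=> cg; apply: (@cfor_comp _ _ _ g N a cg); exact: cn_continuous. Qed.

Lemma near_cn_lt (T : topologicalType) (g : T -> V) a (c : R) : {for a, continuous g} ->
  N (g a) < c -> \forall x \near a, N (g x) < c.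
Proof. by move=> /cfor_cn cg /lt_nbhsl; move/cg. Qed.

Lemma near_cn_gt (T : topologicalType) (g : T -> V) a (c : R) : {for a, continuous g} ->
  c < N (g a) -> \forall x \near a, c < N (g x).
Proof. by move=> /cfor_cn cg /lt_nbhsr; move/cg. Qed.

Lemma nbhs_cn_lt (a : V) (c : R) : N a < c -> \forall x \near a, N x < c.
Proof. by move=> /lt_nbhsl; exact: cn_continuous. Qed.

Lemma nbhs_cn_gt (a : V) (c : R) : c < N a -> \forall x \near a, c < N x.
Proof. by move=> /lt_nbhsr; exact: cn_continuous. Qed.

Lemma compact_cn_le (c : R) : compact [set x | N x <= c].
Proof.
apply: (@compact_rV_bounded _ _ _ c).
  exact: (closed_preimage cn_continuous (@closed_le _ c)).
by move=> v; apply: le_trans; exact: rn_cn.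
Qed.

End ComplexNorm.

Lemma chol_path_continuous (R : realType) (n : nat) (g : Cplx R -> 'rV[Cplx R]_n) (a : Cplx R) :
  (forall j, chol (fun t => g t ord0 j) a) -> {for a, continuous g}.
Proof.
move=> /chol_path[v hv]; apply/cfor_rnP => e e0.
have [d d0 hd] := hv 1 ltr01; have v0 := rn_ge0 v.
apply/nbhs_rnP; exists (Num.min d (e / (1 + rn v))).
  by rewrite lt_min d0 divr_gt0 //; lra.
move=> t; rewrite lt_min ltr_pdivlMr; last by lra.
move=> /andP[/hd]; rewrite mul1r => h1 h2.
have := rnD (g t - g a - (t - a) *: v) ((t - a) *: v); rewrite subrK rnZ; lra.
Qed.

(** * Means of Cauchy kernels along lines through the origin *)

Section Star.
Variable R : realType.
Local Notation C := (Cplx R).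
Variable n : nat.
Local Notation V := 'rV[C]_n.
Variables (rho E : V -> R) (r : R).
Hypotheses (hrho : cnorm rho) (hE : cnorm E) (rhoE : forall x, rho x <= E x).
Hypotheses (r0 : 0 < r) (r1 : r < 1).
Variable f : V -> C^o.
Hypothesis df : forall x, r < E x -> rho x < 1 -> differentiable f x.
Hypothesis f1 : forall x, r < E x -> rho x < 1 -> rn (f x : C) <= 1.

(** The restriction of [f] to the line through [y], times the Cauchy kernel at [t = 1], the
    parameter of [y] itself. *)
Definition hartogs_kernel (y : V) (t : C) : C := (f (t *: y) : C) * (t / (t - 1)).
Local Notation G s y := (circ s (hartogs_kernel y)).
(** The circle [rn t = s] on the line through [y] lies in the domain of [f]. *)
Definition admissible (y : V) (s : R) := r < s * E y /\ s * rho y < 1.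

Lemma chol_scalev (y : V) (t : C) j : chol (fun t : C => (t *: y) ord0 j) t.
Proof.
apply: (chol_ext (f := fun t : C => t * y ord0 j)) => [u|]; first by rewrite mxE.
by apply: cholM; [exact: chol_id|exact: chol_cst].
Qed.

Lemma chol_ratio1 (t : C) : t != 1 -> chol (fun t : C => t / (t - 1)) t.
Proof.
move=> t1; apply: cholM; first exact: chol_id.
apply: cholV; first by apply: cholB; [exact: chol_id|exact: chol_cst].
by rewrite subr_eq0.
Qed.

Lemma chol_fline (y : V) (t : C) : admissible y (rn t) -> chol (fun t : C => f (t *: y) : C) t.
Proof.
move=> [h1 h2]; apply: (@chol_diff _ _ f (fun t : C => t *: y)).
  by apply: df; rewrite cnZ.
by move=> j; exact: chol_scalev.
Qed.

Lemma chol_hartogs_kernel (y : V) (t : C) : admissible y (rn t) -> t != 1 -> chol (hartogs_kernel y) t.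
Proof.
by move=> at1 t1; apply: cholM; [exact: chol_fline|exact: chol_ratio1].
Qed.

Lemma rn_eq_neq1 (t : C) (s : R) : s != 1 -> rn t = s -> t != 1.
Proof. by move=> s1 ts; apply: contraNneq s1 => t1; rewrite -ts t1 rn1. Qed.

Lemma kernel_mean_indep (y : V) (s s' : R) : 0 < s -> s <= s' -> admissible y s -> admissible y s' ->
  1 < s \/ s' < 1 -> G s y = G s' y.
Proof.
move=> s0 ss [a1 a2] [b1 b2] H; apply: circ_annulus => // t /andP[t1 t2].
have Ey := cn_ge0 hE y; have ry := cn_ge0 hrho y.
apply: chol_hartogs_kernel.
  split; first by apply: (lt_le_trans a1); rewrite ler_wpM2r.
  by apply: le_lt_trans b2; rewrite ler_wpM2r.
apply: (@rn_eq_neq1 _ (rn t)) => //; apply/eqP => e; lra.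
Qed.

Lemma kernel_mean_bound (y : V) (s : R) : 0 < s -> s != 1 -> admissible y s -> rn (G s y) <= s / `|s - 1|.
Proof.
move=> s0 s1 a; apply: rn_circ; first exact: ltW.
  move=> t ts; apply: chol_continuous; apply: chol_hartogs_kernel; first by rewrite ts.
  exact: rn_eq_neq1 ts.
move=> t ts; have [a1 a2] := a.
have fb : rn (f (t *: y) : C) <= 1 by apply: f1; rewrite cnZ // ts.
rewrite /hartogs_kernel !rnM rnV ts -[leRHS]mul1r ler_pM ?rn_ge0 //.
  by rewrite divr_ge0 ?rn_ge0 // ltW.
rewrite ler_wpM2l ?(ltW s0) // lef_pV2 ?posrE ?normr_gt0 ?subr_eq0 //.
  by have := rn_dist t 1; rewrite ts rn1.
by rewrite rn_gt0 subr_eq0; exact: rn_eq_neq1 ts.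
Qed.

Lemma admissible_near (g : C -> V) (a : C) (s : R) : 0 < s -> {for a, continuous g} ->
  admissible (g a) s -> \forall z \near a, admissible (g z) s.
Proof.
move=> s0 cg [a1 a2].
have cg' : {for a, continuous (fun z => rc s *: g z)}.
  by apply: cforZv; [exact: cfor_cst|exact: cg].
have s0' := ltW s0.
have := near_cn_gt hE cg' (c := r); rewrite cn_rc // => /(_ a1) H1.
have := near_cn_lt hrho cg' (c := 1); rewrite cn_rc // => /(_ a2) H2.
by near=> z; split; [rewrite -(cn_rc hE) //|rewrite -(cn_rc hrho) //]; near: z.
Unshelve. all: by end_near. Qed.

Lemma chol_kernel_mean (g : C -> V) (a : C) (s : R) : 0 < s -> s != 1 ->
  (\forall z \near a, forall j, chol (fun t => g t ord0 j) z) -> admissible (g a) s ->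
  chol (fun z => G s (g z)) a.
Proof.
move=> s0 s1 hg ag; have cg := chol_path_continuous (nbhs_singleton hg).
have : \forall z \near a, (forall j, chol (fun t => g t ord0 j) z) /\ admissible (g z) s.
  by apply: filterI => //; exact: admissible_near.
move=> /nbhs_rnP[d d0 hd]; have s0' := ltW s0.
have tn1 t : rc s * cis t != 1 :> C.
  by apply: (@rn_eq_neq1 _ s) => //; rewrite rn_circle.
apply: (@chol_dint R (fun z t => hartogs_kernel (g z) (rc s * cis t)) a d d0).
  move=> t z _ /hd[cz [a1 a2]]; apply: cholM; last exact: chol_cst.
  apply: (@chol_diff _ _ f (fun z : C => (rc s * cis t) *: g z)).
    by apply: df; rewrite cnZ // rn_circle.
  move=> j; apply: (chol_ext (f := fun z => (rc s * cis t) * g z ord0 j)) => [u|].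
    by rewrite mxE.
  by apply: cholM; [exact: chol_cst|exact: cz].
move=> t z _ /hd[cz [a1 a2]].
have c2 : {for (z, t), continuous (fun p : C * R => rc s * cis p.2 : C)}.
  apply: cforM; first exact: cfor_cst.
  by apply: cfor_comp; [exact: cvg_snd|exact: continuous_cis].
apply: cforM.
  apply: (@cfor_comp _ _ _ (fun p : C * R => (rc s * cis p.2) *: g p.1) f).
    apply: cforZv; first exact: c2.
    apply: (@cfor_comp _ _ _ (fun p : C * R => p.1) g); first exact: cvg_fst.
    exact: chol_path_continuous cz.
  by apply: differentiable_continuous; apply: df => /=; rewrite cnZ // rn_circle.
apply: cforM; first exact: c2.
apply: cforV; first by apply: cforB; [exact: c2|exact: cfor_cst].
by rewrite subr_eq0; exact: tn1.
Qed.

Hypothesis perp : forall y, exists2 v : V, v != 0 & forall z : C, E y <= E (y + z *: v).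

(** The midpoint of the interval of radii that are admissible and less than 1, the modulus of the
    pole. *)
Definition rad_in (y : V) : R := (r / E y + (Num.max 1 (rho y))^-1) / 2.
(** An admissible radius beyond the pole. Where [r < E y] fails, the circle is placed at Euclidean
    norm [(1 + r) / 2], which keeps the radius uniformly away from 1 and so bounds the mean in the
    hole. *)
Definition rad_out (y : V) : R :=
  if r < E y then (1 + (rho y)^-1) / 2 else (1 + r) / 2 / E y.

Lemma E_gt0_neq0 (y : V) : r < E y -> y != 0.
Proof. by have r0' := r0; move=> ry; rewrite -(cn_eq0 hE) gt_eqF //; lra. Qed.

Lemma rad_inP (y : V) : r < E y -> [/\ 0 < rad_in y, rad_in y < 1 & admissible y (rad_in y)].
Proof.
have r0' := r0; have r1' := r1; move=> ry; have y0 := E_gt0_neq0 ry.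
have E0 := cn_gt0 hE y0; have p0 := cn_gt0 hrho y0; have pE := rhoE y.
rewrite /rad_in; set m := Num.max 1 (rho y).
have m1 : 1 <= m by rewrite le_max lexx.
have m2 : rho y <= m by rewrite le_max lexx orbT.
have mE : r * m < E y.
  rewrite /m /Num.max; case: ifP => _; last by lra.
  have : r * rho y < 1 * rho y by rewrite ltr_pM2r.
  lra.
have a1 : r / E y < m^-1 by rewrite ltr_pdivrMr // mulrC ltr_pdivlMr //; lra.
have a2 : 0 < r / E y by rewrite divr_gt0.
have a3 : m^-1 <= 1 by rewrite invf_le1 //; lra.
have m0 : m != 0 by apply/eqP => e; rewrite e in m1; lra.
split; [lra|lra|split].
  rewrite mulrAC ltr_pdivlMr; last by lra.
  have : r / E y * E y < m^-1 * E y by rewrite ltr_pM2r.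
  by rewrite divfK ?gt_eqF // mulrDl; rewrite divfK ?gt_eqF //; lra.
apply: (@lt_le_trans _ _ (m^-1 * m)); last by rewrite mulVf.
apply: (@le_lt_trans _ _ ((r / E y + m^-1) / 2 * m)).
  by rewrite ler_wpM2l //; lra.
by rewrite ltr_pM2r; lra.
Qed.

Lemma rad_outP (y : V) : y != 0 -> rho y < 1 ->
  [/\ 1 < rad_out y, admissible y (rad_out y) & ~~ (r < E y) -> (1 + r^-1) / 2 <= rad_out y].
Proof.
have r0' := r0; have r1' := r1; move=> y0 ry.
have E0 := cn_gt0 hE y0; have p0 := cn_gt0 hrho y0; have pE := rhoE y.
have ri : 1 < r^-1 by rewrite invf_gt1.
rewrite /rad_out /admissible; case: ifPn => [rE|].
  have pi : 1 < (rho y)^-1 by rewrite invf_gt1.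
  split=> //; [lra|split].
    have : 1 * E y < (1 + (rho y)^-1) / 2 * E y by rewrite ltr_pM2r //; lra.
    lra.
  by rewrite mulrAC mulrDl mulVf ?gt_eqF //; lra.
rewrite -leNgt => Er.
have h : (1 + r^-1) / 2 <= (1 + r) / 2 / E y.
  rewrite ler_pdivlMr //; apply: (@le_trans _ _ ((1 + r^-1) / 2 * r)).
    by rewrite ler_wpM2l //; lra.
  by rewrite mulrAC mulrDl mulVf ?gt_eqF //; lra.
split=> //; [lra|rewrite divfK ?gt_eqF //; split; first by lra].
rewrite mulrAC ltr_pdivrMr //.
apply: (@le_lt_trans _ _ ((1 + r) / 2 * E y)); first by rewrite ler_wpM2l //; lra.
by rewrite ltr_pM2r //; lra.
Qed.

(* The inner mean is holomorphic on [r < E] and vanishes at infinity, hence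
   along the complex line [y + z *: v], on which [E] stays above [E y]. *)
Lemma inner_mean_eq0 (y : V) : r < E y -> G (rad_in y) y = 0.
Proof.
move=> ry; have [v v0 hv] := perp y.
pose g (z : C) := y + z *: v; pose h (z : C) : C := G (rad_in (g z)) (g z).
have rg z : r < E (g z) by apply: lt_le_trans (hv z).
have cg z j : chol (fun t => g t ord0 j) z.
  apply: (chol_ext (f := fun t => y ord0 j + t * v ord0 j)) => [t|]; first by rewrite !mxE.
  by apply: cholD; [exact: chol_cst|apply: cholM; [exact: chol_id|exact: chol_cst]].
have hh z : chol h z.
  have [s0 s1 a] := rad_inP (rg z).
  have H : chol (fun z' => G (rad_in (g z)) (g z')) z.
    apply: chol_kernel_mean => //; first by rewrite lt_eqF.
    by apply/nbhs_rnP; exists 1; [exact: ltr01|move=> u _ j; exact: cg].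
  apply: chol_near H; have cgz := chol_path_continuous (cg z).
  apply: filterS (admissible_near s0 cgz a) => u au.
  have [t0 t1 b] := rad_inP (rg u).
  have [st|/ltW ts] := leP (rad_in (g z)) (rad_in (g u)).
    by apply: kernel_mean_indep => //; right.
  by apply/esym; apply: kernel_mean_indep => //; right.
(* At distance [T] from 0 the point [g z] has norm at least [M], so its inner radius is below
   [1 / M <= 1 / 2] and the mean is at most [2 / M]; the maximum principle carries the bound to
   [z = 0]. *)
have bound (M : R) : 2 <= M -> rn (h 0) <= 2 / M.
  move=> M2; have rv : 0 < rn v by rewrite rn_gt0.
  pose T := (M + rn y) / rn v; have yn := rn_ge0 y.
  have T0 : 0 < T by rewrite divr_gt0 //; lra.
  apply: (@max_principle R h 0 (T + 1) (fun z _ => hh z) T (2 / M)) => //; first by lra.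
    move=> z; rewrite subr0 => zT; have [s0 s1 a] := rad_inP (rg z).
    have gM : M <= rho (g z).
      apply: le_trans (rn_cn hrho _); rewrite /g addrC.
      have := rn_ler_sub (z *: v) (- y); rewrite opprK rnN rnZ zT /T divfK ?gt_eqF //; lra.
    have sM : rad_in (g z) * M < 1.
      by apply: le_lt_trans a.2; rewrite ler_wpM2l // ltW.
    have sh : rad_in (g z) <= 1 / 2.
      have : rad_in (g z) * 2 <= rad_in (g z) * M by rewrite ler_wpM2l // ltW.
      lra.
    apply: le_trans (kernel_mean_bound s0 _ a) _; first by rewrite lt_eqF.
    rewrite ltr0_norm; last by lra.
    rewrite ler_pdivrMr; last by lra.
    rewrite mulrAC ler_pdivlMr; lra.
  by rewrite subrr rn0 ltW.
have h0 : h 0 = G (rad_in y) y by rewrite /h /g scale0r addr0.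
rewrite -h0; apply/eqP; rewrite -rn_eq0; apply/eqP; apply: le_anti.
rewrite rn_ge0 andbT leNgt; apply/negP => c0.
pose M := 2 + 4 / rn (h 0).
have c1 : 0 < 4 / rn (h 0) by rewrite divr_gt0.
have M2 : 2 <= M by rewrite /M; lra.
have := bound M M2; rewrite ler_pdivlMr; last by lra.
rewrite /M mulrDr mulrCA mulfV ?gt_eqF //; lra.
Qed.

(** Subtracting the constant [f y] removes the pole at [t = 1], so the means of [k] inside and
    outside agree. The kernel [u / (u - 1)] has mean 0 inside and 1 outside, and the inner mean of
    [f] vanishes. *)
Lemma outer_mean_eq (y : V) : r < E y -> rho y < 1 -> G (rad_out y) y = f y.
Proof.
move=> ry py; have y0 := E_gt0_neq0 ry.
have E0 := cn_gt0 hE y0; have p0 := cn_gt0 hrho y0.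
have [s0 s1 a] := rad_inP ry; have [t1 b _] := rad_outP y0 py.
set s := rad_in y in s0 s1 a; set t := rad_out y in t1 b *.
have [q cq fq] : chol (fun u : C => f (u *: y) : C) 1.
  by apply: chol_fline; rewrite rn1 /admissible !mul1r.
rewrite scale1r in fq.
pose k (u : C) : C := if u == 1 then q 1 else ((f (u *: y) : C) - f y) * (u / (u - 1)).
have admu (u : C) : r / E y < rn u < (rho y)^-1 -> admissible y (rn u).
  move=> /andP[h1 h2]; split; first by rewrite -ltr_pdivrMr.
  by rewrite -ltr_pdivlMr // mul1r.
have kN (u : C) : u != 1 -> k u = ((f (u *: y) : C) - f y) * (u / (u - 1)).
  by rewrite /k => /negbTE ->.
have ck1 (u : C) : r / E y < rn u < (rho y)^-1 -> u != 1 -> chol k u.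
  move=> /admu au u1.
  apply: (@chol_near _ (fun u => ((f (u *: y) : C) - f y) * (u / (u - 1)))).
    have : \forall w \near u, w - 1 != 0.
      apply: (@continuous_near_neq0 _ (fun w => w - 1)); last by rewrite subr_eq0.
      by apply: cforB; [exact: cfor_id|exact: cfor_cst].
    by apply: filterS => w; rewrite subr_eq0 => w1; rewrite kN.
  apply: cholM; last exact: chol_ratio1.
  by apply: cholB; [exact: chol_fline|exact: chol_cst].
have ck (u : C) : r / E y < rn u < (rho y)^-1 -> {for u, continuous k}.
  move=> hu; have [->|u1] := eqVneq u 1; last exact: chol_continuous (ck1 u hu u1).
  have cqk : {for 1, continuous (fun u : C => q u * u)}.
    apply: cforM; [exact: cq|exact: cfor_id].
  apply: (@cfor_near C C (fun u : C => q u * u) k 1 _ cqk).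
  apply: filterS fq => w fw; have [w1|w1] := eqVneq w 1.
    by rewrite w1 /k eqxx mulr1.
  have w2 : w - 1 != 0 by rewrite subr_eq0.
  by rewrite kN // fw addrC addKr [w / _]mulrC mulrA mulfK.
have s0' := ltW s0; have t0 : 0 <= t by lra.
have ratio (u : C) (x : R) : x != 1 -> rn u = x -> {for u, continuous (fun u : C => u / (u - 1))}.
  by move=> x1 ux; apply: chol_continuous; apply: chol_ratio1; exact: rn_eq_neq1 ux.
have kE (x : R) : 0 <= x -> x != 1 -> admissible y x ->
    circ x k = G x y - (f y : C) * circ x (fun u => u / (u - 1)).
  move=> x0 x1 ax.
  have cr u : rn u = x -> {for u, continuous (fun u : C => u / (u - 1))} by exact: ratio.
  rewrite -(circZ (f y : C) x0 cr) -(@circB _ x (hartogs_kernel y) _ x0).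
  - by apply: (circ_ext x0) => u ux; rewrite kN ?mulrBl //; exact: rn_eq_neq1 ux.
  - move=> u ux; apply: chol_continuous; apply: chol_hartogs_kernel; first by rewrite ux.
    exact: rn_eq_neq1 ux.
  - move=> u ux; apply: cforM; [exact: cfor_cst|exact: cr].
have E1 : circ s k = circ t k.
  have [a1 a2] := a; have [b1 b2] := b.
  apply: (@circ_annulus1 _ k 1 s t (r / E y) (rho y)^-1).
  - by rewrite ltW // divr_gt0.
  - by rewrite ltr_pdivrMr.
  - by lra.
  - by rewrite -[_^-1]mul1r ltr_pdivlMr.
  - exact: ck.
  - exact: ck1.
have s1n : s != 1 by rewrite lt_eqF.
have t1n : t != 1 by rewrite gt_eqF.
have rin : circ s (fun u : C => u / (u - 1)) = 0.
  have -> : circ s (fun u : C => u / (u - 1)) = 0 / (0 - 1); last by rewrite mul0r.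
  apply: (@mean_value1 _ (fun u : C => u / (u - 1)) 0 s 1 s0 s1).
    move=> u u1; apply: chol_continuous; apply: chol_ratio1.
    by apply/eqP => u1'; rewrite u1' rn1 ltxx in u1.
  move=> u u1 _ _; apply: chol_ratio1.
  by apply/eqP => u1'; rewrite u1' rn1 ltxx in u1.
have rout : circ t (fun u : C => u / (u - 1)) = 1.
  by apply: circ_kernel_pole; rewrite rn1.
rewrite (kE s) // (kE t) // rin rout inner_mean_eq0 // mulr0 subr0 mulr1 in E1.
by move/esym/eqP: E1; rewrite subr_eq0 => /eqP.
Qed.

End Star.

(** * Extension across the hole and the Schwarz lemma *)

Section HartogsSchwarz.
Variable R : realType.
Local Notation C := (Cplx R).
Variable n : nat.
Local Notation V := 'rV[C]_n.
Variables (rho E : V -> R) (r : R) (phi : V -> V) (z : V).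
Hypotheses (hrho : cnorm rho) (hE : cnorm E) (rhoE : forall x, rho x <= E x).
Hypotheses (r0 : 0 < r) (r1 : r < 1).
Hypothesis perp : forall y, exists2 v : V, v != 0 & forall c : C, E y <= E (y + c *: v).
Hypotheses (rz : r < E z) (z1 : rho z < 1).
Hypothesis dphi : forall x, rho x < 1 -> differentiable phi x.
Hypothesis phi1 : forall x, rho x < 1 -> rho (phi x) < 1.
Hypothesis phiK : forall x, rho x < 1 -> phi (phi x) = x.
Hypothesis phiz : phi z = 0.

Lemma phi0 : phi 0 = z. Proof. by rewrite -phiz phiK. Qed.

(** [rho (phi x)] has a maximum below 1 on the compact hole, and [phi] is an involution. *)
Lemma phi_far : exists2 t : R, t < 1 & forall w, rho w < 1 -> t < rho w -> r < E (phi w).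
Proof.
have r0' := r0; have r1' := r1.
have Kr x : E x <= r -> rho x < 1 by move=> h; have := rhoE x; lra.
have [||x|x Kx xm] := @compact_max R V (fun x => rho (phi x)) [set x | E x <= r].
- by exists 0 => /=; rewrite (cn0 hE) ltW.
- exact: (compact_cn_le hE).
- by move=> /= /Kr h; apply: (cfor_cn hrho); apply: differentiable_continuous; exact: dphi.
exists (rho (phi x)); first by apply: phi1; exact: Kr.
move=> w w1 tw; rewrite ltNge; apply/negP => Ew.
by have := xm (phi w) Ew; rewrite phiK // leNgt tw.
Qed.

Lemma chol_phi_line (u : V) (t : C) j : rho (t *: u) < 1 ->
  chol (fun t : C => phi (t *: u) ord0 j) t.
Proof.
move=> tu; apply: (@chol_diff _ _ (fun x => phi x ord0 j : C^o) (fun t : C => t *: u)).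
  apply: (@differentiable_comp _ _ _ _ phi (fun x : V => x ord0 j : C^o)).
    exact: dphi.
  exact: differentiable_coord.
by move=> k; exact: chol_scalev.
Qed.

Variable f : V -> C^o.
Hypothesis df : forall x, r < E x -> rho x < 1 -> differentiable f x.
Hypothesis f1 : forall x, r < E x -> rho x < 1 -> rn (f x : C) <= 1.
Hypothesis fz : f z = 0.

Definition hartogs (y : V) : C := circ (rad_out rho E r y) (hartogs_kernel f y).

(** The radius [rad_out] may jump from point to point, but by [kernel_mean_indep] it can be frozen
    near a given point. *)
Lemma hartogs_chol (g : C -> V) (a : C) :
  (\forall t \near a, forall j, chol (fun u => g u ord0 j) t) -> g a != 0 ->
  rho (g a) < 1 -> chol (fun t => hartogs (g t)) a.
Proof.
move=> hg ga ga1; have cga := chol_path_continuous (nbhs_singleton hg).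
have [s1 sa _] := rad_outP hrho hE rhoE r0 r1 ga ga1.
set s := rad_out rho E r (g a) in s1 sa.
have s0 : 0 < s by lra.
have H : chol (fun t => circ s (hartogs_kernel f (g t))) a.
  by apply: (chol_kernel_mean hrho hE df s0 _ hg sa); rewrite gt_eqF.
apply: chol_near H.
have H1 := admissible_near hrho hE s0 cga sa.
have H2 := near_cn_lt hrho cga ga1.
have ga0 := cn_gt0 hrho ga.
have H3 := near_cn_gt hrho cga ga0.
apply: filterS3 H1 H2 H3 => t t1 t2 t3; rewrite /hartogs.
have gt0 : g t != 0 by rewrite -(cn_eq0 hrho) gt_eqF.
have [u1 ua _] := rad_outP hrho hE rhoE r0 r1 gt0 t2.
have [su|/ltW us] := leP s (rad_out rho E r (g t)).
  by apply: (kernel_mean_indep hrho hE df) => //; left.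
apply/esym; apply: (kernel_mean_indep hrho hE df) => //; [lra|by left].
Qed.

Lemma hartogs_ext (x : V) : r < E x -> rho x < 1 -> hartogs x = f x.
Proof. exact: (outer_mean_eq hrho hE rhoE r0 r1 df f1 perp). Qed.

(** Off the hole the extension is [f]; in the hole the radius is at least [S > 1], and [s / (s - 1)]
    decreases in [s]. *)
Lemma hartogs_bounded : exists B : R, forall y, y != 0 -> rho y < 1 -> rn (hartogs y) <= B.
Proof.
have r0' := r0; have r1' := r1.
pose S : R := (1 + r^-1) / 2.
have ri : 1 < r^-1 by rewrite invf_gt1.
have S1 : 1 < S by rewrite /S; lra.
have B0 : 0 < S / (S - 1) by rewrite divr_gt0 //; lra.
exists (1 + S / (S - 1)) => y y0 y1; have [Ey|Ey] := boolP (r < E y).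
  by rewrite hartogs_ext //; have := f1 Ey y1; lra.
have [s1 sa /(_ Ey) sS] := rad_outP hrho hE rhoE r0 r1 y0 y1.
rewrite /hartogs; move: s1 sa sS; set s := rad_out _ _ _ _ => s1 sa sS.
have s0 : 0 < s by lra.
have sn : s != 1 by rewrite gt_eqF.
apply: le_trans (kernel_mean_bound hrho hE df f1 s0 sn sa) _.
rewrite -/S in sS; rewrite gtr0_norm; last by lra.
apply: (@le_trans _ _ (S / (S - 1))); last by lra.
rewrite ler_pdivrMr; last by lra.
rewrite mulrAC ler_pdivlMr; last by lra.
lra.
Qed.

(* [hartogs] extends [f] across the hole except possibly at [0]; along the disc
   [t |-> phi (t *: u)] the point [0] is attained at most once, away from
   [t = 0], and there the singularity is removable. *)
Lemma hartogs_schwarz (x : V) : r < E x -> rho x < 1 -> rn (f x : C) <= rho (phi x).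
Proof.
have r0' := r0; have r1' := r1.
move=> rx x1; have [->|xz] := eqVneq x z.
  by rewrite fz rn0 (cn_ge0 hrho).
pose y := phi x; have y1 : rho y < 1 by exact: phi1.
have y0 : y != 0 by apply: contraNneq xz => y0; rewrite -(phiK x1) -/y y0 phi0.
have ry0 := cn_gt0 hrho y0.
pose u := (rc (rho y))^-1 *: y.
have ru : rho u = 1.
  by rewrite (cnZ hrho) rnV rn_rc gtr0_norm // mulVf // gt_eqF.
have rtu (t : C) : rho (t *: u) = rn t by rewrite (cnZ hrho) ru mulr1.
have z0 := E_gt0_neq0 hE r0 rz.
have u0 : u != 0 by rewrite -(cn_eq0 hrho) ru oner_eq0.
(* [a] is the parameter at which the disc passes through 0; if there is none, 1 serves, as it lies
   outside of the open disc. *)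
have [a [a0 ha xa]] : exists a : C, [/\ a != 0,
    forall t : C, rn t < 1 -> t != a -> phi (t *: u) != 0 & rc (rho y) != a].
  have [[a [a1 az]]|na] := pselect (exists a : C, rn a < 1 /\ phi (a *: u) = 0).
    exists a; split.
    - by apply: contraNneq z0 => a0; rewrite -phi0 -[X in phi X](scale0r u) -a0 az.
    - move=> t t1; apply: contraNneq => tz.
      have : t *: u = a *: u.
        by rewrite -(phiK (x := t *: u)) ?rtu // -(phiK (x := a *: u)) ?rtu // tz az.
      by move/eqP; rewrite -subr_eq0 -scalerBl scaler_eq0 (negbTE u0) orbF subr_eq0.
    - apply/eqP => ya; have : x = 0.
        by rewrite -az -ya /u scalerA mulfV ?scale1r ?phiK // rc_eq0 gt_eqF.
      exact/eqP/(E_gt0_neq0 hE r0 rx).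
  exists 1; split; first exact: oner_neq0.
    by move=> t t1 _; apply/eqP => tz; apply: na; exists t.
  by rewrite -rc1 (inj_eq (@rc_inj R)) lt_eqF.
have [B hB] := hartogs_bounded.
have [t0 t1 ht0] := phi_far.
have xE : x = phi (rc (rho y) *: u).
  by rewrite /u scalerA mulfV ?scale1r ?phiK // rc_eq0 gt_eqF.
have yE : rn (rc (rho y) : C) = rho y by rewrite rn_rc gtr0_norm.
rewrite -hartogs_ext // -/y -[leRHS]yE [in leLHS]xE.
apply: (@schwarz_punctured R (fun t => hartogs (phi (t *: u))) a B t0 a0 t1).
- move=> t t1' ta; apply: hartogs_chol; last 2 first.
  + exact: ha.
  + by apply: phi1; rewrite rtu.
  have : \forall s \near t, rho (s *: u) < 1.
    apply: (near_cn_lt hrho); last by rewrite rtu.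
    by apply: cforZv; [exact: cfor_id|exact: cfor_cst].
  by apply: filterS => s su j; exact: chol_phi_line.
- by move=> t t1' ta; apply: hB; [exact: ha|apply: phi1; rewrite rtu].
- move=> t /andP[t2 t3] ta.
  have far : r < E (phi (t *: u)) by apply: ht0; rewrite rtu.
  have near1 : rho (phi (t *: u)) < 1 by apply: phi1; rewrite rtu.
  by rewrite hartogs_ext //; exact: f1.
- by rewrite scale0r phi0 hartogs_ext.
- by rewrite yE.
- exact: xa.
Qed.

End HartogsSchwarz.

(** * Invariants of a unit ball minus a Euclidean ball *)

Section HyperbolicTangent.
Variable R : realType.
Implicit Types x y : R.

Lemma tanhE x : tanh x = 1 - 2 / (expR x ^+ 2 + 1).
Proof.
rewrite /tanh expRN; have e0 := expR_gt0 x.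
have e1 : 0 < expR x ^+ 2 + 1 by rewrite ltr_pwDr // exprn_ge0 // ltW.
by field; rewrite !gt_eqF.
Qed.

Lemma tanh_lt1 x : tanh x < 1.
Proof.
have p : 0 < expR x ^+ 2 + 1 :> R by rewrite ltr_pwDr // exprn_ge0 // expR_ge0.
by rewrite tanhE ltrBlDr ltrDl divr_gt0.
Qed.

Lemma ler_tanh x y : x <= y -> tanh x <= tanh y.
Proof.
have p (t : R) : 0 < expR t ^+ 2 + 1 :> R by rewrite ltr_pwDr // exprn_ge0 // expR_ge0.
move=> xy; rewrite !tanhE lerD2l lerN2 ler_wpM2l // lef_pV2 ?posrE // lerD2r.
by rewrite lerXn2r ?nnegrE ?expR_ge0 // ler_expR.
Qed.

Lemma tanhK x : 0 <= x -> x < 1 -> tanh (artanh x) = x.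
Proof.
move=> x0 x1; rewrite tanhE /artanh -expRM_natl.
have p : 0 < (1 + x) / (1 - x) by rewrite divr_gt0; lra.
have -> : 2%:R * (ln ((1 + x) / (1 - x)) / 2) = ln ((1 + x) / (1 - x)) by field.
rewrite lnK //; field; lra.
Qed.

Lemma ler_artanh x y : 0 <= x -> x <= y -> y < 1 -> artanh x <= artanh y.
Proof.
move=> x0 xy y1; rewrite /artanh ler_wpM2r //.
have p (t : R) : 0 <= t -> t < 1 -> 0 < (1 + t) / (1 - t) by move=> t0 t1; rewrite divr_gt0; lra.
rewrite ler_ln ?posrE ?p //; try lra.
rewrite ler_pdivrMr; last by lra.
rewrite mulrAC ler_pdivlMr; last by lra.
nra.
Qed.

Lemma lt_artanh x y : 0 <= x -> x < 1 -> x < tanh y -> artanh x < y.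
Proof.
move=> x0 x1 xy; rewrite ltNge; apply/negP => /ler_tanh.
by rewrite tanhK // leNgt xy.
Qed.

Lemma artanh_lt x y : 0 <= x -> x < 1 -> 0 <= y -> y < 1 ->
  artanh x < artanh y -> x < y.
Proof.
move=> x0 x1 y0 y1; rewrite !ltNge; apply: contraNN => yx.
exact: ler_artanh.
Qed.

End HyperbolicTangent.

(** * One-sided cluster points and linear functionals *)

Section RightLimits.
Variable R : realType.
Local Notation C := (Cplx R).
Variable n : nat.
Local Notation V := 'rV[C]_n.

(** A cluster point along the right neighbourhoods of 0, spelled out as the existence of arbitrarily
    small parameters [t]. *)
Lemma cluster_right (K : set V) (h : R -> V) (t0 : R) : 0 < t0 -> compact K ->
  (forall t, 0 < t < t0 -> K (h t)) -> exists2 v, K v &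
  forall e d : R, 0 < e -> 0 < d -> exists2 t, 0 < t < d & rn (h t - v) < e.
Proof.
move=> t00 cK hK.
have right (d : R) : 0 < d -> \forall t \near 0^'+, 0 < t < d.
  move=> d0; near=> t; apply/andP; split; first by near: t; exact: nbhs_right_gt.
  by near: t; exact: nbhs_right_lt.
have [|v [Kv cv]] := cK (h @ 0^'+) _.
  by apply: filterS (right t0 t00) => t /hK.
exists v => // e d e0 d0.
have A : (h @ 0^'+) [set y | exists2 t, 0 < t < d & y = h t].
  by apply: filterS (right d d0) => t td; exists t.
have B : nbhs v [set y | rn (y - v) < e] by apply/nbhs_rnP; exists e.
by have [y [[t td ->] ye]] := cv _ _ A B; exists t.
Unshelve. all: by end_near. Qed.

(** Bilinear, without conjugation, so that it is holomorphic in [y]. *)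
Definition pairing (L : V) (y : V) : C^o := \sum_j y ord0 j * L ord0 j.

Lemma differentiable_rV (T : normedModType C) (f : T -> V) x :
  (forall j, differentiable (fun y => f y ord0 j : C^o) x) -> differentiable f x.
Proof.
move=> df; have -> : f = \sum_(j < n) (fun y => f y ord0 j *: (delta_mx ord0 j : V)).
  by apply/funext => y; rewrite fct_sumE [LHS]row_sum_delta.
apply: differentiable_sum => j.
exact: (@differentiableZl _ _ _ (fun y => f y ord0 j)).
Qed.

Lemma differentiable_pairing L y : differentiable (pairing L) y.
Proof.
have -> : pairing L = \sum_(j < n) (fun y : V => y ord0 j * L ord0 j : C^o).
  by apply/funext => x; rewrite fct_sumE.
apply: differentiable_sum => j.
apply: (@differentiableM _ _ (fun y : V => y ord0 j) (fun=> L ord0 j)).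
  exact: differentiable_coord.
exact: differentiable_cst.
Qed.

Lemma differentiable_scale (c : C) (x : V) : differentiable (fun y : V => c *: y) x.
Proof.
apply: (@differentiableZ _ _ _ (fun y : V => y) c x).
apply: differentiable_rV => j; exact: differentiable_coord.
Qed.

Lemma pairing0 L : pairing L 0 = 0.
Proof. by rewrite /pairing big1 // => j _; rewrite mxE mul0r. Qed.

Lemma chol_pairing L (g : C -> V) (a : C) :
  (forall j, chol (fun t => g t ord0 j) a) -> chol (fun t => pairing L (g t)) a.
Proof.
move=> hg; apply: chol_sum => j; apply: cholM; first exact: hg.
exact: chol_cst.
Qed.

End RightLimits.

Lemma lhol_near (R : realType) (W : normedModType (Cplx R)) (p q : W -> Cplx R) (x : W) :
  (\forall y \near x, p y = q y) -> lhol p x -> lhol q x.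
Proof.
move=> pq [cp lp]; split; first exact: cfor_near pq cp.
move=> v; apply: chol_near (lp v).
have cl := @cfor_line R W x v 0.
have := cl [set y | p y = q y]; rewrite scale0r addr0; exact.
Qed.

(** * The two invariants for a general pair of norms *)

Section BallMinusBall.
Variable R : realType.
Local Notation C := (Cplx R).
Variable n : nat.
Local Notation V := 'rV[C]_n.
Variables (rho E : V -> R) (r : R) (phi : V -> V) (z : V) (m : R) (w : V).
Hypotheses (hrho : cnorm rho) (hE : cnorm E) (rhoE : forall x, rho x <= E x).
Hypotheses (r0 : 0 < r) (r1 : r < 1).
Hypothesis norming : forall x, exists L : V,
  (forall y, rn (pairing L y : C) <= rho y) /\ pairing L x = rc (rho x).
Hypothesis perp : forall y, exists2 v : V, v != 0 & forall c : C, c != 0 -> E y < E (y + c *: v).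
Hypotheses (rz : r < E z) (z1 : rho z < 1).
Hypothesis dphi : forall x, rho x < 1 -> differentiable phi x.
Hypothesis phi1 : forall x, rho x < 1 -> rho (phi x) < 1.
Hypothesis phiK : forall x, rho x < 1 -> phi (phi x) = x.
Hypothesis phiz : phi z = 0.
Hypothesis hm : forall x, E x <= r -> m <= rho (phi x).
Hypotheses (Ew : E w = r) (phiw : rho (phi w) = m).

Definition ball_minus_ball : set V := [set x | r < E x /\ rho x < 1].
Local Notation D := ball_minus_ball.
Local Notation Om := (norm_ball rho 1).

Lemma open_norm_ball x : Om x -> nbhs x Om.
Proof.
move=> x1; have H := nbhs_cn_lt hrho x1.
exact: H.
Qed.

Lemma open_ball_minus_ball x : D x -> nbhs x D.
Proof.
move=> [x1 x2]; have H1 := nbhs_cn_lt hrho x2.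
have H2 := nbhs_cn_gt hE x1.
by apply: filterS2 H1 H2 => y; split.
Qed.

Lemma nearest_lt1 : rho w < 1.
Proof. by have := rhoE w; have r1' := r1; rewrite Ew; lra. Qed.

Lemma radius_lt1 : m < 1. Proof. by rewrite -phiw phi1 // nearest_lt1. Qed.

Lemma radius_gt0 : 0 < m.
Proof.
rewrite -phiw (cn_gt0 hrho) //; apply/eqP => w0.
have : w = z by rewrite -(phiK nearest_lt1) w0 (phi0 z1 phiK phiz).
by move=> wz; have rz' := rz; rewrite -wz Ew ltxx in rz'.
Qed.

Lemma perp_le y : exists2 v : V, v != 0 & forall c : C, E y <= E (y + c *: v).
Proof.
have [v v0 hv] := perp y; exists v => // c.
have [->|c0] := eqVneq c 0; first by rewrite scale0r addr0.
exact: ltW (hv c c0).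
Qed.

Lemma schwarz_fun (f : V -> C^o) x : holo D (@unit_disk R) f -> f z = 0 -> D x ->
  rn (f x : C) <= rho (phi x).
Proof.
move=> [df f1] fz [x1 x2].
apply: (hartogs_schwarz hrho hE rhoE r0 r1 perp_le rz z1 dphi phi1 phiK phiz _ _ fz x1 x2).
  by move=> y y1 y2; apply: df.
move=> y y1 y2; rewrite rn_cmod ltW //; apply: (f1 (f y)).
by exists y.
Qed.

(** A functional that norms [f x] reduces the claim to scalar functions. *)
Lemma schwarz_map (f : V -> V) x : holo D Om f -> f z = 0 -> D x ->
  rho (f x) <= rho (phi x).
Proof.
move=> [df f1] fz Dx; have [L [L1 Lx]] := norming (f x).
have := @schwarz_fun (pairing L \o f) x _ _ Dx; rewrite /= Lx rn_rc ger0_norm ?(cn_ge0 hrho) //.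
apply; last by rewrite fz pairing0.
split=> [y Dy|_ [y Dy <-]].
  apply: differentiable_comp; first exact: df.
  exact: differentiable_pairing.
rewrite /unit_disk /= -rn_cmod; apply: le_lt_trans (L1 _) _.
by apply: (f1 (f y)); exists y.
Qed.

(** The upper bound is [schwarz_fun]; it is attained by [pairing L \o phi] with [L] norming
    [phi x]. *)
Lemma caratheodory_ball_minus_ball x : D x -> caratheodory D z x = (artanh (rho (phi x)))%:E.
Proof.
move=> Dx; have [x1 x2] := Dx; apply: le_anti; apply/andP; split.
  apply: ge_ereal_sup => _ [l [f hf [fz fx]] <-]; rewrite lee_fin.
  have := schwarz_fun hf fz Dx; rewrite fx rn_cmod => h.
  by apply: ler_artanh h _; [rewrite -rn_cmod rn_ge0|exact: phi1].
have [L [L1 Lx]] := norming (phi x).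
apply: ereal_sup_ubound; exists (pairing L (phi x)); last first.
  by rewrite Lx -rn_cmod rn_rc ger0_norm // (cn_ge0 hrho).
exists (pairing L \o phi); last by rewrite /= phiz pairing0.
split=> [y [_ y2]|_ [y [_ y2] <-]].
  apply: differentiable_comp; first exact: dphi.
  exact: differentiable_pairing.
rewrite /unit_disk /= -rn_cmod; apply: le_lt_trans (L1 _) _.
exact: phi1.
Qed.

Lemma phi_out x : rho x < 1 -> rho (phi x) < m -> r < E x.
Proof. by move=> x1 xm; rewrite ltNge; apply/negP => /hm; rewrite leNgt xm. Qed.

Lemma phi_inj x y : rho x < 1 -> rho y < 1 -> phi x = phi y -> x = y.
Proof. by move=> x1 y1 e; rewrite -(phiK x1) e phiK. Qed.

(* The points [(1 + t) *: w] with [t > 0] approach the hole from within [D]. *)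
Definition ray (t : R) (c : C) (v : V) : V := rc (1 + t) *: (w + c *: v).

Lemma ray_cn (N : V -> R) t c v : cnorm N -> 0 <= t -> N (ray t c v) = (1 + t) * N (w + c *: v).
Proof. by move=> hN t0; rewrite /ray cn_rc //; lra. Qed.

Lemma ray_near (v : V) (e : R) : 0 < e -> exists2 d : R, 0 < d &
  forall t c, 0 <= t < d -> rn c < d -> rn (ray t c v - w) < e.
Proof.
move=> e0.
have a0 := rn_ge0 w; have b0 := rn_ge0 v.
pose d : R := Num.min 1 (e / (1 + rn w + 2 * rn v)).
have h0 : 0 < 1 + rn w + 2 * rn v by lra.
have d0 : 0 < d by rewrite lt_min ltr01 divr_gt0.
have d1 : d <= 1 by rewrite ge_min lexx.
have de : d * (1 + rn w + 2 * rn v) <= e by rewrite -ler_pdivlMr // ge_min lexx orbT.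
clearbody d; exists d => // t c /andP[t0 td] cd.
have -> : ray t c v - w = rc t *: w + (rc (1 + t) * c) *: v.
  rewrite /ray scalerDr scalerA rcD rc1; set x := _ *: v.
  by rewrite scalerDl scale1r addrAC [w + _]addrC addrK.
apply: le_lt_trans (rnD _ _) _; rewrite (rnZ (rc t)) (rnZ (rc (1 + t) * c)) rnM !rn_rc ger0_norm // ger0_norm; last by lra.
have c0 := rn_ge0 c.
have h1 : t * rn w <= d * rn w by rewrite ler_wpM2r // ltW.
have h2 : (1 + t) * rn c * rn v <= 2 * d * rn v.
  rewrite ler_wpM2r //; apply: ler_pM => //; lra.
by rewrite !mulrDr mulr1 in de; lra.
Qed.

Lemma phi_near_w (s : R) : m < s -> exists2 e : R, 0 < e &
  forall x, rn (x - w) < e -> rho x < 1 /\ rho (phi x) < s.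
Proof.
rewrite -phiw => ms.
have cphi : {for w, continuous phi}.
  by apply: differentiable_continuous; apply: dphi; exact: nearest_lt1.
have H1 := nbhs_cn_lt hrho nearest_lt1.
have H2 := near_cn_lt hrho cphi ms.
have H : \forall x \near w, rho x < 1 /\ rho (phi x) < s by apply: filterS2 H1 H2 => x; split.
by move/nbhs_rnP: H.
Qed.

Lemma squeezing_ball_minus_ball : squeezing rho D z = m%:E.
Proof.
apply: le_anti; apply/andP; split; last first.
  apply: ereal_sup_ubound; exists m => //; split; first exact: radius_gt0.
  exists phi; split => //.
  - split=> [x [_ x2]|_ [x [_ x2] <-]]; first exact: dphi.
    exact: phi1.
  - move=> x y; rewrite !inE => -[_ x2] [_ y2]; exact: phi_inj.
  - move=> y ym; rewrite /norm_ball /= in ym.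
    have y1 : rho y < 1 by apply: lt_trans ym radius_lt1.
    exists (phi y); last exact: phiK.
    by split; [apply: phi_out; [exact: phi1|rewrite phiK]|exact: phi1].
apply: ge_ereal_sup => _ [s [s0 [f [hf injf fz sf]]] <-].
rewrite lee_fin leNgt; apply/negP => ms.
have [df f1] := hf.
(* With [s'] strictly below [s], the closed ball of radius [s'] is compact and contained in the
   image of [f]. *)
pose s' := (m + s) / 2.
have s's : s' < s by rewrite /s'; lra.
have [e e0 he] := phi_near_w (s := s') ltac:(rewrite /s'; lra).
have [d d0 hd] := ray_near 0 e0.
pose p t := ray t 0 0.
have pE t : p t = rc (1 + t) *: w by rewrite /p /ray scale0r addr0.
have pD t : 0 < t < d -> D (p t) /\ rho (phi (p t)) < s'.
  move=> /andP[t0 td]; have := hd t 0 _ _; rewrite ltW // rn0 => /(_ td d0) /he[h1 h2].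
  split => //; split => //; rewrite /p ray_cn ?ltW // scale0r addr0 Ew.
  by rewrite mulrDl mul1r ltrDl mulr_gt0.
have [|t td|v Kv clv] := @cluster_right R n [set x | rho x <= s'] (f \o p) d d0.
- exact: (compact_cn_le hrho).
- have [Dp ps] := pD t td; apply: le_trans (ltW ps).
  exact: schwarz_map.
have [x Dx fx] : (f @` D) v by apply: sf; apply: le_lt_trans s's.
have [g gx [d1 d10 hg]] := injective_local_inverse open_ball_minus_ball df injf Dx.
rewrite fx in gx hg.
have xw : 0 < rn (x - w).
  rewrite rn_gt0 subr_eq0; apply/eqP => xw; have [rx _] := Dx.
  by rewrite xw Ew ltxx in rx.
have [_ _ cg _] := hg v ltac:(by rewrite subrr rn0).
have x20 : 0 < rn (x - w) / 2 by lra.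
have /continuous_rnP /(_ _ x20)[d2 d20 hd2] := cg.
have [d3 d30 hd3] := ray_near 0 x20.
have [||t /andP[t0]] := clv (Num.min d1 d2) (Num.min d d3).
- by rewrite lt_min d10.
- by rewrite lt_min d0.
rewrite !lt_min => /andP[t1 t3] /andP[h1 h2].
have [Dp _] := pD t ltac:(by rewrite t0).
have [Ug fg _ _] := hg _ h1.
(* The local inverse at the cluster value returns [p t], which is thus close to [x] and to [w] at
   once, whereas [x], a point of [D], differs from [w]. *)
have gp : g ((f \o p) t) = p t by apply: injf; rewrite ?inE.
have := hd2 _ h2; rewrite gp gx => k1.
have k2 := hd3 t 0 ltac:(by rewrite ltW) ltac:(by rewrite rn0).
have k3 := rn_sub x (p t) w; rewrite (rnC x (p t)) in k3.
have : rn (p t - x) + rn (p t - w) < rn (x - w) / 2 + rn (x - w) / 2 by exact: ltrD.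
by rewrite -splitr ltNge k3.
Qed.

Lemma fridman_ge : (m%:E <= fridman rho D z)%E.
Proof.
have m0 := radius_gt0; have m1 := radius_lt1.
(* By [caratheodory_ball_minus_ball] the ball of radius [artanh m] consists of the points with
   [rho (phi x) < m], which form the image of the model domain under [phi (rc m *: y)]. *)
apply: ereal_sup_ubound; exists (artanh m); last by rewrite tanhK // ltW.
have sc y : Om y -> rho (rc m *: y) < m.
  by move=> y1; rewrite (cn_rc hrho) ?(ltW m0) // -[ltRHS]mulr1 ltr_pM2l.
have sc1 y : Om y -> rho (rc m *: y) < 1 by move=> /sc h; apply: lt_trans h m1.
exists (fun y => phi (rc m *: y)); split.
- split=> [y y1|_ [y y1 <-]].
    apply: (@differentiable_comp _ _ _ _ (fun y : V => rc m *: y) phi).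
      exact: differentiable_scale.
    by apply: dphi; exact: sc1.
  split; last by apply: phi1; exact: sc1.
  by apply: phi_out; [apply: phi1; exact: sc1|rewrite phiK ?sc // sc1].
- move=> x y; rewrite !inE => x1 y1 /(phi_inj (sc1 _ x1) (sc1 _ y1)).
  by apply: scalerI; rewrite rc_eq0 gt_eqF.
- move=> x [Dx]; rewrite (caratheodory_ball_minus_ball Dx) lte_fin => h.
  have [_ x1] := Dx; have px : rho (phi x) < m.
    by apply: artanh_lt h; rewrite ?(cn_ge0 hrho) ?phi1 // ltW.
  exists ((rc m)^-1 *: phi x); last first.
    by rewrite scalerA mulfV ?rc_eq0 ?gt_eqF // scale1r phiK.
  rewrite /norm_ball /= -rcV (cn_rc hrho) ?invr_ge0 ?(ltW m0) //.
  by rewrite mulrC ltr_pdivrMr // mul1r.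
Qed.

Section Inverse.
Variable f : V -> V.
Hypotheses (df : forall x, Om x -> differentiable f x) (injf : set_inj Om f).

(** The inverse chosen point by point agrees near each point of the image with the local inverse
    from Osgood's theorem, by injectivity of [f]. *)
Lemma inverse_exists : exists g : V -> V, forall x, (f @` Om) x ->
  [/\ Om (g x), f (g x) = x, {for x, continuous g} & forall j, lhol (fun y => g y ord0 j) x].
Proof.
have /choice[g hg] : forall x, exists y, (f @` Om) x -> Om y /\ f y = x.
  move=> x; have [[y Oy fy]|nx] := pselect ((f @` Om) x); first by exists y.
  by exists 0.
exists g => x fx; have [gx fgx] := hg x fx; split=> //.
all: have [g' g'x [d d0 hd]] := injective_local_inverse open_norm_ball df injf gx.
all: rewrite fgx in g'x hd.
all: have E1 : \forall v \near x, g' v = g v by apply/nbhs_rnP; exists d => // v /hd[Ov fv _ _];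
  (have fv' : (f @` Om) v by exists (g' v)); have [gv fgv] := hg v fv';
  apply: injf; rewrite ?inE // fv fgv.
all: have [_ _ cg hol] := hd x ltac:(by rewrite subrr rn0).
  exact: cfor_near E1 cg.
move=> j; apply: lhol_near (hol j).
by apply: filterS E1 => y ->.
Qed.

End Inverse.

Lemma fridman_le : (fridman rho D z <= m%:E)%E.
Proof.
have r0' := r0; have m0 := radius_gt0; have m1 := radius_lt1.
apply: ge_ereal_sup => _ [q [f [[df f1] injf qf]] <-].
rewrite lee_fin leNgt; apply/negP => mq.
have q1 := tanh_lt1 q.
pose s := (m + tanh q) / 2.
have ms : m < s by rewrite /s; lra.
have s1 : s < tanh q by rewrite /s; lra.
have sf x : D x -> rho (phi x) < s -> (f @` Om) x.
  move=> Dx px; apply: qf; split => //; rewrite caratheodory_ball_minus_ball // lte_fin.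
  have [_ x1] := Dx.
  by apply: lt_artanh; rewrite ?(cn_ge0 hrho) ?phi1 //; apply: lt_trans px s1.
have [e e0 he] := phi_near_w ms.
have [v v0 hv] := perp w.
have [d d0 hd] := ray_near v e0.
(* Near [w] the point [ray t c v] leaves the hole as soon as [t > 0] or [c] is nonzero, the latter
   because [E] grows strictly along [v]; it then lies in a Caratheodory ball, hence in the image of
   [f]. *)
have inf t c : 0 <= t < d -> rn c < d -> 0 < t \/ c != 0 -> (f @` Om) (ray t c v).
  move=> td cd H; have [x1 xs] := he _ (hd t c td cd).
  have /andP[t0 _] := td.
  apply: sf => //; split=> //; rewrite ray_cn //.
  have [c0|c0] := eqVneq c 0.
    case: H => [t1|]; last by rewrite c0 eqxx.
    by rewrite c0 scale0r addr0 Ew mulrDl mul1r ltrDl mulr_gt0.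
  have := hv c c0; rewrite Ew => h.
  by apply: (lt_le_trans h); rewrite mulrDl mul1r lerDl mulr_ge0 //; apply: (cn_ge0 hE).
have [g hg] := inverse_exists df injf.
pose d2 := d / 2.
have d20 : 0 < d2 by rewrite divr_gt0.
have d2d : d2 < d by rewrite /d2; lra.
(* The boundary circles of the discs, including the limit disc [t = 0]: as [rn c = d2 > 0], this
   compact set is mapped by [ray] into the image of [f], and so the maximum [M] is below 1. *)
pose S : set (R * C) := `[0, d2]%classic `*` [set c | rn (c - 0) = d2].
have [|||p Sp pm] := @compact_max R _ (fun p : R * C => rho (g (ray p.1 p.2 v))) S.
- exists (0, rc d2); split=> /=; first by rewrite in_itv /= lexx ltW.
  by rewrite subr0 rn_rc ger0_norm // ltW.
- apply: compact_setX; first exact: segment_compact.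
  exact: compact_C_sphere.
- move=> [t c] [/= ]; rewrite in_itv /= subr0 => /andP[t0 td] cd.
  have H : (f @` Om) (ray t c v).
    apply: inf; [by rewrite t0 (le_lt_trans td)|by rewrite cd|right].
    by rewrite -rn_gt0 cd.
  have [_ _ cg _] := hg _ H.
  apply: (cfor_cn hrho (g := fun p : R * C => g (ray p.1 p.2 v))).
  apply: (@cfor_comp _ _ _ (fun p : R * C => ray p.1 p.2 v) g); last exact: cg.
  apply: cforZv.
    apply: cfor_rc; apply: (@cvgD _ R^o); [exact: cfor_cst|exact: cvg_fst].
  apply: cforDv; first exact: cfor_cst.
  by apply: cforZv; [exact: cvg_snd|exact: cfor_cst].
set M := rho (g (ray p.1 p.2 v)) in pm.
have M1 : M < 1.
  case: Sp => /=; rewrite in_itv /= subr0 => /andP[t0 td] cd.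
  have H : (f @` Om) (ray p.1 p.2 v).
    apply: inf; [by rewrite t0 (le_lt_trans td)|by rewrite cd|right].
    by rewrite -rn_gt0 cd.
  by have [h _ _ _] := hg _ H.
(* For [t > 0] the whole disc in [c] lies in the image; the maximum principle, for a functional that
   norms the value at the centre, bounds that value by [M]. *)
have bound t : 0 < t < d2 -> rho (g (ray t 0 v)) <= M.
  move=> /andP[t0 td]; have td' : 0 <= t < d by rewrite ltW //= (lt_trans td).
  have [L [L1 Lx]] := norming (g (ray t 0 v)).
  pose k (c : C) : C := pairing L (g (ray t c v)).
  have hk c : rn (c - 0) < d -> chol k c.
    rewrite subr0 => cd; have [_ _ _ hol] := hg _ (inf t c td' cd (or_introl t0)).
    apply: chol_pairing => j.
    have rE (u : C) : ray t u v = rc (1 + t) *: w + u *: (rc (1 + t) *: v).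
      by rewrite /ray scalerDr !scalerA [u * _]mulrC.
    apply: (chol_ext (f := fun u : C => g (rc (1 + t) *: w + u *: (rc (1 + t) *: v)) ord0 j)).
      by move=> u; rewrite rE.
    apply: (@lhol_chol _ _ (fun y => g y ord0 j)); rewrite -rE; exact: hol.
  have kM c : rn (c - 0) = d2 -> rn (k c) <= M.
    move=> cd; apply: le_trans (L1 _) _; apply: (pm (t, c)); split=> //=.
    by rewrite in_itv /= !ltW.
  have := max_principle hk d20 d2d kM (z := 0).
  rewrite subrr rn0 /k Lx rn_rc ger0_norm ?(cn_ge0 hrho) //.
  by apply; exact: ltW.
have [|x xM clx] := cluster_right (K := [set x | rho x <= M]) (h := fun t => g (ray t 0 v)) d20 _ bound.
  exact: (compact_cn_le hrho).
have Ox : Om x by apply: le_lt_trans xM M1.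
(* Continuity of [f] at the cluster point [x] would force [f x = w], which is not in [D]. *)
have Dfx : D (f x) by apply: f1; exists x.
have cf : {for x, continuous f} by apply: differentiable_continuous; exact: df.
have xw : 0 < rn (f x - w).
  rewrite rn_gt0 subr_eq0; apply/eqP => xw; have [rx _] := Dfx.
  by rewrite xw Ew ltxx in rx.
have x20 : 0 < rn (f x - w) / 2 by rewrite divr_gt0.
have /continuous_rnP /(_ _ x20)[d1 d10 hd1] := cf.
have [d3 d30 hd3] := ray_near v x20.
have [t /andP[t0]] := clx d1 (Num.min d2 d3) d10 ltac:(by rewrite lt_min d20).
rewrite lt_min => /andP[td td3] td1.
have td' : 0 <= t < d by rewrite ltW //= (lt_trans td).
have [_ fg _ _] := hg _ (inf t 0 td' ltac:(by rewrite rn0) (or_introl t0)).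
have k1 := hd1 _ td1; rewrite fg in k1.
have k2 := hd3 t 0 ltac:(by rewrite ltW) ltac:(by rewrite rn0).
have k3 := rn_sub (f x) (ray t 0 v) w; rewrite (rnC (f x) (ray t 0 v)) in k3.
have : rn (ray t 0 v - f x) + rn (ray t 0 v - w) < rn (f x - w) / 2 + rn (f x - w) / 2.
  exact: ltrD.
by rewrite -splitr ltNge k3.
Qed.

Lemma fridman_ball_minus_ball : fridman rho D z = m%:E.
Proof. by apply: le_anti; rewrite fridman_le fridman_ge. Qed.

End BallMinusBall.

(** * The spherical shell *)

Section Euclid.
Variable R : realType.
Local Notation C := (Cplx R).
Variable n : nat.
Local Notation V := 'rV[C]_n.
Local Notation E := (@euclid_norm R n).
Implicit Types (x y v w : V) (a c : C).

Lemma conj_rc (t : R) : (rc t : C)^* = rc t.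
Proof.
apply/CrealP; rewrite realE -rc0 !ler_rc; exact: le_total.
Qed.

Lemma mul_conj c : c * c^* = rc (rn c ^+ 2).
Proof. by rewrite -normCK rnE rcX. Qed.

Lemma rn_conj c : rn c^* = rn c.
Proof. by apply: (@rc_inj R); rewrite -!rnE norm_conjC. Qed.

Definition hermitian x y : C := \sum_j x ord0 j * (y ord0 j)^*.

Lemma hermitianC x y : hermitian y x = (hermitian x y)^*.
Proof.
rewrite /hermitian rmorph_sum; apply: eq_bigr => j _.
by rewrite rmorphM /= conjCK mulrC.
Qed.

Lemma hermitianDl x y v : hermitian (x + y) v = hermitian x v + hermitian y v.
Proof. by rewrite /hermitian -big_split; apply: eq_bigr => j _; rewrite mxE mulrDl. Qed.

Lemma hermitianZl c x y : hermitian (c *: x) y = c * hermitian x y.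
Proof. by rewrite /hermitian mulr_sumr; apply: eq_bigr => j _; rewrite mxE mulrA. Qed.

Lemma hermitianNl x y : hermitian (- x) y = - hermitian x y.
Proof. by rewrite -scaleN1r hermitianZl mulN1r. Qed.

Lemma hermitianDr x y v : hermitian v (x + y) = hermitian v x + hermitian v y.
Proof. by rewrite hermitianC hermitianDl rmorphD /= -!hermitianC. Qed.

Lemma hermitianZr c x y : hermitian y (c *: x) = c^* * hermitian y x.
Proof. by rewrite hermitianC hermitianZl rmorphM /= -hermitianC. Qed.

Lemma hermitianNr x y : hermitian y (- x) = - hermitian y x.
Proof. by rewrite hermitianC hermitianNl rmorphN /= -hermitianC. Qed.

Lemma euclid_ge0 x : 0 <= E x.
Proof. exact: sqrtr_ge0. Qed.

Lemma euclid_sqr x : E x ^+ 2 = \sum_j rn (x ord0 j) ^+ 2.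
Proof.
rewrite /euclid_norm sqr_sqrtr; last by rewrite sumr_ge0 // => j _; exact: sqr_ge0.
by apply: eq_bigr => j _; rewrite rn_cmod.
Qed.

Lemma hermitian_self x : hermitian x x = rc (E x ^+ 2).
Proof.
have rc_sum : {morph @rc R : s t / s + t} by exact: rcD.
rewrite euclid_sqr (big_morph _ rc_sum (rc0 R)); apply: eq_bigr => j _.
exact: mul_conj.
Qed.

Lemma euclidZ c x : E (c *: x) = rn c * E x.
Proof.
apply/eqP; rewrite -(@eqrXn2 _ 2) ?mulr_ge0 ?rn_ge0 ?euclid_ge0 //.
rewrite exprMn; apply/eqP; apply: (@rc_inj R); rewrite [in RHS]rcM -hermitian_self hermitianZl hermitianZr hermitian_self.
by rewrite mulrA mul_conj.
Qed.

Lemma rn_euclid x : rn x <= E x.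
Proof.
apply: rn_rV_le => [|j]; first exact: euclid_ge0.
rewrite -(@ler_pXn2r _ 2) ?nnegrE ?rn_ge0 ?euclid_ge0 // euclid_sqr (bigD1 j) //= lerDl.
by rewrite sumr_ge0 // => k _; exact: sqr_ge0.
Qed.

Lemma euclid_gt0 x : x != 0 -> 0 < E x.
Proof. by rewrite -rn_gt0 => /lt_le_trans; apply; exact: rn_euclid. Qed.

Lemma euclid_pythagoras x y : hermitian x y = 0 -> E (x + y) ^+ 2 = E x ^+ 2 + E y ^+ 2.
Proof.
move=> h; apply: (@rc_inj R); rewrite rcD -!hermitian_self hermitianDl !hermitianDr h (hermitianC x y) h.
by rewrite rmorph0 addr0 add0r.
Qed.

(** Pythagoras for the orthogonal projection [t *: y] of [x] on [y]. *)
Lemma cauchy_schwarz x y : rn (hermitian x y) <= E x * E y.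
Proof.
have [->|y0] := eqVneq y 0.
  by rewrite -(scale0r 0) hermitianZr rmorph0 mul0r rn0 mulr_ge0 ?euclid_ge0.
have Ey := euclid_gt0 y0.
have yy : rc (E y ^+ 2) != 0 :> C by rewrite rc_eq0 gt_eqF // exprn_gt0.
pose t := hermitian x y / rc (E y ^+ 2).
have o : hermitian (x - t *: y) (t *: y) = 0.
  by rewrite hermitianZr hermitianDl hermitianNl hermitianZl hermitian_self divfK // subrr mulr0.
have := euclid_pythagoras o; rewrite subrK => P.
have : E (t *: y) ^+ 2 <= E x ^+ 2 by rewrite P lerDr sqr_ge0.
rewrite ler_pXn2r ?nnegrE ?euclid_ge0 // euclidZ rnM rnV rn_rc ger0_norm ?sqr_ge0 //.
rewrite expr2 invfM mulrA -mulrA mulVf ?gt_eqF // mulr1 => h.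
by rewrite -ler_pdivrMr.
Qed.

Lemma euclidD x y : E (x + y) <= E x + E y.
Proof.
have [->|s0] := eqVneq (x + y) 0.
  by rewrite -(scale0r 0) euclidZ rn0 mul0r addr_ge0 ?euclid_ge0.
have Es := euclid_gt0 s0; rewrite -(ler_pM2r Es) mulrDl.
have -> : E (x + y) * E (x + y) = rn (hermitian (x + y) (x + y)).
  by rewrite hermitian_self rn_rc ger0_norm ?sqr_ge0.
rewrite hermitianDl; apply: le_trans (rnD _ _) _; apply: lerD; exact: cauchy_schwarz.
Qed.

Lemma cnorm_euclid : cnorm E.
Proof. by split; [exact: euclidZ|exact: euclidD|exact: rn_euclid]. Qed.

Lemma norming_euclid x : exists L : V,
  (forall y, rn (pairing L y : C) <= E y) /\ pairing L x = rc (E x).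
Proof.
have [->|x0] := eqVneq x 0.
  exists 0; split=> [y|]; last by rewrite pairing0 (cn0 cnorm_euclid).
  rewrite /pairing big1 ?rn0 ?euclid_ge0 // => j _; by rewrite mxE mulr0.
have Ex := euclid_gt0 x0.
pose L : V := \row_j (rc (E x)^-1 * (x ord0 j)^*).
have pE y : pairing L y = rc (E x)^-1 * hermitian y x.
  by rewrite /pairing /hermitian mulr_sumr; apply: eq_bigr => j _; rewrite mxE mulrCA.
exists L; split=> [y|]; last first.
  by rewrite pE hermitian_self -rcM expr2 mulrA mulVf ?mul1r // gt_eqF.
rewrite pE rnM rn_rc gtr0_norm ?invr_gt0 // mulrC ler_pdivrMr //.
exact: cauchy_schwarz.
Qed.

Lemma perp_euclid y : (2 <= n)%N ->
  exists2 v : V, v != 0 & forall c : C, c != 0 -> E y < E (y + c *: v).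
Proof.
move=> n2.
suff [v v0 h] : exists2 v : V, v != 0 & hermitian y v = 0.
  exists v => // c c0; have h' : hermitian y (c *: v) = 0 by rewrite hermitianZr h mulr0.
  rewrite -(@ltr_pXn2r _ 2) ?nnegrE ?euclid_ge0 // euclid_pythagoras // ltrDl exprn_gt0 //.
  by rewrite euclidZ mulr_gt0 ?euclid_gt0 // rn_gt0.
pose i0 := Ordinal (ltnW n2 : (0 < n)%N); pose i1 := Ordinal (n2 : (1 < n)%N).
have i01 : i1 != i0 by [].
(* The vector [(conj y1, - conj y0, 0, ...)] is orthogonal to [y]; it is 0 only if [y0 = y1 = 0],
   and then the first basis vector serves. *)
pose v : V := \row_j (if j == i0 then (y ord0 i1)^* else if j == i1 then - (y ord0 i0)^* else 0).
have [v0|v0] := eqVneq v 0; last first.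
  exists v => //; rewrite /hermitian (bigD1 i0) //= (bigD1 i1) //= big1.
    by rewrite !mxE !eqxx (negbTE i01) rmorphN /= !conjCK mulrN addr0 [y ord0 i0 * _]mulrC subrr.
  by move=> j /andP[j0 j1]; rewrite mxE (negbTE j0) (negbTE j1) rmorph0 mulr0.
exists (delta_mx ord0 i0); last first.
  rewrite /hermitian (bigD1 i0) //= big1 => [|j j0].
    rewrite mxE !eqxx addr0; have := congr1 (fun w : V => w ord0 i1) v0.
    rewrite !mxE eqxx (negbTE i01) => /eqP; rewrite oppr_eq0 conjC_eq0 => /eqP ->.
    by rewrite mul0r.
  by rewrite mxE (negbTE j0) andbF rmorph0 mulr0.
apply/eqP => /(congr1 (fun w : V => w ord0 i0)); rewrite !mxE !eqxx => /eqP.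
by rewrite oner_eq0.
Qed.

End Euclid.

Section DifferentiableScalar.
Variable R : realType.
Local Notation C := (Cplx R).
Variables (T : normedModType C) (x : T).

Lemma diff_scalM (f g : T -> C^o) : differentiable f x -> differentiable g x ->
  differentiable (fun y => (f y : C) * (g y : C) : C^o) x.
Proof. by move=> df dg; exact: (@differentiableM _ _ f g x). Qed.

Lemma diff_scalB (f g : T -> C^o) : differentiable f x -> differentiable g x ->
  differentiable (fun y => (f y : C) - (g y : C) : C^o) x.
Proof. by move=> df dg; exact: (@differentiableB _ _ _ f g x). Qed.

Lemma diff_scalV (f : T -> C^o) : differentiable f x -> f x != 0 ->
  differentiable (fun y => (f y : C)^-1 : C^o) x.
Proof. by move=> df fx; exact: (@differentiableV _ _ f x). Qed.

Lemma diff_scal_cst (c : C) : differentiable (fun _ : T => c : C^o) x.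
Proof. exact: differentiable_cst. Qed.

End DifferentiableScalar.

(** * Involutive automorphisms of the Euclidean ball *)

Section BallAutomorphism.
Variable R : realType.
Local Notation C := (Cplx R).
Variable n : nat.
Local Notation V := 'rV[C]_n.
Local Notation E := (@euclid_norm R n).
Variable a : V.
Hypothesis a1 : E a < 1.

Definition aut_scale : R := Num.sqrt (1 - E a ^+ 2).
Local Notation s := (rc aut_scale : C).

(** The classical involution [(a - P w - s (w - P w)) / (1 - hermitian w a)], where [P] projects on
    the line of [a]. Since [hermitian a a = 1 - s ^+ 2], the factor [(1 - s) / hermitian a a]
    becomes [1 / (1 + s)], which makes sense for [a = 0] too. *)
Definition ball_aut (w : V) : V :=
  (1 - hermitian w a)^-1 *: ((1 - hermitian w a / (1 + s)) *: a - s *: w).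

Lemma a_sqr_lt1 : E a ^+ 2 < 1.
Proof. by rewrite expr_lt1 // euclid_ge0. Qed.

Lemma aut_scale_gt0 : 0 < aut_scale.
Proof. by rewrite sqrtr_gt0 subr_gt0 a_sqr_lt1. Qed.

Lemma hermitian_center : hermitian a a = 1 - s ^+ 2.
Proof.
rewrite -rcX sqr_sqrtr ?subr_ge0 ?(ltW a_sqr_lt1) //.
by rewrite rcB rc1 opprB addrC subrK hermitian_self.
Qed.

Lemma aut_scale_neq0 : s != 0.
Proof. by rewrite rc_eq0 gt_eqF // aut_scale_gt0. Qed.

Lemma aut_scale1_neq0 : 1 + s != 0.
Proof.
rewrite -rc1 -rcD rc_eq0 gt_eqF //; have := aut_scale_gt0; lra.
Qed.

Lemma rn_hermitian_lt1 w : E w < 1 -> rn (hermitian w a) < 1.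
Proof.
move=> w1; apply: le_lt_trans (cauchy_schwarz w a) _.
apply: (@le_lt_trans _ _ (E w * 1)); last by rewrite mulr1.
by rewrite ler_wpM2l ?euclid_ge0 // ltW.
Qed.

Lemma hermitian_neq1 w : E w < 1 -> 1 - hermitian w a != 0.
Proof.
move=> /rn_hermitian_lt1 h; rewrite subr_eq0; apply/eqP => h1.
by rewrite -h1 rn1 ltxx in h.
Qed.

(** Expanding with [hermitian a a = 1 - s ^+ 2] leaves a rational identity. It gives the invariance
    of the ball and, through [mob_le] and [mob_eq], the extremal values of [E (ball_aut w)]. *)
Lemma ball_aut_sqr w : E w < 1 ->
  (1 - E (ball_aut w) ^+ 2) * rn (1 - hermitian w a) ^+ 2 = (1 - E a ^+ 2) * (1 - E w ^+ 2).
Proof.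
move=> w1; have c1 := hermitian_neq1 w1; have s1 := aut_scale1_neq0.
rewrite euclidZ rnV exprMn mulrBl mul1r mulrAC -exprMn mulVf ?rn_eq0 // expr1n mul1r.
set N : V := (X in rn (1 - hermitian w a) ^+ 2 - euclid_norm X ^+ 2); apply: (@rc_inj R).
rewrite rcB [in RHS]rcM !rcB rc1 -mul_conj -!hermitian_self hermitian_center /N.
rewrite hermitianDl !hermitianDr !hermitianNl !hermitianNr !hermitianZl !hermitianZr hermitian_center (hermitianC w a) conj_rc.
rewrite !rmorphB /= rmorphM /= fmorphV rmorphD /= rmorph1 conj_rc.
move: (hermitian w a) (hermitian w a)^* (hermitian w w) c1 => c d W c1.
by field.
Qed.

Lemma ball_aut_lt1 w : E w < 1 -> E (ball_aut w) < 1.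
Proof.
move=> w1; have := ball_aut_sqr w1.
have h1 : 0 < (1 - E a ^+ 2) * (1 - E w ^+ 2).
  by rewrite mulr_gt0 // subr_gt0 expr_lt1 ?euclid_ge0.
have h2 : 0 < rn (1 - hermitian w a) ^+ 2 by rewrite exprn_gt0 // rn_gt0 hermitian_neq1.
move=> h; rewrite -h pmulr_lgt0 // subr_gt0 expr_lt1 ?euclid_ge0 // in h1.
Qed.

Lemma ball_aut_id : ball_aut a = 0.
Proof.
have s1 := aut_scale1_neq0.
rewrite /ball_aut hermitian_center -scalerBl -[X in X - s]/(1 - _).
suff -> : 1 - (1 - s ^+ 2) / (1 + s) - s = 0 by rewrite scale0r scaler0.
by field.
Qed.

Lemma ball_autK w : E w < 1 -> ball_aut (ball_aut w) = w.
Proof.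
move=> w1; have c1 := hermitian_neq1 w1; have s1 := aut_scale1_neq0; have s0 := aut_scale_neq0.
have e1 : hermitian (ball_aut w) a = (1 - s ^+ 2 - hermitian w a) / (1 - hermitian w a).
  rewrite hermitianZl hermitianDl hermitianNl !hermitianZl hermitian_center; move: (hermitian w a) c1 => c c1; field.
  by rewrite c1.
have e2 : 1 - hermitian (ball_aut w) a = s ^+ 2 / (1 - hermitian w a).
  by rewrite e1; move: (hermitian w a) c1 => c c1; field.
have e3 : 1 - hermitian (ball_aut w) a != 0 by rewrite e2 mulf_neq0 ?invr_eq0 // expf_neq0.
rewrite {1}/ball_aut e2 e1; apply/rowP => j; rewrite !mxE.
move: (hermitian w a) c1 (a ord0 j) (w ord0 j) => c c1 aj wj; field.
by rewrite ?c1 ?s0 ?s1 ?e3.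
Qed.

Lemma differentiable_ball_aut w : E w < 1 -> differentiable ball_aut w.
Proof.
move=> w1; apply: differentiable_rV => j.
pose L : V := \row_k (a ord0 k)^*.
have hL x : hermitian x a = pairing L x.
  by apply: eq_bigr => k _; rewrite mxE.
have dh : differentiable (fun x => hermitian x a : C^o) w.
  have -> : (fun x => hermitian x a : C^o) = pairing L by apply/funext.
  exact: differentiable_pairing.
have -> : (fun y => ball_aut y ord0 j : C^o) = (fun y => (1 - hermitian y a)^-1 *
    ((1 - hermitian y a / (1 + s)) * a ord0 j - s * y ord0 j)).
  by apply/funext => y; rewrite !mxE.
apply: diff_scalM.
  apply: (@diff_scalV _ _ _ (fun y => 1 - hermitian y a)); last exact: hermitian_neq1.
  by apply: diff_scalB => //; exact: diff_scal_cst.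
apply: diff_scalB.
  apply: (@diff_scalM _ _ _ (fun y => 1 - hermitian y a / (1 + s))); last exact: diff_scal_cst.
  apply: (@diff_scalB _ _ _ (fun=> 1) (fun y => hermitian y a / (1 + s))); first exact: diff_scal_cst.
  by apply: diff_scalM => //; exact: diff_scal_cst.
apply: (@diff_scalM _ _ _ (fun=> s) (fun y : V => y ord0 j)); first exact: diff_scal_cst.
exact: differentiable_coord.
Qed.

End BallAutomorphism.

(** * Pseudo-hyperbolic distance on the interval [0, 1) *)

Section PseudoHyperbolic.
Variable R : realType.
Implicit Types P Q Z t r : R.

Lemma mob_gt0 Z t : 0 <= Z -> Z < 1 -> 0 <= t -> t < 1 -> 0 < 1 - t * Z.
Proof.
move=> Z0 Z1 t0 t1; have : t * Z <= t * 1 by rewrite ler_wpM2l // ltW.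
lra.
Qed.

Lemma mob_identity Z t : (1 - t * Z) ^+ 2 - (Z - t) ^+ 2 = (1 - Z ^+ 2) * (1 - t ^+ 2).
Proof. by ring. Qed.

(** [P] stands for the norm of the image under an automorphism and [Q] for the modulus of its
    denominator. The product [(1 - P ^+ 2) * Q ^+ 2] being fixed, [P] is least when [Q] is, and
    [Q = 1 - t * Z] gives the distance of the moduli by [mob_identity]. *)
Lemma mob_le P Q Z t : 0 <= P -> 0 <= Z -> Z < 1 -> 0 <= t -> t < 1 -> 1 - t * Z <= Q ->
  (1 - P ^+ 2) * Q ^+ 2 = (1 - Z ^+ 2) * (1 - t ^+ 2) -> `|(Z - t) / (1 - t * Z)| <= P.
Proof.
move=> P0 Z0 Z1 t0 t1 tQ e; have d0 := mob_gt0 Z0 Z1 t0 t1.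
have Q0 : 0 < Q by lra.
rewrite normrM normfV (gtr0_norm d0) ler_pdivrMr //.
rewrite -(@ler_pXn2r _ 2) ?nnegrE ?mulr_ge0 ?(ltW d0) // real_normK ?num_real //.
rewrite -(@ler_pM2r _ (Q ^+ 2)) ?exprn_gt0 // exprMn.
have i := mob_identity Z t.
have k0 : 0 <= (1 - Z ^+ 2) * (1 - t ^+ 2) by rewrite mulr_ge0 // subr_ge0 expr_le1 // ltW.
have h : (1 - t * Z) ^+ 2 <= Q ^+ 2 by rewrite ler_pXn2r // nnegrE ltW.
have hk : (1 - Z ^+ 2) * (1 - t ^+ 2) * (1 - t * Z) ^+ 2 <= (1 - Z ^+ 2) * (1 - t ^+ 2) * Q ^+ 2.
  by rewrite ler_wpM2l.
move: hk e i; set k := (1 - Z ^+ 2) * (1 - t ^+ 2).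
move: (1 - t * Z) => d; move: ((Z - t) ^+ 2) => N hk e i.
have -> : N = d ^+ 2 - k by rewrite -i; ring.
have -> : P ^+ 2 * d ^+ 2 * Q ^+ 2 = d ^+ 2 * Q ^+ 2 - k * d ^+ 2 by rewrite -e; ring.
by rewrite mulrBl lerD2l lerN2.
Qed.

Lemma mob_eq P Q Z t : 0 <= P -> 0 <= Z -> Z < 1 -> 0 <= t -> t < 1 -> 1 - t * Z = Q ->
  (1 - P ^+ 2) * Q ^+ 2 = (1 - Z ^+ 2) * (1 - t ^+ 2) -> P = `|(Z - t) / (1 - t * Z)|.
Proof.
move=> P0 Z0 Z1 t0 t1 tQ e; have d0 := mob_gt0 Z0 Z1 t0 t1; rewrite -tQ in e.
apply/eqP; rewrite -(@eqrXn2 _ 2) // real_normK ?num_real // expr_div_n.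
rewrite -mob_identity in e; have d20 : (1 - t * Z) ^+ 2 != 0 by rewrite expf_neq0 // gt_eqF.
rewrite -(inj_eq (mulIf d20)) divfK //; apply/eqP.
by rewrite mulrBl mul1r in e; apply: oppr_inj; apply: addrI e.
Qed.

(** After clearing denominators the difference is [1 - Z ^+ 2] times the distance from [t] to
    [u]. *)
Lemma mob_between Z t u : 0 <= Z -> Z < 1 -> 0 <= t -> t < 1 ->
  t <= u <= Z \/ Z <= u <= t ->
  `|(Z - u) / (1 - u * Z)| <= `|(Z - t) / (1 - t * Z)|.
Proof.
move=> Z0 Z1 t0 t1 H; have dt := mob_gt0 Z0 Z1 t0 t1.
have du : 0 < 1 - u * Z by apply: mob_gt0; case: H => /andP[]; lra.
have z2 : 0 <= 1 - Z ^+ 2 by rewrite subr_ge0 expr_le1 // ltW.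
rewrite !normrM !normfV (gtr0_norm dt) (gtr0_norm du) ler_pdivrMr // mulrAC ler_pdivlMr //.
case: H => /andP[h1 h2].
  rewrite !ger0_norm ?subr_ge0 ?(le_trans h1) //.
  rewrite -subr_ge0.
  have -> : (Z - t) * (1 - u * Z) - (Z - u) * (1 - t * Z) = (u - t) * (1 - Z ^+ 2) by ring.
  by rewrite mulr_ge0 // subr_ge0.
rewrite !ler0_norm ?subr_le0 ?(le_trans h1) //.
rewrite -subr_ge0.
have -> : - (Z - t) * (1 - u * Z) - (- (Z - u) * (1 - t * Z)) = (t - u) * (1 - Z ^+ 2) by ring.
by rewrite mulr_ge0 // subr_ge0.
Qed.

End PseudoHyperbolic.

(** * The invariants of the shell *)

Section AnnulusCase.
Variable R : realType.
Local Notation C := (Cplx R).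
Variables (n : nat) (r : R).
Hypotheses (n2 : (2 <= n)%N) (r0 : 0 < r) (r1 : r < 1).
Local Notation V := 'rV[C]_n.
Local Notation E := (@euclid_norm R n).
Variable z : V.
Hypotheses (rz : r < E z) (z1 : E z < 1).

(** By Cauchy-Schwarz the denominator [1 - hermitian w z] has modulus at least [1 - E w * E z]. *)
Lemma ball_aut_ge w : E w < 1 -> `|(E z - E w) / (1 - E w * E z)| <= E (ball_aut z w).
Proof.
move=> w1; have Q := ball_aut_sqr z1 w1.
apply: mob_le Q; rewrite ?euclid_ge0 //.
have := rn_ler_sub (1 : C) (hermitian w z); rewrite rn1; have := cauchy_schwarz w z; lra.
Qed.

Lemma annulusE : annulus r = ball_minus_ball E E r.
Proof. by apply/seteqP; split=> x; [case/andP|case=> h1 h2; apply/andP]. Qed.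

Local Notation m := ((E z - r) / (1 - r * E z)).
Local Notation w := (rc (r / E z) *: z).

Lemma euclid_center_gt0 : 0 < E z. Proof. exact: lt_trans rz. Qed.

Lemma euclid_nearest : E w = r.
Proof.
by rewrite (cn_rc (cnorm_euclid R n)) ?divr_ge0 ?(ltW r0) ?(ltW euclid_center_gt0) // divfK // gt_eqF // euclid_center_gt0.
Qed.

(** For this positive multiple of [z] the product [hermitian w z] is the real number [r * E z], so
    that the estimate of [ball_aut_ge] is an equality. *)
Lemma ball_aut_nearest : E (ball_aut z w) = m.
Proof.
have z0 := euclid_center_gt0; have r0' := r0; have rz' := rz.
have w1 : E w < 1 by rewrite euclid_nearest.
have d0 : 0 < 1 - r * E z by apply: mob_gt0; rewrite ?euclid_ge0 // ltW.
have := ball_aut_sqr z1 w1; rewrite euclid_nearest hermitianZl hermitian_self -rcM -rc1 -rcB rn_rc.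
have -> : r / E z * E z ^+ 2 = r * E z by field; rewrite gt_eqF.
rewrite gtr0_norm // => Q; rewrite (mob_eq _ _ _ _ _ (erefl _) Q) ?euclid_ge0 // ?(ltW r0) //.
by rewrite ger0_norm // divr_ge0 ?(ltW d0) // subr_ge0 ltW.
Qed.

Lemma ball_aut_ge_nearest x : E x <= r -> m <= E (ball_aut z x).
Proof.
move=> xr; have x1 : E x < 1 by apply: le_lt_trans xr r1.
apply: le_trans (ball_aut_ge x1).
have rz' := rz; have d0 : 0 < 1 - r * E z by apply: mob_gt0; rewrite ?euclid_ge0 // ltW.
have -> : m = `|m| by rewrite ger0_norm // divr_ge0 ?(ltW d0) // subr_ge0 ltW.
apply: mob_between; rewrite ?euclid_ge0 //; left.
by rewrite xr ltW.
Qed.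

Lemma annulus_invariants : squeezing E (annulus r) z = m%:E /\ fridman E (annulus r) z = m%:E.
Proof.
rewrite annulusE; have cE := cnorm_euclid R n.
have perp (y : V) := @perp_euclid R n y n2.
have rhoE x : E x <= E x by [].
split.
  exact: (squeezing_ball_minus_ball cE cE rhoE r0 r1 (@norming_euclid R n) perp rz z1
    (fun x h => differentiable_ball_aut z1 h) (fun x h => ball_aut_lt1 z1 h)
    (fun x h => ball_autK z1 h) (ball_aut_id z1) ball_aut_ge_nearest euclid_nearest ball_aut_nearest).
exact: (fridman_ball_minus_ball cE cE rhoE r0 r1 (@norming_euclid R n) perp rz z1
  (fun x h => differentiable_ball_aut z1 h) (fun x h => ball_aut_lt1 z1 h)
  (fun x h => ball_autK z1 h) (ball_aut_id z1) ball_aut_ge_nearest euclid_nearest ball_aut_nearest).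
Qed.

End AnnulusCase.

(** * The polydisk minus a ball *)

Lemma cfor_ext (T U : topologicalType) (f g : T -> U) (a : T) :
  f =1 g -> {for a, continuous f} -> {for a, continuous g}.
Proof. by move=> /funext ->. Qed.

Section DiskAutomorphism.
Variable R : realType.
Local Notation C := (Cplx R).
Implicit Types a w : C.

Definition disk_aut a w : C := (a - w) / (1 - a^* * w).

Lemma disk_aut_den a w : rn a < 1 -> rn w < 1 -> 1 - a^* * w != 0.
Proof.
move=> a1 w1; rewrite subr_eq0; apply/eqP => h.
have := mob_gt0 (rn_ge0 w) w1 (rn_ge0 a) a1.
by rewrite -(rn_conj a) -rnM -h rn1 subrr ltxx.
Qed.

Lemma disk_aut_sqr a w : rn a < 1 -> rn w < 1 ->
  (1 - rn (disk_aut a w) ^+ 2) * rn (1 - a^* * w) ^+ 2 = (1 - rn a ^+ 2) * (1 - rn w ^+ 2).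
Proof.
move=> a1 w1; have c1 := disk_aut_den a1 w1.
rewrite rnM rnV exprMn mulrBl mul1r -mulrA -exprMn mulVf ?rn_eq0 // expr1n mulr1.
apply: (@rc_inj R); rewrite rcB [in RHS]rcM !rcB rc1 -!mul_conj.
rewrite !rmorphB /= rmorphM /= conjCK rmorph1.
by move: a^* w^* => b v; ring.
Qed.

Lemma disk_aut_lt1 a w : rn a < 1 -> rn w < 1 -> rn (disk_aut a w) < 1.
Proof.
move=> a1 w1; have h := disk_aut_sqr a1 w1.
have h1 : 0 < (1 - rn a ^+ 2) * (1 - rn w ^+ 2).
  by rewrite mulr_gt0 // subr_gt0 expr_lt1 ?rn_ge0.
have h2 : 0 < rn (1 - a^* * w) ^+ 2 by rewrite exprn_gt0 // rn_gt0 disk_aut_den.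
by rewrite -h pmulr_lgt0 // subr_gt0 expr_lt1 ?rn_ge0 // in h1.
Qed.

Lemma disk_autK a w : rn a < 1 -> rn w < 1 -> disk_aut a (disk_aut a w) = w.
Proof.
move=> a1 w1; have c1 := disk_aut_den a1 w1.
have a2 : 1 - a^* * a != 0 by exact: disk_aut_den.
have c2 : 1 - a^* * disk_aut a w != 0 by apply: disk_aut_den => //; exact: disk_aut_lt1.
move: c2; rewrite /disk_aut; move: a^* c1 a2 => b c1 a2 c2.
have e : 1 - b * ((a - w) / (1 - b * w)) = (1 - b * a) / (1 - b * w) by field.
by rewrite e; field; rewrite ?a2 ?c1.
Qed.

Lemma disk_aut_ge a w : rn a < 1 -> rn w < 1 ->
  `|(rn a - rn w) / (1 - rn w * rn a)| <= rn (disk_aut a w).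
Proof.
move=> a1 w1; apply: mob_le (disk_aut_sqr a1 w1); rewrite ?rn_ge0 //.
have := rn_ler_sub (1 : C) (a^* * w); rewrite rn1 rnM rn_conj [rn a * _]mulrC; lra.
Qed.

(** The number of modulus [t] with the argument of [a], or with argument 0 if [a = 0]. This choice
    makes the denominator of [disk_aut] smallest among all numbers of modulus [t]. *)
Definition align a (t : R) : C := if a == 0 then rc t else rc (t / rn a) * a.

Lemma rn_align a (t : R) : 0 <= t -> rn (align a t) = t.
Proof.
move=> t0; rewrite /align; have [_|a0] := eqVneq a 0; first by rewrite rn_rc ger0_norm.
have ra : 0 < rn a by rewrite rn_gt0.
by rewrite rnM rn_rc ger0_norm ?divr_ge0 ?(ltW ra) // divfK // gt_eqF.
Qed.

Lemma disk_aut_align a (t : R) : rn a < 1 -> 0 <= t -> t < 1 ->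
  rn (disk_aut a (align a t)) = `|(rn a - t) / (1 - t * rn a)|.
Proof.
move=> a1 t0 t1; have w1 : rn (align a t) < 1 by rewrite rn_align.
have := disk_aut_sqr a1 w1; rewrite rn_align //; apply: mob_eq; rewrite ?rn_ge0 //.
suff -> : a^* * align a t = rc (t * rn a).
  rewrite -rc1 -rcB rn_rc ger0_norm // ltW //; apply: mob_gt0; rewrite ?rn_ge0 //.
rewrite /align; have [->|a0] := eqVneq a 0; first by rewrite rmorph0 mul0r rn0 mulr0.
rewrite mulrCA [a^* * a]mulrC mul_conj -rcM; congr rc.
by rewrite expr2 mulrA divfK ?rn_eq0.
Qed.

End DiskAutomorphism.

(** * The invariants of the polydisk minus a ball *)

Section PolydiskCase.
Variable R : realType.
Local Notation C := (Cplx R).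
Variables (n : nat) (r : R).
Hypotheses (n2 : (2 <= n)%N) (r0 : 0 < r) (r1 : r < 1).
Local Notation V := 'rV[C]_n.
Local Notation E := (@euclid_norm R n).
Local Notation M := (@max_norm R n).

Lemma cnorm_max : cnorm M.
Proof.
have e (x : V) : M x = rn x by rewrite rn_rV.
by split=> *; rewrite !e ?rnZ ?rnD.
Qed.

Lemma max_le_euclid (x : V) : M x <= E x.
Proof. by rewrite -rn_rV; exact: rn_euclid. Qed.

(** A coordinate of largest modulus at [x], rotated so as to be positive there. *)
Lemma norming_max (x : V) : exists L : V,
  (forall y, rn (pairing L y : C) <= M y) /\ pairing L x = rc (M x).
Proof.
pose i0 : 'I_n := Ordinal (ltnW n2 : (0 < n)%N).
have [j hj] : exists j, M x = rn (x ord0 j).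
  have [j _ hj] : exists2 j : 'I_n, true & forall i : 'I_n, true -> rn (x ord0 i) <= rn (x ord0 j).
    case: (@Order.TotalTheory.arg_maxP _ _ _ i0 xpredT (fun i => rn (x ord0 i)) isT) => j _ h.
    by exists j.
  exists j; apply: le_anti; rewrite -rn_rV rn_coord andbT.
  by apply: rn_rV_le; [exact: rn_ge0|move=> i; exact: hj].
have [x0|x0] := eqVneq (x ord0 j) 0.
  exists 0; split=> [y|].
    by rewrite /pairing big1 ?rn0 ?(cn_ge0 cnorm_max) // => i _; rewrite mxE mulr0.
  by rewrite hj x0 rn0 /pairing big1 // => i _; rewrite mxE mulr0.
have xj : 0 < rn (x ord0 j) by rewrite rn_gt0.
pose L : V := ((x ord0 j)^* / rc (rn (x ord0 j))) *: delta_mx ord0 j.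
have pE y : pairing L y = y ord0 j * ((x ord0 j)^* / rc (rn (x ord0 j))).
  rewrite /pairing (bigD1 j) //= big1 => [|i ij].
    by rewrite !mxE !eqxx mulr1 addr0.
  by rewrite !mxE (negbTE ij) andbF !mulr0.
exists L; split=> [y|].
  rewrite pE !rnM rnV rn_conj rn_rc gtr0_norm // mulfV ?gt_eqF // mulr1.
  by rewrite -rn_rV rn_coord.
rewrite pE mulrA mul_conj -rcV -rcM hj; congr rc.
by field; rewrite gt_eqF.
Qed.

Variable z : V.
Hypotheses (rz : r < E z) (z1 : M z < 1).

Definition polydisk_aut (w : V) : V := \row_j disk_aut (z ord0 j) (w ord0 j).

Lemma coord_lt1 (w : V) j : M w < 1 -> rn (w ord0 j) < 1.
Proof. by rewrite -rn_rV; apply: le_lt_trans; exact: rn_coord. Qed.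

Lemma max_lt1 (w : V) : (forall j, rn (w ord0 j) < 1) -> M w < 1.
Proof.
by move=> h; apply: bigmax_lt => // j _; rewrite -rn_cmod.
Qed.

Lemma polydisk_aut_lt1 w : M w < 1 -> M (polydisk_aut w) < 1.
Proof.
by move=> w1; apply: max_lt1 => j; rewrite mxE disk_aut_lt1 ?coord_lt1.
Qed.

Lemma polydisk_autK w : M w < 1 -> polydisk_aut (polydisk_aut w) = w.
Proof.
by move=> w1; apply/rowP => j; rewrite !mxE disk_autK ?coord_lt1.
Qed.

Lemma polydisk_aut_id : polydisk_aut z = 0.
Proof. by apply/rowP => j; rewrite !mxE /disk_aut subrr mul0r. Qed.

Lemma differentiable_polydisk_aut w : M w < 1 -> differentiable polydisk_aut w.
Proof.
move=> w1; apply: differentiable_rV => j.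
have -> : (fun y => polydisk_aut y ord0 j : C^o) =
    (fun y => (z ord0 j - y ord0 j) * (1 - (z ord0 j)^* * y ord0 j)^-1).
  by apply/funext => y; rewrite mxE.
have dj : differentiable (fun y : V => y ord0 j : C^o) w by exact: differentiable_coord.
apply: diff_scalM; first by apply: diff_scalB => //; exact: diff_scal_cst.
apply: (@diff_scalV _ _ _ (fun y : V => 1 - (z ord0 j)^* * y ord0 j)).
  apply: (@diff_scalB _ _ _ (fun=> 1) (fun y : V => (z ord0 j)^* * y ord0 j)).
    exact: diff_scal_cst.
  by apply: (@diff_scalM _ _ _ (fun=> (z ord0 j)^*)) => //; exact: diff_scal_cst.
by apply: disk_aut_den; exact: coord_lt1.
Qed.

Local Notation G w := (\big[Num.max/0]_(i < n)
  `| (cmod (z ord0 i) - cmod (w ord0 i)) / (1 - cmod (w ord0 i) * cmod (z ord0 i)) |).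

Lemma mobmax_le_aut (w : V) : M w < 1 -> G w <= M (polydisk_aut w).
Proof.
move=> w1; apply: le_bigmax2 => j _; rewrite -!rn_cmod mxE.
by apply: disk_aut_ge; exact: coord_lt1.
Qed.

(** Aligning arguments turns each coordinate estimate behind [mobmax_le_aut] into an equality; the
    moduli stay the same, so the point remains on its sphere. *)
Lemma mobmax_aligned (w : V) : M w < 1 ->
  M (polydisk_aut (\row_j align (z ord0 j) (rn (w ord0 j)))) = G w.
Proof.
move=> w1; apply: eq_bigr => j _; rewrite !mxE -!rn_cmod.
by rewrite disk_aut_align ?rn_ge0 ?coord_lt1.
Qed.

Lemma euclid_abs (x y : V) : (forall j, rn (x ord0 j) = rn (y ord0 j)) -> E x = E y.
Proof.
by move=> h; congr Num.sqrt; apply: eq_bigr => j _; rewrite -!rn_cmod h.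
Qed.

Lemma cfor_bigmax (T : topologicalType) (F : 'I_n -> T -> R) (a : T) :
  (forall j, {for a, continuous (F j)}) ->
  {for a, continuous (fun x => \big[Num.max/0]_(j < n) F j x)}.
Proof.
move=> cF; elim: (index_enum 'I_n) => [|j l IH].
  by apply: (@cfor_ext _ _ (fun=> 0)) => [x|]; [rewrite big_nil|exact: cfor_cst].
apply: (@cfor_ext _ _ (fun x => Num.max (F j x) (\big[Num.max/0]_(i <- l) F i x))).
  by move=> x; rewrite big_cons.
exact: (@continuous_max _ _ (F j) (fun x => \big[Num.max/0]_(i <- l) F i x) a (cF j) IH).
Qed.

Lemma mobmax_continuous (w : V) : M w < 1 -> {for w, continuous (fun x : V => G x)}.
Proof.
move=> w1; apply: (@cfor_bigmax V (fun j (x : V) =>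
  `|(cmod (z ord0 j) - cmod (x ord0 j)) / (1 - cmod (x ord0 j) * cmod (z ord0 j))|)) => j.
pose h (x : V) : C := (rc (rn (z ord0 j)) - rc (rn (x ord0 j))) /
  (1 - rc (rn (x ord0 j)) * rc (rn (z ord0 j))).
have hE x : rn (h x) = `|(cmod (z ord0 j) - cmod (x ord0 j)) /
    (1 - cmod (x ord0 j) * cmod (z ord0 j))|.
  by rewrite /h -rc1 -rcM -!rcB -rcV -rcM rn_rc !rn_cmod.
have cj : {for w, continuous (fun x : V => rc (rn (x ord0 j)) : C)}.
  apply: cfor_rc; apply: (@cfor_rn _ _ _ (fun x : V => x ord0 j)).
  exact: continuous_coord.
have ch : {for w, continuous h}.
  apply: cforM; first by apply: cforB; [exact: cfor_cst|exact: cj].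
  apply: cforV.
    apply: cforB; first exact: cfor_cst.
    by apply: cforM; [exact: cj|exact: cfor_cst].
  rewrite -rc1 -rcM -rcB rc_eq0 gt_eqF // mob_gt0 ?rn_ge0 ?coord_lt1 //.
exact: (@cfor_ext _ _ (fun x => rn (h x)) _ w hE (cfor_rn ch)).
Qed.

Lemma compact_sphere : compact [set w : V | E w = r].
Proof.
apply: (@compact_rV_bounded _ _ _ r); last by move=> v <-; exact: rn_euclid.
exact: (closed_preimage (cn_continuous (cnorm_euclid R n)) (@closed_eq _ r)).
Qed.

Lemma sphere_lt1 (w : V) : E w <= r -> M w < 1.
Proof. by move=> wr; apply: le_lt_trans (max_le_euclid w) _; apply: le_lt_trans r1. Qed.

Definition modulus_row (w : V) : V := \row_j rc (rn (w ord0 j)).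

Lemma rn_modulus_row w j : rn (modulus_row w ord0 j) = rn (w ord0 j).
Proof. by rewrite mxE rn_rc ger0_norm ?rn_ge0. Qed.

Lemma euclid_modulus_row w : E (modulus_row w) = E w.
Proof. by apply: euclid_abs => j; exact: rn_modulus_row. Qed.

(* Moving the moduli [|w_i|] towards [|z_i|] until the sphere is reached
   decreases every pseudo-hyperbolic distance. *)
Lemma mobmax_sphere (w : V) : E w <= r -> exists2 u : V, E u = r & G u <= G w.
Proof.
move=> wr; have cE := cnorm_euclid R n.
pose u (t : R) : V := rc (1 - t) *: modulus_row w + rc t *: modulus_row z.
have cu : continuous (fun t => E (u t)).
  move=> t; apply: (cfor_cn cE (g := u)); apply: cforDv.
    apply: cforZv; last exact: cfor_cst.
    by apply: cfor_rc; apply: (@cvgB _ R^o); [exact: cfor_cst|exact: cfor_id].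
  by apply: cforZv; [apply: cfor_rc; exact: cfor_id|exact: cfor_cst].
have u0 : E (u 0) = E w by rewrite /u subr0 rc0 rc1 scale1r scale0r addr0 euclid_modulus_row.
have u1 : E (u 1) = E z by rewrite /u subrr rc0 rc1 scale1r scale0r add0r euclid_modulus_row.
have uj t j : 0 <= t -> t <= 1 ->
    rn (u t ord0 j) = (1 - t) * rn (w ord0 j) + t * rn (z ord0 j).
  move=> t0 t1.
  have p0 : 0 <= (1 - t) * rn (w ord0 j) + t * rn (z ord0 j).
    by rewrite addr_ge0 // mulr_ge0 ?rn_ge0 // subr_ge0.
  by rewrite !mxE -!rcM -rcD rn_rc ger0_norm.
clearbody u.
have hv : Num.min (E (u 0)) (E (u 1)) <= r <= Num.max (E (u 0)) (E (u 1)).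
  by rewrite u0 u1; apply/andP; split; [rewrite ge_min wr|rewrite le_max (ltW rz) orbT].
have [t] := @IVT R (fun t => E (u t)) 0 1 r ler01 (continuous_subspaceT cu) hv.
rewrite in_itv /= => /andP[t0 t1] ut; exists (u t) => //.
apply: le_bigmax2 => j _; rewrite -!rn_cmod.
have w1 : rn (w ord0 j) < 1 by apply: coord_lt1; exact: sphere_lt1.
have zj1 : rn (z ord0 j) < 1 by exact: coord_lt1.
apply: mob_between => //; try exact: rn_ge0.
rewrite uj //; move: (rn (w ord0 j)) (rn (z ord0 j)) => a b.
have [ab|/ltW ab] := leP a b; [left|right].
  have : 0 <= t * (b - a) by rewrite mulr_ge0 // subr_ge0.
  have : 0 <= (1 - t) * (b - a) by rewrite mulr_ge0 // subr_ge0.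
  by move=> h1 h2; apply/andP; split; lra.
have : 0 <= t * (a - b) by rewrite mulr_ge0 // subr_ge0.
have : 0 <= (1 - t) * (a - b) by rewrite mulr_ge0 // subr_ge0.
by move=> h1 h2; apply/andP; split; lra.
Qed.

Lemma closure_ball : closure (norm_ball E r) = [set w : V | E w <= r].
Proof.
have cE := cnorm_euclid R n; apply/seteqP; split.
  have cl : closed [set w : V | E w <= r].
    exact: (closed_preimage (cn_continuous cE) (@closed_le _ r)).
  by rewrite [X in _ `<=` X](iffLR (closure_id _) cl); apply: closureS => w /ltW.
move=> w /= wr B /nbhs_rnP[e e0 he].
have nw := rn_ge0 w.
pose t : R := Num.min (1 / 2) (e / (1 + rn w)).
have t0 : 0 < t by rewrite lt_min divr_gt0 //=; apply: divr_gt0 => //; lra.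
have t1 : t <= 1 / 2 by rewrite ge_min lexx.
have te : t * (1 + rn w) <= e by rewrite -ler_pdivlMr ?ge_min ?lexx ?orbT //; lra.
clearbody t; exists (rc (1 - t) *: w); split.
  rewrite /norm_ball /= (cn_rc cE); last by lra.
  have h : (1 - t) * E w <= (1 - t) * r by rewrite ler_wpM2l //; lra.
  apply: le_lt_trans h _.
  by rewrite mulrBl mul1r ltrBlDr ltrDl mulr_gt0.
apply: he; rewrite rcB rc1 scalerBl scale1r addrAC subrr sub0r rnN rnZ rn_rc gtr0_norm //.
by rewrite mulrDr mulr1 in te; lra.
Qed.

Lemma frontier_ball : frontier (norm_ball E r) = [set w : V | E w = r].
Proof.
have cE := cnorm_euclid R n.
have int : interior (norm_ball E r) = norm_ball E r.
  apply/seteqP; split=> w; first exact: interior_subset.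
  by move=> wr; exact: (nbhs_cn_lt cE wr).
rewrite /frontier closure_ball int; apply/seteqP; split=> w.
  by move=> [/= wr /negP]; rewrite -leNgt => rw; apply: le_anti; rewrite wr.
by move=> /= e; split; rewrite /norm_ball /= e ?ltxx.
Qed.

Lemma polydisk_minus_ballE : polydisk_minus_ball r = ball_minus_ball M E r.
Proof.
rewrite /polydisk_minus_ball closure_ball; apply/seteqP; split=> w.
  by move=> [w1 /negP]; rewrite -ltNge.
by move=> [rw w1]; split=> //=; apply/negP; rewrite -ltNge.
Qed.

(** Let [w] minimize [G] on the sphere. A point [x] of the closed ball satisfies
    [M (polydisk_aut x) >= G x >= G u >= G w] for some [u] on the sphere, and the aligned point [w']
    attains [G w]. So the minimum over the hole is the one in the theorem. *)
Lemma polydisk_invariants : exists m : R,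
  [/\ is_minimum (frontier (norm_ball E r)) (fun w : V => G w) m,
      squeezing M (polydisk_minus_ball r) z = m%:E &
      fridman M (polydisk_minus_ball r) z = m%:E].
Proof.
have cE := cnorm_euclid R n; have cM := cnorm_max.
have Ez0 : 0 < E z by exact: lt_trans rz.
have [|||w Ew wmin] := @compact_min R _ (fun w : V => G w) [set w : V | E w = r].
- exists (rc (r / E z) *: z).
  by rewrite /= (cn_rc cE) ?divr_ge0 ?ltW // divfK // gt_eqF.
- exact: compact_sphere.
- by move=> x /= xr; apply: mobmax_continuous; apply: sphere_lt1; rewrite xr.
have w1 : M w < 1 by apply: sphere_lt1; rewrite Ew.
pose w' : V := \row_j align (z ord0 j) (rn (w ord0 j)).
have Ew' : E w' = r.
  by rewrite -Ew; apply: euclid_abs => j; rewrite mxE rn_align ?rn_ge0.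
have pw' : M (polydisk_aut w') = G w by exact: mobmax_aligned.
have hm x : E x <= r -> G w <= M (polydisk_aut x).
  move=> xr; apply: le_trans (mobmax_le_aut (sphere_lt1 xr)).
  by have [u ur] := mobmax_sphere xr; apply: le_trans; exact: wmin.
have perp (y : V) := @perp_euclid R n y n2.
exists (G w); split.
- rewrite frontier_ball; split; first by exists w.
  by move=> x xr; exact: wmin.
- rewrite polydisk_minus_ballE.
  exact: (squeezing_ball_minus_ball cM cE max_le_euclid r0 r1 norming_max perp rz z1
    differentiable_polydisk_aut polydisk_aut_lt1 polydisk_autK polydisk_aut_id hm Ew' pw').
- rewrite polydisk_minus_ballE.
  exact: (fridman_ball_minus_ball cM cE max_le_euclid r0 r1 norming_max perp rz z1
    differentiable_polydisk_aut polydisk_aut_lt1 polydisk_autK polydisk_aut_id hm Ew' pw').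
Qed.

End PolydiskCase.

Theorem corollary3p2 (R : realType) (n : nat) (r : R)
    (hn : (2 <= n)%N) (hr0 : 0 < r) (hr1 : r < 1) :
  (forall z : 'rV[Cplx R]_n, annulus r z ->
     squeezing (@euclid_norm R n) (annulus r) z =
       ((euclid_norm z - r) / (1 - r * euclid_norm z))%:E /\
     fridman (@euclid_norm R n) (annulus r) z =
       ((euclid_norm z - r) / (1 - r * euclid_norm z))%:E) /\
  (forall z : 'rV[Cplx R]_n, polydisk_minus_ball r z ->
     exists m : R,
       [/\ is_minimum (frontier (norm_ball (@euclid_norm R n) r))
             (fun w => \big[Num.max/0]_(i < n)
                `| (cmod (z ord0 i) - cmod (w ord0 i)) /
                   (1 - cmod (w ord0 i) * cmod (z ord0 i)) |) m,
           squeezing (@max_norm R n) (polydisk_minus_ball r) z = m%:E &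
           fridman (@max_norm R n) (polydisk_minus_ball r) z = m%:E]).
Proof.
split=> z hz; first by have /andP[rz z1] := hz; exact: annulus_invariants.
have : ball_minus_ball (@max_norm R n) (@euclid_norm R n) r z by rewrite -polydisk_minus_ballE.
by case=> rz z1; exact: polydisk_invariants.
Qed.
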